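(* Let $\mathcal I\subseteq\mathcal F\{y_1,\ldots,y_n\}$ be a prime differential ideal of differential dimension $d$, and let $\{A_1,\ldots,A_{n-d}\}$ be a characteristic set of $\mathcal I$ with respect to an orderly ranking. Let $F$ be the differential Chow form of $\mathcal I$. Put $e_i=\mathrm{ord}(A_i)$, $h=\sum_{i=1}^{n-d}e_i$ and $m_i=\deg(A_i)$. Then $$\deg(F)\le 2^{(h+1)(d+1)}\prod_{i=1}^{n-d}m_i^{\,h-e_i+1}\Big(2\sum_{i=1}^{n-d}(m_i-1)+1\Big).$$ In particular, if $D=\max\{2,m_1,\ldots,m_{n-d}\}$, then $\deg(F)<(n-d+1)D^{\,nh+n+3}$.
   Context: $\mathcal F$ is an ordinary differential field of characteristic zero with derivation $\delta$; $a^{(k)}=\delta^k a$. $\mathbb Y=\{y_1,\ldots,y_n\}$ are differential indeterminates and $\mathcal F\{\mathbb Y\}=\mathcal F[y_j^{(k)}:1\le j\le n,\ k\ge 0]$. Prime differential ideals are assumed not to be the unit ideal. $\mathrm{ord}(f)$ is the greatest $k$ such that some $y_i^{(k)}$ appears effectively in $f$, and $\deg$ is the total degree as an algebraic polynomial in all derivatives. A ranking is a total order on the derivatives $\{y_j^{(k)}\}$ with $\delta\alpha>\alpha$ and $\alpha_1>\alpha_2\Rightarrow\delta\alpha_1>\delta\alpha_2$; it is orderly if $k>l\Rightarrow y_i^{(k)}>y_j^{(l)}$ for all $i,j$. The leader $\mathrm{ld}(f)$ is the greatest derivative appearing effectively in $f$. $f$ is reduced w.r.t. $g$ if no proper derivative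 of $\mathrm{ld}(g)$ appears in $f$ and $\deg(f,\mathrm{ld}(g))<\deg(g,\mathrm{ld}(g))$. A set is auto-reduced if each element is reduced w.r.t. every other one. An auto-reduced set $\mathcal C\subset\mathcal J$ is a characteristic set of a differential ideal $\mathcal J$ if $\mathcal J$ contains no nonzero element reduced w.r.t. $\mathcal C$. The differential dimension $d$ of $\mathcal I$ is the differential transcendence degree over $\mathcal F$ of $\mathcal F\langle\eta\rangle$, $\eta$ a generic point of $\mathcal I$; every characteristic set of $\mathcal I$ has $n-d$ elements. Differential Chow form: let $\mathbb P_i=u_{i0}+u_{i1}y_1+\cdots+u_{in}y_n$ $(i=0,\ldots,d)$ with all $u_{ij}$ differential indeterminates over $\mathcal F$, $\mathbf u_i=(u_{i0},\ldots,u_{in})$. The differential ideal $[\mathcal I,\mathbb P_0,\ldots,\mathbb P_d]\cap\mathcal F\{\mathbf u_0,\ldots,\mathbf u_d\}$, where $[\cdot]$ is the differential ideal generated in $\mathcal F\{\mathbb Y,\mathbf u_0,\ldots,\mathbf u_d\}$, is prime of codimension one, and there is an irreducible $F\in\mathcal F\{\mathbf u_0,\ldots,\mathbf u_d\}$, unique up to a nonzero factor in $\mathcal F$, such that $\{F\}$ is a characteristic set of it under any ranking. $F$ is the differential Chow form of $\mathcal I$. *)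

(* Defs.v *)
From mathcomp Require Import all_boot all_algebra.
From mathcomp Require Import finmap.
From mathcomp.multinomials Require Import monalg.

Set Implicit Arguments.
Unset Strict Implicit.
Unset Printing Implicit Defensive.

Import GRing.Theory.
Local Open Scope ring_scope.

Section Derivations.
Context {R : comNzRingType}.

Definition derivation (D : R -> R) : Prop :=
  (forall a b, D (a + b) = D a + D b) /\
  (forall a b, D (a * b) = D a * b + a * D b).

Definition differential_ideal (D : R -> R) (I : R -> Prop) : Prop :=
  [/\ I 0, forall a b, I a -> I b -> I (a + b),
      forall a b, I b -> I (a * b) & forall a, I a -> I (D a)].

Definition prime_differential_ideal (D : R -> R) (I : R -> Prop) : Prop :=
  [/\ differential_ideal D I, ~ I 1 & forall a b, I (a * b) -> I a \/ I b].

Definition generated_differential_ideal (D : R -> R) (S : R -> Prop) : R -> Prop :=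
  fun a => forall I, differential_ideal D I -> (forall b, S b -> I b) -> I a.

Definition invertible (a : R) : Prop := exists b, a * b = 1.

Definition irreducible (a : R) : Prop :=
  [/\ a <> 0, ~ invertible a &
      forall b c, a = b * c -> invertible b \/ invertible c].

End Derivations.

(* F{y_j : j in J}; the pair (j, k) stands for the derivative y_j^(k). *)
Notation dpoly J F := {malg F[{cmonom (J * nat)%type}]}.

Section DifferentialPolynomials.
Context {J : choiceType} {F : fieldType}.

Definition dvar (j : J) (k : nat) : dpoly J F := << ucm (j, k) >>.

(* The derivation of F{Y} extending delta: the coefficients are differentiated,
   and a monomial m contributes, for each y_j^(k) in it, the term
   m(y_j^(k)) * (m / y_j^(k)) * y_j^(k+1). *)
Definition dderiv (delta : F -> F) (p : dpoly J F) : dpoly J F :=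
  \sum_(m <- msupp p)
    (<< delta p@_m *g m >> +
     \sum_(v <- finsupp m)
       << p@_m *+ m v *g mmul (divcm m (ucm v)) (ucm (v.1, v.2.+1)) >>).

Definition dvars (p : dpoly J F) : {fset J * nat} :=
  (\bigcup_(m <- msupp p) finsupp m)%fset.

(* dord and ddeg are 0 on elements of F. *)
Definition dord (p : dpoly J F) : nat := (\max_(v <- dvars p) v.2)%N.

Definition ddeg (p : dpoly J F) : nat := (\max_(m <- msupp p) mdeg m)%N.

Definition ddeg_in (v : J * nat) (p : dpoly J F) : nat := (\max_(m <- msupp p) m v)%N.

End DifferentialPolynomials.

Section Evaluation.
Context {J : choiceType} {F : fieldType} {S : comNzRingType}.

Definition monom_eval (x : J * nat -> S) (m : {cmonom (J * nat)%type}) : S :=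
  \prod_(v <- finsupp m) x v ^+ m v.

(* The differential specialization y_j^(k) |-> D^k (eta j). *)
Definition deval (iota : F -> S) (D : S -> S) (eta : J -> S) (p : dpoly J F) : S :=
  mmap iota (monom_eval (fun v => iter v.2 D (eta v.1))) p.

End Evaluation.

Definition drename {J J' : choiceType} {F : fieldType} (delta : F -> F)
    (f : J -> J') : dpoly J F -> dpoly J' F :=
  deval (fun c => c%:MP) (dderiv delta) (fun j => dvar (f j) 0).

Section Rankings.
Context {J : choiceType} {F : fieldType}.

Definition ranking (le : rel (J * nat)) : Prop :=
  let lt v w := le v w && (v != w) in
  [/\ [/\ reflexive le, antisymmetric le, transitive le & total le],
      forall j k, lt (j, k) (j, k.+1) &
      forall i j k l, lt (i, k) (j, l) -> lt (i, k.+1) (j, l.+1)].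

Definition orderly (le : rel (J * nat)) : Prop :=
  forall i j k l, (l < k)%N -> le (j, l) (i, k) && ((j, l) != (i, k)).

Definition is_leader (le : rel (J * nat)) (p : dpoly J F) (v : J * nat) : Prop :=
  v \in dvars p /\ forall w, w \in dvars p -> le w v.

(* f is reduced with respect to g; only used when g is not in F, so that
   g has a (unique) leader. *)
Definition reduced (le : rel (J * nat)) (f g : dpoly J F) : Prop :=
  forall v, is_leader le g v ->
    (forall k, (v.2 < k)%N -> (v.1, k) \notin dvars f) /\
    (ddeg_in v f < ddeg_in v g)%N.

(* As usual, auto-reduced sets consist of elements having a leader, i.e. of
   elements outside F. *)
Definition autoreduced (le : rel (J * nat)) (T : finType) (C : T -> dpoly J F) : Prop :=
  (forall t, exists v, is_leader le (C t) v) /\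
  (forall s t, s != t -> reduced le (C s) (C t)).

Definition characteristic_set (le : rel (J * nat)) (I : dpoly J F -> Prop)
    (T : finType) (C : T -> dpoly J F) : Prop :=
  [/\ autoreduced le C, forall t, I (C t) &
      forall f, I f -> (forall t, reduced le f (C t)) -> f = 0].

End Rankings.

Section DifferentialDimension.
Context {F : fieldType} (delta : F -> F).
Context {K : fieldType} (iota : {rmorphism F -> K}) (D : K -> K).

Definition differential_extension : Prop :=
  derivation D /\ forall a, D (iota a) = iota (delta a).

Definition differential_subfield (L : K -> Prop) : Prop :=
  [/\ L 1, forall a b, L a -> L b -> L (a - b),
      forall a b, L a -> L b -> L (a / b) & forall a, L a -> L (D a)].

(* F<eta>, the smallest differential subfield containing F and eta. *)
Definition adjoin (J : choiceType) (eta : J -> K) : K -> Prop :=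
  fun x => forall L, differential_subfield L ->
    (forall a, L (iota a)) -> (forall j, L (eta j)) -> L x.

Definition differentially_independent (J : choiceType) (b : J -> K) : Prop :=
  forall p : dpoly J F, deval iota D b p = 0 -> p = 0.

(* A differential transcendence basis is a maximal differentially independent
   family of elements of L. *)
Definition differential_transcendence_basis (L : K -> Prop)
    (J : choiceType) (b : J -> K) : Prop :=
  [/\ forall j, L (b j), differentially_independent b &
      forall x, L x -> ~ differentially_independent (oapp b x)].

Definition has_differential_trdeg (L : K -> Prop) (d : nat) : Prop :=
  exists b : 'I_d -> K, differential_transcendence_basis L b.

Definition generic_point (J : choiceType) (I : dpoly J F -> Prop) (eta : J -> K) : Prop :=
  forall p, I p <-> deval iota D eta p = 0.

End DifferentialDimension.

Definition differential_dimension {F : fieldType} (delta : F -> F) (J : choiceType)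
    (I : dpoly J F -> Prop) (d : nat) : Prop :=
  exists (K : fieldType) (iota : {rmorphism F -> K}) (D : K -> K) (eta : J -> K),
    [/\ differential_extension delta iota D, generic_point iota D I eta &
        has_differential_trdeg iota D (adjoin iota D eta) d].

Section ChowForm.
Context {F : fieldType} (delta : F -> F) (n d : nat).

Definition chow_index : choiceType := ('I_d.+1 * 'I_n.+1)%type.

(* P_i in F{Y, u_0, ..., u_d}: inl j is the index of y_(j+1) and inr (i, j) that
   of u_ij; lift ord0 j is j + 1. *)
Definition generic_hyperplane (i : 'I_d.+1) : dpoly ('I_n + chow_index)%type F :=
  dvar (inr (i, ord0)) 0 +
  \sum_(j < n) dvar (inr (i, lift ord0 j)) 0 * dvar (inl j) 0.

(* [I, P_0, ..., P_d] intersected with F{u_0, ..., u_d}. *)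
Definition chow_ideal (I : dpoly 'I_n F -> Prop) : dpoly chow_index F -> Prop :=
  fun f => generated_differential_ideal (dderiv delta)
    (fun q => (exists2 p, I p & q = drename delta (@inl 'I_n chow_index) p) \/
              (exists i, q = generic_hyperplane i))
    (drename delta (@inr 'I_n chow_index) f).

Definition is_differential_chow_form (I : dpoly 'I_n F -> Prop)
    (f : dpoly chow_index F) : Prop :=
  irreducible f /\
  forall le : rel (chow_index * nat), ranking le ->
    characteristic_set le (chow_ideal I) (fun _ : 'I_1 => f).

End ChowForm.

(* Main.v *)
Require Import Defs.
From HB Require Import structures.
From mathcomp Require Import all_boot all_algebra.
From mathcomp Require Import finmap.
From mathcomp.multinomials Require Import monalg.
From mathcomp Require Import zify ring.
From Stdlib Require Import Classical_Prop ClassicalEpsilon.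

Set Implicit Arguments.
Unset Strict Implicit.
Unset Printing Implicit Defensive.

Import GRing.Theory.
Local Open Scope ring_scope.

(** Write $h$ for the sum of the orders of the $A_t$ and let $\eta$ be a
    generic point of $I$.  In the ring $S = K\{u\}$ of differential polynomials
    over $K = F\langle\eta\rangle$ (or any larger $K$), send $y_j$ to $\eta_j$,
    $u_{ij}$ to itself for $j \geq 1$ and $u_{i0}$ to
    $-\sum_j u_{ij}\eta_j$.  This is a generic zero of the ideal generated by
    $I$ and the hyperplanes $P_i$ ([chow_ideal_vanishes],
    [vanishes_chow_ideal]), so that the Chow form $f$ is the irreducible relation
    between the coordinates $u$ of this point.

    Now forget the derivation and keep the derivatives of order at most $h$ of the
    $y_j$ and the $u_{ij}$.  The point satisfies the algebraic equations
    $P_i^{(k)} = 0$ for $k \leq h$ and $A_t^{(k)} = 0$ for $k \leq h - e_t$, of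
    degrees at most $2$ and $m_t$; each of them determines its leader over the
    other variables, and the variables that are not leaders are algebraically
    independent at the point ([independent_at_chow_zero]).  So the point is generic
    on a variety cut out by these equations with the expected dimension; by
    Bezout's inequality its degree is at most
    $q = 2^{(h+1)(d+1)} \prod_t m_t^{h-e_t+1}$, and the hypersurface $f = 0$ is the
    closure of its projection to $u$-space, whence $\deg f \leq q$.  This is
    [chow_degree]; both inequalities of the theorem follow from it.

    Bezout's inequality is proved in the following elementary form
    ([bezout_elimination]): if there is one more polynomial $G_0, \ldots, G_s$ of
    degree at most $1$ than the dimension, their values at the point satisfy a
    nontrivial algebraic relation of degree at most $q$ in the last of them.  Two
    steps give it.  Counting monomials produces a relation between the $G_i$ and
    the equations themselves ([perron], Perron's theorem), and since the equations
    are triangular they can be replaced by their value $0$ one after the other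
    without destroying the relation ([triangular_specialization]).

    The degree of $f$ is read off from such a relation in [projection_degree].  One
    takes for the $G_i$ the polynomials $w - l_w T$, for the variables $w$ of $f$
    and a new variable $T$ that is given an indeterminate value; then some of the
    variables that are not leaders, to complete the $w$ to a family of the right
    size ([extend_independent], from the exchange property); and $T$ itself as the
    last one.  In terms of the $w$ and $T$ the relation becomes a polynomial that
    vanishes at the point; as all the variables but one are independent there and
    $f$ is irreducible, Gauss's lemma shows that $f$ divides it
    ([common_zero_divides]).  Substituting $w + l_w T$ for $w$ yields that
    $f(w + l_w T)$ divides the relation.  Its degree in $T$ is $\deg f$ if $l$ is
    not a zero of the form of highest degree of $f$; the relation has degree at
    most $q$ in $T$.

    Two further facts are needed.  The order of $f$ is at most $h$
    ([leader_order]): otherwise the derivatives of order at most $h$ of the $u_{ij}$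
    would be independent at the point, while there are enough of them for a
    relation as above.  And $d \leq n$ ([dimension_le]): otherwise $h = 0$ and the
    $u_{ij}$ other than the leader of $f$ would be more independent elements than
    the dimension allows. *)

(** * Unique factorization in iterated polynomial rings *)

Section Factorial.

Definition divides (R : comNzRingType) (p a : R) := exists c, a = p * c.

Definition prime_element (R : comNzRingType) (p : R) :=
  [/\ p <> 0, ~ invertible p &
      forall a b, divides p (a * b) -> divides p a \/ divides p b].

(** The additive function stands for the number of irreducible factors: it makes
    factorizations terminate. *)
Definition factorial_domain (R : idomainType) :=
  (exists N : R -> nat,
     (forall a b, a != 0 -> b != 0 -> N (a * b) = (N a + N b)%N) /\
     (forall a, a != 0 -> N a = 0%N -> invertible a)) /\
  (forall p : R, irreducible p -> prime_element p).

Lemma prime_decomposition (R : idomainType) (c : R) : factorial_domain R ->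
  c != 0 -> exists (s : seq R) (u : R),
    [/\ forall p, p \in s -> prime_element p, invertible u & c = u * \prod_(p <- s) p].
Proof.
move=> [[N [NM N0]] irP]; move En: (N c) => n.
elim/ltn_ind: n c En => n IH c Nc c0.
have [ic|nic] := classic (invertible c).
  by exists [::], c; rewrite big_nil mulr1.
have [irc|nirc] := classic (irreducible c).
  exists [:: c], 1; rewrite big_seq1 mul1r; split=> //; last by exists 1; rewrite mulr1.
  by move=> p; rewrite inE => /eqP ->; apply: irP.
have [a [b [cab [nia nib]]]] : exists a b, c = a * b /\ ~ invertible a /\ ~ invertible b.
  apply: NNPP => H; apply: nirc; split=> // [|a b cab]; first exact/eqP.
  apply: NNPP => H2; apply: H; exists a, b.
  by split=> //; split=> H3; apply: H2; [left|right].
move: (c0); rewrite cab mulf_eq0 negb_or => /andP[a0 b0].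
have Na : (0 < N a)%N by rewrite lt0n; apply/eqP => /(N0 _ a0).
have Nb : (0 < N b)%N by rewrite lt0n; apply/eqP => /(N0 _ b0).
have Nab : (N a + N b = n)%N by rewrite -NM // -cab.
have [|s1 [u1 [p1 i1 e1]]] := IH (N a) _ a erefl a0; first by lia.
have [|s2 [u2 [p2 i2 e2]]] := IH (N b) _ b erefl b0; first by lia.
exists (s1 ++ s2), (u1 * u2); split.
- by move=> p; rewrite mem_cat => /orP[/p1|/p2].
- case: i1 i2 => v1 h1 [v2 h2]; exists (v1 * v2).
  by rewrite mulrACA h1 h2 mulr1.
- by rewrite big_cat /= e1 e2 mulrACA.
Qed.

Section Gauss.
Variable R : idomainType.
Implicit Types p q h : {poly R}.

Definition coef_divides (pi : R) p := forall i, divides pi p`_i.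

Lemma coef_dividesP pi p : coef_divides pi p -> exists q, p = pi *: q.
Proof.
move=> H; suff [s es] : exists s : nat -> R, forall i, (i < size p)%N -> p`_i = pi * s i.
  exists (\poly_(i < size p) s i); apply/polyP => i; rewrite coefZ coef_poly.
  by case: ltnP => [/es //|h]; rewrite mulr0 nth_default.
elim: (size p) => [|n [s es]]; first by exists (fun=> 0).
have [c hc] := H n; exists (fun i => if i == n then c else s i) => i.
by rewrite ltnS leq_eqVlt; case: eqP => [->|] //= _ /es.
Qed.

Lemma divides_add (a b c : R) : divides a b -> divides a c -> divides a (b + c).
Proof. by case=> x -> [y ->]; exists (x + y); rewrite mulrDr. Qed.

Lemma divides_mulr (a b c : R) : divides a b -> divides a (b * c).
Proof. by case=> x ->; exists (x * c); rewrite mulrA. Qed.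

Lemma coef_divides_mul pi q h : coef_divides pi q -> coef_divides pi (q * h).
Proof.
move/coef_dividesP => [q' ->] i; exists (q' * h)`_i.
by rewrite -scalerAl coefZ.
Qed.

Lemma coef_dividesD pi q h : coef_divides pi q -> coef_divides pi h ->
  coef_divides pi (q + h).
Proof. by move=> a b i; rewrite coefD; apply: divides_add. Qed.

Lemma coef_dividesN pi q : coef_divides pi q -> coef_divides pi (- q).
Proof. by move=> a i; rewrite coefN; case: (a i) => c ->; exists (- c); rewrite mulrN. Qed.

(** Gauss's lemma: [pi] divides one of the two leading coefficients, and removing
    that leading term decreases the sum of the sizes. *)
Lemma coef_divides_prime pi : prime_element pi -> forall q h,
  coef_divides pi (q * h) -> coef_divides pi q \/ coef_divides pi h.
Proof.
case=> _ _ pr q h; move En: (size q + size h)%N => n.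
elim/ltn_ind: n q h En => n IH q h En dqh.
have [q0|q0] := eqVneq q 0.
  by left=> i; rewrite q0 coef0; exists 0; rewrite mulr0.
have [h0|h0] := eqVneq h 0.
  by right=> i; rewrite h0 coef0; exists 0; rewrite mulr0.
have dX (a : R) m : divides pi a -> coef_divides pi (a *: 'X^m).
  by move=> da i; rewrite coefZ; apply: divides_mulr.
have trunc p : p != 0 -> (size (p - lead_coef p *: 'X^((size p).-1))%R < size p)%N.
  rewrite -size_poly_gt0 => p0.
  suff : (size (p - lead_coef p *: 'X^((size p).-1))%R <= (size p).-1)%N by move/leq_ltn_trans; apply; rewrite prednK.
  apply/leq_sizeP => j; rewrite leq_eqVlt => /orP[/eqP <-|lj].
    by rewrite coefB coefZ coefXn eqxx mulr1 subrr.
  by rewrite coefB coefZ coefXn gtn_eqF // mulr0 subr0 nth_default // -(prednK p0).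
have := dqh (size (q * h)).-1; rewrite -/(lead_coef _) lead_coefM.
case/pr => dl; [have [] := IH _ _ (q - lead_coef q *: 'X^((size q).-1)) h erefl
               |have [] := IH _ _ q (h - lead_coef h *: 'X^((size h).-1)) erefl].
- by have := trunc q q0; lia.
- by rewrite mulrBl; apply: coef_dividesD => //; apply/coef_dividesN/coef_divides_mul/dX.
- by move=> dq; left; rewrite -[q](subrK (lead_coef q *: 'X^((size q).-1)));
    apply: coef_dividesD => //; apply: dX.
- by right.
- by have := trunc h h0; lia.
- rewrite mulrBr; apply: coef_dividesD => //; apply/coef_dividesN.
  by rewrite mulrC; apply/coef_divides_mul/dX.
- by left.
- by move=> dq; right; rewrite -[h](subrK (lead_coef h *: 'X^((size h).-1)));
    apply: coef_dividesD => //; apply: dX.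
Qed.

Lemma prime_elementC pi : prime_element pi -> prime_element (pi%:P : {poly R}).
Proof.
move=> ppi; case: (ppi) => n0 ni _; split.
- by move/eqP; rewrite polyC_eq0 => /eqP.
- case=> q /(congr1 (fun p : {poly R} => p`_0)); rewrite coefCM coefC eqxx => e.
  by apply: ni; exists q`_0.
- have dC q : divides pi%:P q <-> coef_divides pi q.
    split=> [[q' ->] i|/coef_dividesP [q' ->]]; first by rewrite coefCM; exists q'`_i.
    by exists q'; rewrite mul_polyC.
  by move=> a b /dC /(coef_divides_prime ppi)[]/dC; [left|right].
Qed.

Hypothesis fR : factorial_domain R.

(** Replaces the passage to the fraction field: by Gauss's lemma the prime factors
    of [c] are distributed among [q] and [g]. *)
Lemma clear_denominator c (a q g : {poly R}) : c != 0 -> c *: a = q * g ->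
  exists (c1 c2 : R) (q' g' : {poly R}), [/\ c1 != 0, c2 != 0, q = c1 *: q', g = c2 *: g' & a = q' * g'].
Proof.
move=> c0; have [s [u [ps [v uv] ->]]] := prime_decomposition fR c0.
elim: s ps a q g => [|pi s IH] ps a q g.
  rewrite big_nil mulr1 => e; exists u, 1, (v *: q), g.
  have v0 : v * u = 1 by rewrite mulrC.
  have e1 : v *: (u *: a) = v *: (q * g) by rewrite e.
  move: e1; rewrite scalerA v0 scale1r => e1.
  have u0 : u != 0 by apply: contra_eq_neq uv => ->; rewrite mul0r eq_sym oner_eq0.
  split; rewrite ?oner_eq0 ?scale1r //; first by rewrite scalerA uv scale1r.
  by rewrite -scalerAl.
have ppi : prime_element pi by apply: ps; rewrite mem_head.
have {}IH := IH (fun r (ir : r \in s) => ps r (mem_behead (s := pi :: s) ir)).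
have pi0 : pi != 0 by case: ppi => /eqP.
have scI x y : pi *: x = pi *: y -> x = y :> {poly R}.
  by rewrite -!mul_polyC; apply: mulfI; rewrite polyC_eq0.
rewrite big_cons mulrCA -scalerA => e.
have : coef_divides pi (q * g).
  by move=> i; rewrite -e coefZ; apply/divides_mulr; exists 1; rewrite mulr1.
case/(coef_divides_prime ppi) => /coef_dividesP [q' eq].
  move: e; rewrite eq -scalerAl => /scI /IH [c1 [c2 [q1 [g1 [n1 n2 -> -> ->]]]]].
  exists (pi * c1), c2, q1, g1; split=> //; first by rewrite mulf_neq0.
  by rewrite scalerA.
move: e; rewrite eq -scalerAr => /scI /IH [c1 [c2 [q1 [g1 [n1 n2 -> -> ->]]]]].
exists c1, (pi * c2), q1, g1; split=> //; first by rewrite mulf_neq0.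
by rewrite scalerA.
Qed.

Lemma invertible_polyC (c : R) : invertible (c%:P : {poly R}) -> invertible c.
Proof.
case=> q /(congr1 (fun p : {poly R} => p`_0)); rewrite coefCM coefC eqxx => e.
by exists q`_0.
Qed.

Lemma invertible_size (p : {poly R}) : invertible p -> size p = 1%N.
Proof.
case=> q e; have /eqP : size (p * q) = 1%N by rewrite e size_poly1.
by rewrite size_mul_eq1 => /andP[/eqP].
Qed.

Lemma primitive_cancel c (p a h : {poly R}) : irreducible p -> (1 < size p)%N ->
  c != 0 -> c *: a = p * h -> divides p a.
Proof.
move=> [_ _ irp] sp c0 /(clear_denominator c0) [c1 [c2 [p' [h' [n1 n2 ep eh ea]]]]].
have : p = c1%:P * p' by rewrite mul_polyC.
case/irp => [/invertible_polyC [d cd]|/invertible_size sp'].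
  exists (d *: h'); rewrite ep -scalerAr -scalerAl scalerA.
  by rewrite mulrC cd scale1r.
by move: sp; rewrite ep size_scale // sp'.
Qed.

(** Coprimality over a domain is coprimality over its fraction field. A common
    divisor of positive degree, once its denominators are cleared, must be [p] up to
    a constant since [p] is irreducible. *)
Lemma irreducible_divides_noncoprime (p a : {poly R}) : irreducible p -> (1 < size p)%N ->
  ~~ coprimep p a -> divides p a.
Proof.
move=> irp sp; set g := gcdp p a => ncop.
have /Pdiv.Idomain.dvdpP [[c q] /= c0 e1] : g %| p by apply: dvdp_gcdl.
have /Pdiv.Idomain.dvdpP [[c' q2] /= c'0 e2] : g %| a by apply: dvdp_gcdr.
have [c1 [c2 [q' [g' [n1 n2 eq eg ep]]]]] := clear_denominator c0 e1.
case: (irp) => p0 _ /(_ _ _ ep) [/invertible_size sq|/invertible_size sg]; last first.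
  by move: ncop; rewrite coprimep_def -/g eg size_scale // sg.
have [r er] : exists r, q = r%:P.
  by exists q`_0; apply: size1_polyC; rewrite eq size_scale // sq.
have r0 : r != 0.
  apply/eqP => r0; move: e1; rewrite er r0 polyC0 mul0r => /eqP.
  by rewrite -mul_polyC mulf_eq0 polyC_eq0 (negPf c0) /= => /eqP.
apply: (@primitive_cancel (r * c') _ _ (c *: q2)) => //; first by rewrite mulf_neq0.
by rewrite -scalerA e2 -scalerAr [c *: _]scalerAl e1 er mul_polyC -scalerAl (mulrC g).
Qed.

(** Irreducible constants are prime by Gauss's lemma. An irreducible polynomial of
    positive degree that does not divide [a] is coprime to it over the fraction
    field, hence divides [b] there, and denominators can be cleared. *)
Lemma factorial_poly : factorial_domain {poly R}.
Proof.
case: (fR) => [[N [NM N0]] irP]; split.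
  exists (fun p : {poly R} => (size p).-1 + N (lead_coef p))%N; split=> [a b a0 b0|a a0].
    rewrite size_mul // lead_coefM NM ?lead_coef_eq0 //.
    by move: a0 b0; rewrite -!size_poly_gt0; lia.
  move/eqP; rewrite addn_eq0 => /andP[/eqP sa /eqP Na].
  have ea : a = (lead_coef a)%:P.
    by rewrite /lead_coef sa; apply: size1_polyC; move: sa; lia.
  have [|b ab] := N0 _ _ Na; first by rewrite lead_coef_eq0.
  by exists b%:P; rewrite ea -polyCM ab.
move=> p irp; case: (irp) => p0 nip pP.
have [sp|sp] := leqP (size p) 1.
  rewrite (size1_polyC sp); apply/prime_elementC/irP; split.
  - by move=> e; apply: p0; rewrite (size1_polyC sp) e.
  - case=> b e; apply: nip; exists b%:P.
    by rewrite (size1_polyC sp) -polyCM e.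
  - move=> b c e; have := pP b%:P c%:P; rewrite -polyCM -e -size1_polyC // => /(_ erefl).
    by case=> /invertible_polyC; [left|right].
split=> // a b [c eab].
have [cop|ncop] := boolP (coprimep p a); last first.
  by left; apply: irreducible_divides_noncoprime.
have dab : p %| a * b by rewrite eab dvdp_mulIl.
right; rewrite Gauss_dvdpr // in dab.
have /Pdiv.Idomain.dvdpP [[e q] /= e0 eb] := dab.
by apply: (primitive_cancel irp sp e0); rewrite eb mulrC.
Qed.

End Gauss.
End Factorial.

Section IteratedPolynomials.
Variable K : fieldType.

(** The polynomials in variables of indices [0], ..., [n - 1], the outermost one being
    that of index [n - 1]. Unlike monoid algebras, they inherit unique factorization
    by recursion on [n], and have a distinguished variable in which degrees are
    measured. *)
Fixpoint itp (n : nat) : idomainType := if n is n'.+1 then {poly (itp n')} else K.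

Lemma itp_factorial n : factorial_domain (itp n).
Proof.
elim: n => [|n IH]; last exact: factorial_poly.
split.
  exists (fun=> 0%N); split=> // a a0 _; exists a^-1; exact: mulfV.
move=> p [/eqP p0 []]; exists p^-1; exact: mulfV.
Qed.

Fixpoint itC n : {rmorphism K -> itp n} :=
  if n is n'.+1 then (polyC \o itC n') : {rmorphism K -> {poly (itp n')}} else idfun.

Fixpoint itX n (i : nat) : itp n :=
  if n is n'.+1 return itp n then (if i == n' then 'X else (itX n' i)%:P) else 0.

Section Eval.
Variables (S : comNzRingType) (iota : {rmorphism K -> S}).

Fixpoint itev (x : nat -> S) n : {rmorphism itp n -> S} :=
  if n is n'.+1 then horner_eval (x n') \o map_poly (itev x n') : {rmorphism {poly itp n'} -> S}
  else iota.

Lemma itevS x n (p : itp n.+1) : itev x n.+1 p = (map_poly (itev x n) p).[x n].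
Proof. by []. Qed.

Lemma itevC x n c : itev x n (itC n c) = iota c.
Proof.
elim: n => //= n IH; rewrite /horner_eval map_polyC hornerC; exact: IH.
Qed.

Lemma itevX x n i : (i < n)%N -> itev x n (itX n i) = x i.
Proof.
elim: n => //= n IH; rewrite ltnS leq_eqVlt.
case: eqP => [->|_] /= h; first by rewrite /horner_eval map_polyX hornerX.
by rewrite /horner_eval map_polyC hornerC; exact: IH.
Qed.

Lemma eq_itev x y n (p : itp n) : (forall i, (i < n)%N -> x i = y i) ->
  itev x n p = itev y n p.
Proof.
elim: n p => // n IH p e; rewrite !itevS e //; congr (horner _ _).
by apply: eq_map_poly => c; apply: IH => i h; apply: e; apply: ltnW.
Qed.

End Eval.

Lemma itev_comp (S S' : comNzRingType) (iota : {rmorphism K -> S}) (g : {rmorphism S -> S'})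
    (iota' : {rmorphism K -> S'}) x n (p : itp n) :
  (forall c, iota' c = g (iota c)) ->
  g (itev iota x n p) = itev iota' (g \o x) n p.
Proof.
move=> e; elim: n p => [|n IH] p; first by rewrite /= e.
rewrite !itevS -horner_map /= -map_poly_comp; congr (horner _ _).
by apply: eq_map_poly => c; apply: IH.
Qed.

Lemma itev_id n (p : itp n) : itev (itC n) (itX n) n p = p.
Proof.
elim: n p => // n IH p; rewrite itevS /= eqxx.
rewrite -[RHS]comp_polyXr /comp_poly; congr (horner _ _).
apply: eq_map_poly => c.
rewrite (@eq_itev _ _ _ (polyC \o itX n)); last first.
  by move=> i h; rewrite /= ltn_eqF.
rewrite -(@itev_comp _ _ (itC n) (@polyC (itp n))) //=.
by rewrite IH.
Qed.

End IteratedPolynomials.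

(** * Polynomials in an arbitrary set of variables *)

Notation mpol V K := {malg K[{cmonom V}]}.

Lemma malgUU (V : choiceType) (R : comNzRingType) (c1 c2 : R) (m1 m2 : {cmonom V}) :
  << c1 *g m1 >> * << c2 *g m2 >> = << c1 * c2 *g mmul m1 m2 >> :> mpol V R.
Proof. exact: fgmulUU. Qed.

Section Support.
Variables (V : choiceType) (R : comNzRingType).
Implicit Types (p q : mpol V R) (m : {cmonom V}).

(** Bounds on the variables and on the degree of a polynomial are both conditions on
    the monomials that occur in it. *)
Definition monomials_in (Q : {cmonom V} -> Prop) p := forall m, p@_m != 0 -> Q m.

Lemma monomials_in0 Q : monomials_in Q (0 : mpol V R).
Proof. by move=> m; rewrite mcoeff0 eqxx. Qed.

Lemma monomials_inD Q p q : monomials_in Q p -> monomials_in Q q -> monomials_in Q (p + q).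
Proof.
move=> hp hq m; rewrite mcoeffD; have [->|/hp//] := eqVneq p@_m 0.
by rewrite add0r; apply: hq.
Qed.

Lemma monomials_inN Q p : monomials_in Q p -> monomials_in Q (- p).
Proof. by move=> hp m; rewrite mcoeffN oppr_eq0; apply: hp. Qed.

Lemma monomials_in_sum Q (I : Type) (r : seq I) (P : pred I) (f : I -> mpol V R) :
  (forall i, P i -> monomials_in Q (f i)) -> monomials_in Q (\sum_(i <- r | P i) f i).
Proof.
move=> h; apply: (big_ind (monomials_in Q)) => //; first exact: monomials_in0.
exact: monomials_inD.
Qed.

Lemma monomials_inM (Q1 Q2 Q3 : {cmonom V} -> Prop) p q :
  (forall m1 m2, Q1 m1 -> Q2 m2 -> Q3 (mmul m1 m2)) ->
  monomials_in Q1 p -> monomials_in Q2 q -> monomials_in Q3 (p * q).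
Proof.
move=> H h1 h2 m; rewrite mcoeff_neq0 => /msuppM_le [m1 [m2 [i1 i2 ->]]].
by apply: H; [apply: h1|apply: h2]; rewrite mcoeff_neq0.
Qed.

Lemma monomials_inU (Q : {cmonom V} -> Prop) c m : Q m -> monomials_in Q (<< c *g m >> : mpol V R).
Proof. by move=> h m'; rewrite mcoeffU; case: (eqVneq m m') => [<- //|_]; rewrite mulr0n eqxx. Qed.

Lemma monomials_inW (Q Q' : {cmonom V} -> Prop) p : (forall m, Q m -> Q' m) ->
  monomials_in Q p -> monomials_in Q' p.
Proof. by move=> h hp m /hp/h. Qed.

Definition vars_in (P : V -> Prop) := monomials_in (fun m => forall v, m v != 0%N -> P v).
Definition deg_le (n : nat) := monomials_in (fun m => (mdeg m <= n)%N).

Lemma vars_inM P p q : vars_in P p -> vars_in P q -> vars_in P (p * q).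
Proof.
apply: monomials_inM => m1 m2 h1 h2 v; rewrite cmM addn_eq0 negb_and.
by case/orP => [/h1|/h2].
Qed.

Lemma vars_inC P c : vars_in P (c%:MP : mpol V R).
Proof. by apply: monomials_inU => v; rewrite cm1. Qed.

Lemma vars_inX (P : V -> Prop) v : P v -> vars_in P (<< ucm v >> : mpol V R).
Proof. by move=> h; apply: monomials_inU => w; rewrite cmU; case: (eqVneq v w) => [<-|_]. Qed.

Lemma vars_inW (P P' : V -> Prop) p : (forall v, P v -> P' v) -> vars_in P p -> vars_in P' p.
Proof. by move=> h; apply: monomials_inW => m hm v /hm/h. Qed.

Lemma vars_in_exp P p n : vars_in P p -> vars_in P (p ^+ n).
Proof.
move=> h; elim: n => [|n IH]; first by rewrite expr0 -mpolyC1E; apply: vars_inC.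
by rewrite exprS; apply: vars_inM.
Qed.

Lemma vars_in_prod P (I : Type) (r : seq I) (f : I -> mpol V R) :
  (forall i, vars_in P (f i)) -> vars_in P (\prod_(i <- r) f i).
Proof.
move=> h; apply: (big_ind (vars_in P)) => //; last exact: vars_inM.
by rewrite -mpolyC1E; apply: vars_inC.
Qed.

Lemma deg_leM a b p q : deg_le a p -> deg_le b q -> deg_le (a + b) (p * q).
Proof. by apply: monomials_inM => m1 m2 h1 h2; rewrite mdegM leq_add. Qed.

Lemma deg_leC c n : deg_le n (c%:MP : mpol V R).
Proof. by apply: monomials_inU; rewrite mdeg1. Qed.

Lemma deg_leX v n : (0 < n)%N -> deg_le n (<< ucm v >> : mpol V R).
Proof. by move=> h; apply: monomials_inU; rewrite mdegU. Qed.

Lemma deg_leW a b p : (a <= b)%N -> deg_le a p -> deg_le b p.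
Proof. by move=> h; apply: monomials_inW => m /leq_trans; apply. Qed.

Lemma deg_le_exp a p n : deg_le a p -> deg_le (a * n) (p ^+ n).
Proof.
move=> h; elim: n => [|n IH]; first by rewrite expr0 -mpolyC1E; apply: deg_leC.
by rewrite exprS mulnS; apply: deg_leM.
Qed.

Lemma deg_le_prod (I : Type) (r : seq I) (f : I -> mpol V R) (a : I -> nat) :
  (forall i, deg_le (a i) (f i)) -> deg_le (\sum_(i <- r) a i) (\prod_(i <- r) f i).
Proof.
move=> h; apply: (big_ind2 (fun p n => deg_le n p)) => //.
- by rewrite -mpolyC1E; apply: deg_leC.
- by move=> p a' q b'; apply: deg_leM.
Qed.

End Support.

Section Evaluation.
Variable V : choiceType.

Section Monom.
Variables (S : comNzRingType) (x : V -> S).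
Definition mev (m : {cmonom V}) : S := \prod_(v <- finsupp m) x v ^+ m v.

Lemma mevEw (d : {fset V}) (m : {cmonom V}) : (finsupp m `<=` d)%fset ->
  mev m = \prod_(v <- d) x v ^+ m v.
Proof.
move=> le; rewrite [LHS](big_fset_incl _ le) // => v _.
by rewrite -cmE_neq0 negbK => /eqP ->; rewrite expr0.
Qed.

Lemma mev_is_mmorphism : mmorphism mev.
Proof.
split=> [m1 m2|]; last by rewrite /mev mdom1 big_seq_fset0.
rewrite /mev mdomD -!/(mev _).
rewrite (mevEw (fsubsetUl _ (finsupp m2))) (mevEw (fsubsetUr (finsupp m1) _)).
by rewrite -big_split /=; apply: eq_bigr => v _; rewrite cmM exprD.
Qed.

HB.instance Definition _ := isMultiplicative.Build {cmonom V} S mev mev_is_mmorphism.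

Lemma mevU v : mev (ucm v) = x v.
Proof. by rewrite /mev mdomU big_seq_fset1 cmUU expr1. Qed.
End Monom.

Lemma eq_mev (S : comNzRingType) (x y : V -> S) (m : {cmonom V}) :
  (forall v, m v != 0%N -> x v = y v) -> mev x m = mev y m.
Proof.
move=> e; rewrite /mev big_seq [RHS]big_seq; apply: eq_bigr => v vm.
by rewrite e // cmE_neq0.
Qed.

Definition ev (R S : comNzRingType) (iota : {rmorphism R -> S}) (x : V -> S) :
  {rmorphism mpol V R -> S} := mmap iota (mev x).

Section Ev.
Variables (R S : comNzRingType) (iota : {rmorphism R -> S}).
Implicit Types (x y : V -> S) (p : mpol V R).

Lemma evE x p : ev iota x p = \sum_(m <- msupp p) iota p@_m * mev x m.
Proof. by []. Qed.

Lemma evC x c : ev iota x c%:MP = iota c.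
Proof. exact: mmapC. Qed.

Lemma evU x c m : ev iota x << c *g m >> = iota c * mev x m.
Proof. exact: mmapU. Qed.

Lemma evX x v : ev iota x << ucm v >> = x v.
Proof. by rewrite evU rmorph1 mul1r mevU. Qed.

Lemma eq_ev x y p : vars_in (fun v => x v = y v) p -> ev iota x p = ev iota y p.
Proof.
move=> e; rewrite !evE big_seq [RHS]big_seq; apply: eq_bigr => m; rewrite -mcoeff_neq0.
by move/e => em; congr (_ * _); apply: eq_mev.
Qed.

Lemma rmorph_ev (S' : comNzRingType) (g : {rmorphism S -> S'}) (iota' : {rmorphism R -> S'}) x p :
  (forall c, iota' c = g (iota c)) -> g (ev iota x p) = ev iota' (g \o x) p.
Proof.
move=> e; rewrite !evE rmorph_sum; apply: eq_bigr => m _.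
rewrite rmorphM e; congr (_ * _); rewrite /mev rmorph_prod.
by apply: eq_bigr => v _; rewrite rmorphXn.
Qed.

End Ev.

(** Every monomial is the product of its variables: the multiplicative structure of
    the monomials is compared with that of the polynomials one variable at a time. *)
Lemma malg_prodU (R : comNzRingType) (m : {cmonom V}) :
  << m >> = mev (fun v => << ucm v >> : mpol V R) m.
Proof.
have pw v n : (<< ucm v >> : mpol V R) ^+ n = << iter n (mmul (ucm v)) (@mone {cmonom V}) >>.
  elim: n => [|n IH]; first by rewrite expr0 -mpolyC1E.
  rewrite exprS IH malgUU mul1r iterS; reflexivity.
have it v n w : iter n (mmul (ucm v)) (@mone {cmonom V}) w = ((v == w) * n)%N.
  by elim: n => [|n IH] /=; rewrite ?cm1 ?muln0 // cmM IH cmU mulnS.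
have gen (r : seq V) : \prod_(v <- r) (<< ucm v >> : mpol V R) ^+ m v =
   << \big[mmul/@mone {cmonom V}]_(v <- r) iter (m v) (mmul (ucm v)) (@mone {cmonom V}) >>.
  elim: r => [|v r IH]; first by rewrite !big_nil.
  rewrite !big_cons IH pw malgUU mul1r; reflexivity.
rewrite /mev gen; congr << _ >>; apply/eqP/cmP => w.
have := fset_uniq (finsupp m).
have -> : m w = if w \in finsupp m then m w else 0%N by case: mdomP.
rewrite -[w \in finsupp m]/(w \in (finsupp m : seq V)).
elim: (finsupp m : seq V) => [|v r IH] /=; first by rewrite big_nil cm1.
case/andP => nr ur; rewrite big_cons cmM it -IH // inE.
have [evw|_] := eqVneq v w; last by rewrite mul0n add0n.
by move: nr; rewrite evw mul1n => /negPf ->; rewrite addn0.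
Qed.

(** The universal property of polynomial rings. *)
Lemma rmorph_malg_ev (R S : comNzRingType) (g : {rmorphism mpol V R -> S})
   (iota : {rmorphism R -> S}) p :
  (forall c, g c%:MP = iota c) -> g p = ev iota (fun v => g << ucm v >>) p.
Proof.
move=> e; rewrite [in LHS](monalgE p) rmorph_sum evE; apply: eq_bigr => m _.
have -> : << p@_m *g m >> = (p@_m)%:MP * << m >> :> mpol V R.
  by rewrite malgUU mulr1 mul1m.
rewrite rmorphM; congr (_ * _); first exact: e.
rewrite malg_prodU /mev rmorph_prod; apply: eq_bigr => v _; exact: rmorphXn.
Qed.

Definition malgCr (R : comNzRingType) : {rmorphism R -> mpol V R} := @malgC {cmonom V} R.

Lemma ev_id (R : comNzRingType) (p : mpol V R) :
  ev (malgCr R) (fun v => << ucm v >>) p = p.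
Proof. by rewrite -(@rmorph_malg_ev _ _ idfun). Qed.

End Evaluation.

Section IteratedVersusMonoidAlgebra.
Variables (V : choiceType) (K : fieldType) (xs : seq V) (n : nat).
Hypotheses (uxs : uniq xs) (sxs : size xs = n).

(** With [malg_it], identifies the iterated polynomials with the polynomials whose
    variables belong to the list [xs], the variable of index [i] being the [i]-th
    entry of [xs]. *)
Definition it_malg : {rmorphism itp K n -> mpol V K} :=
  itev (@malgCr V K) (nth 0 [seq << ucm v >> | v <- xs]) n.

Definition malg_it : {rmorphism mpol V K -> itp K n} :=
  ev (itC K n) (fun v => itX K n (index v xs)).

Lemma it_malgK : cancel it_malg malg_it.
Proof.
move=> p; rewrite /it_malg (itev_comp (iota' := itC K n)) => [|c]; last exact/esym/evC.
rewrite -[RHS]itev_id; apply: eq_itev => i lin; rewrite -sxs in lin.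
have v0 : V by case: xs lin => [//|v ? _]; exact: v.
rewrite /= (nth_map v0); last exact: lin.
rewrite evX; have -> := index_uniq v0 lin uxs; reflexivity.
Qed.

Lemma malg_itK p : vars_in (fun v => v \in xs) p -> it_malg (malg_it p) = p.
Proof.
move=> vp; rewrite /malg_it (rmorph_ev (iota' := @malgCr V K)) => [|c]; last first.
  by rewrite /it_malg itevC.
rewrite -[RHS]ev_id; apply: eq_ev => m pm v vm; have vxs := vp m pm v vm.
rewrite /= /it_malg itevX; last by rewrite -sxs index_mem.
rewrite (nth_map v); last by rewrite index_mem.
have -> := nth_index v vxs; reflexivity.
Qed.

Lemma ev_it_malg (S : comNzRingType) (iota : {rmorphism K -> S}) (x : V -> S) p :
  ev iota x (it_malg p) = itev iota (nth 0 [seq x v | v <- xs]) n p.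
Proof.
rewrite /it_malg (itev_comp (iota' := iota)) => [|c]; last exact/esym/evC.
apply: eq_itev => i; rewrite -sxs => lin.
have v0 : V by case: xs lin => [//|v ? _]; exact: v.
rewrite /= (nth_map v0); last exact: lin.
rewrite (nth_map v0); last exact: lin.
exact: evX.
Qed.

End IteratedVersusMonoidAlgebra.

Section MonoidAlgebraDomain.
Variables (V : choiceType) (K : fieldType).
Implicit Types p q : mpol V K.

Definition mvars (R : nzRingType) (p : mpol V R) : {fset V} :=
  (\bigcup_(m <- msupp p) finsupp m)%fset.

Lemma mvarsP (R : nzRingType) (p : mpol V R) v :
  reflect (exists2 m, p@_m != 0 & m v != 0%N) (v \in mvars p).
Proof.
apply: (iffP (bigfcupP _ _ _ _)) => [[m]|[m]].
  by rewrite andbT -mcoeff_neq0 -cmE_neq0; exists m.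
by rewrite mcoeff_neq0 cmE_neq0 => h1 h2; exists m; rewrite ?h1.
Qed.

Lemma vars_in_mvars (R : comNzRingType) (p : mpol V R) : vars_in (fun v => v \in mvars p) p.
Proof. by move=> m pm v vm; apply/mvarsP; exists m. Qed.

Lemma vars_in_subset (R : comNzRingType) (P : V -> Prop) (p : mpol V R) :
  vars_in P p <-> (forall v, v \in mvars p -> P v).
Proof.
split=> [h v /mvarsP [m pm vm]|h]; first exact: (h m).
exact: vars_inW h (@vars_in_mvars _ p).
Qed.

(** Two polynomials involve finitely many variables, and iterated polynomial rings
    are domains. *)
Lemma malg_mul_eq0 p q : p * q = 0 -> (p == 0) || (q == 0).
Proof.
move=> pq0; pose xs : seq V := enum_fset (mvars p `|` mvars q)%fset.
have uxs : uniq xs by apply: fset_uniq.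
have vp : vars_in (fun v => v \in xs) p.
  by apply/vars_in_subset => v h; rewrite in_fsetU h.
have vq : vars_in (fun v => v \in xs) q.
  by apply/vars_in_subset => v h; rewrite in_fsetU h orbT.
have := congr1 (malg_it K xs (size xs)) pq0; rewrite rmorphM rmorph0 => /eqP.
rewrite mulf_eq0 => /orP[]/eqP e0; apply/orP; [left|right]; apply/eqP.
  by have <- := malg_itK erefl vp; rewrite e0 rmorph0.
by have <- := malg_itK erefl vq; rewrite e0 rmorph0.
Qed.

Definition malg_unit : {pred mpol V K} :=
  fun p => if excluded_middle_informative (invertible p) then true else false.

Definition malg_inv (p : mpol V K) : mpol V K :=
  if excluded_middle_informative (invertible p) is left ip
  then proj1_sig (constructive_indefinite_description _ ip) else p.

Fact malg_mulVx : {in malg_unit, left_inverse 1 malg_inv *%R}.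
Proof.
move=> p; rewrite unfold_in /malg_unit /malg_inv.
case: excluded_middle_informative => // ip _.
by case: constructive_indefinite_description => q /= <-; rewrite mulrC.
Qed.

Fact malg_unitPl (p q : mpol V K) : q * p = 1 -> malg_unit p.
Proof.
move=> qp; rewrite /malg_unit; case: excluded_middle_informative => // [[]].
by exists q; rewrite mulrC.
Qed.

Fact malg_inv_out : {in [predC malg_unit], malg_inv =1 id}.
Proof.
by move=> p; rewrite !inE unfold_in /malg_unit /malg_inv; case: excluded_middle_informative.
Qed.

HB.instance Definition _ := GRing.ComNzRing_hasMulInverse.Build (malg {cmonom V} K)
  malg_mulVx malg_unitPl malg_inv_out.
HB.instance Definition _ := GRing.ComUnitRing_isIntegral.Build (malg {cmonom V} K) malg_mul_eq0.

End MonoidAlgebraDomain.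


(** * Perron's theorem by counting monomials *)

Lemma linear_dependency (K : fieldType) (I J : finType) (a : I -> J -> K) :
  (#|J| < #|I|)%N ->
  exists k : I -> K, (exists i, k i != 0) /\ forall j, \sum_i k i * a i j = 0.
Proof.
move=> ltJI; pose A := \matrix_(i < #|I|, j < #|J|) a (enum_val i) (enum_val j).
have kA : kermx A != 0.
  rewrite kermx_eq0 /row_free; apply/eqP => rA.
  by move: ltJI; rewrite -rA ltnNge rank_leq_col.
pose v := nz_row (kermx A).
have vA : v *m A = 0 by apply/sub_kermxP/nz_row_sub.
have /rV0Pn [i vi] : v != 0 by rewrite nz_row_eq0.
exists (fun i => v 0 (enum_rank i)); split; first by exists (enum_val i); rewrite enum_valK.
move=> j; move/matrixP/(_ 0 (enum_rank j)): vA; rewrite !mxE => vA0.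
rewrite -[RHS]vA0 [RHS](reindex enum_rank) /=; last exact/onW_bij/enum_rank_bij.
by apply: eq_bigr => i' _; rewrite mxE !enum_rankK.
Qed.

Section Counting.
Local Open Scope nat_scope.

(** Each step multiplies the binomial by a quotient $(M+b+1)/(b+1)$ with
    $b \geq Mk$, which is at most $(k+1)/k$. *)
Lemma bin_ratio M k B c : M * k <= B ->
  'C(M + (B + c), M) * k ^ c <= 'C(M + B, M) * k.+1 ^ c.
Proof.
move=> MkB; elim: c => [|c IH]; first by rewrite addn0.
have := mul_bin_down (M + (B + c)).+1 M.
rewrite -addnS addKn /= addnS /= => e.
have h : 'C(M + (B + c).+1, M) * k <= 'C(M + (B + c), M) * k.+1.
  rewrite -(leq_pmul2l (ltn0Sn (B + c))).
  rewrite -addnS in e; move: e; set x := 'C(_, _); set y := 'C(_, _) => e.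
  have -> : (B + c).+1 * (y * k) = (M + (B + c).+1) * x * k by rewrite e mulnA.
  nia.
rewrite addnS !expnSr.
move: h IH; set x := 'C(_, _); set y := 'C(_, _); set z := 'C(_, _).
set s := k ^ c; set t := k.+1 ^ c => h IH.
have : x * k * s <= y * k.+1 * s by rewrite leq_mul2r h orbT.
have : y * s * k.+1 <= z * t * k.+1 by rewrite leq_mul2r IH orbT.
nia.
Qed.

(** Bernoulli's inequality, in the form $(1 + 1/k)^c (1 - c/k) \leq 1$. *)
Lemma power_ratio k c : c <= k -> k.+1 ^ c * (k - c) <= k ^ c * k.
Proof.
elim: c => [|c IH] ck; first by rewrite subn0.
have {}IH := IH (ltnW ck).
rewrite !expnSr; have h : k.+1 * (k - c.+1) <= k * (k - c) by nia.
have : k.+1 ^ c * (k.+1 * (k - c.+1)) <= k.+1 ^ c * (k * (k - c)) by rewrite leq_mul2l h orbT.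
by move: IH; set x := k.+1 ^ c; set y := k ^ c; nia.
Qed.

(** The binomial is a polynomial in $B$ of degree $M$, so that its quotient at
    $B + q$ and $B$ tends to $1$. *)
Lemma bin_growth q M : exists B, q * 'C(M + (B + q), M) < q.+1 * 'C(M + B, M).
Proof.
have [k [qk h4 h5]] : exists k, [/\ q <= k, q * k < q.+1 * (k - q) & 0 < k - q].
  by exists (q * q.+1).+1; split; nia.
exists (M * k).
have hr := bin_ratio q (leqnn (M * k)).
have hp := power_ratio qk.
have b0 : 0 < 'C(M + M * k, M) by rewrite bin_gt0 leq_addr.
have k0 : 0 < k ^ q by rewrite expn_gt0; case: (k) h5.
have h3 : 'C(M + (M * k + q), M) * (k - q) <= 'C(M + M * k, M) * k.
  rewrite -(leq_pmul2r k0).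
  move: hr hp; set x := 'C(_, _); set y := 'C(_, _); set z := k ^ q; set t := k.+1 ^ q.
  set d := k - q => h1 h2.
  have : x * z * d <= y * t * d by rewrite leq_mul2r h1 orbT.
  have : y * (t * d) <= y * (z * k) by rewrite leq_mul2l h2 orbT.
  nia.
rewrite -(ltn_pmul2r h5); move: h3 h4 b0.
set x := 'C(_, _); set y := 'C(_, _); set d := k - q => h3 h4' b0.
have h1 : q * (x * d) <= q * (y * k) by rewrite leq_mul2l h3 orbT.
have h2 : (q * k) * y < (q.+1 * d) * y by rewrite ltn_pmul2r.
rewrite -mulnA; apply: leq_ltn_trans h1 _.
by rewrite [y * k]mulnC mulnA [q.+1 * y * d]mulnAC.
Qed.

(** Dividing each entry of a tuple of sum at most [B] by its weight yields quotients
    of weighted sum at most [B], together with one of [\prod_i w i] tuples of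
    remainders. *)
Lemma count_weighted n B (w : 'I_n -> nat) : (forall i, 0 < w i) ->
  'C(n + B, n) <=
  #|[set a : {ffun 'I_n -> 'I_B.+1} | \sum_i w i * a i <= B]| * \prod_i w i.
Proof.
move=> w0; rewrite -card_partial_ord_partitions.
have -> : \prod_i w i = #|{: {dffun forall i : 'I_n, 'I_(w i)}}|.
  by rewrite card_dep_ffun foldrE big_map -big_enum /=; apply: eq_bigr => i _; rewrite card_ord.
set T := [set t | _]; set A := [set t | _].
have lt_mod (t : n.-tuple 'I_B.+1) i : tnth t i %% w i < w i by rewrite ltn_mod.
have lt_div (t : n.-tuple 'I_B.+1) i : tnth t i %/ w i < B.+1.
  by rewrite ltnS (leq_trans (leq_div _ _)) // -ltnS.
pose g (t : n.-tuple 'I_B.+1) : {ffun 'I_n -> 'I_B.+1} * {dffun forall i : 'I_n, 'I_(w i)} :=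
  ([ffun i => Ordinal (lt_div t i)], [ffun i => Ordinal (lt_mod t i)]).
rewrite -[#|{: _}|]cardsT -cardsX.
have gi : {in T &, injective g}.
  move=> t t' _ _ [/ffunP e1 /ffunP e2]; apply: eq_from_tnth => i; apply: val_inj => /=.
  rewrite (divn_eq (tnth t i) (w i)) [RHS](divn_eq _ (w i)).
  have := congr1 val (e1 i); rewrite !ffunE /= => ->.
  by have := congr1 val (e2 i); rewrite !ffunE /= => ->.
rewrite -(card_in_imset gi); apply/subset_leq_card/subsetP => _ /imsetP [t tT ->].
rewrite !inE andbT /=; move: tT; rewrite inE big_tuple; apply: leq_trans.
by apply: leq_sum => i _; rewrite ffunE /= mulnC leq_divM.
Qed.

End Counting.

Section Monomials.
Variable K : fieldType.

Fixpoint itmon n (e : nat -> nat) : itp K n :=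
  if n is n'.+1 return itp K n then (itmon n' e)%:P * 'X^(e n') else 1.

Fixpoint itcoef n (e : nat -> nat) : itp K n -> K :=
  if n is n'.+1 return itp K n -> K
  then fun p : {poly itp K n'} => itcoef e p`_(e n') else id.

Lemma itcoefD n e (p q : itp K n) : itcoef e (p + q) = itcoef e p + itcoef e q.
Proof. by elim: n p q => //= n IH p q; rewrite coefD IH. Qed.

Lemma itcoef0 n e : itcoef e (0 : itp K n) = 0.
Proof. by elim: n => //= n IH; rewrite coef0 IH. Qed.

Lemma itcoefCM n e c (p : itp K n) : itcoef e (itC K n c * p) = c * itcoef e p.
Proof. by elim: n p => //= n IH p; rewrite coefCM IH. Qed.

Lemma itcoef_mon n e f :
  itcoef e (itmon n f) = (all (fun i => f i == e i) (iota 0 n))%:R.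
Proof.
elim: n => // n IH.
have -> (P : pred nat) : all P (iota 0 n.+1) = all P (iota 0 n) && P n.
  by rewrite -{1}[n.+1]addn1 iotaD all_cat /= andbT.
rewrite /= coefCM coefXn [_ == f n]eq_sym; case: eqP => _; last by rewrite mulr0 itcoef0 andbF.
by rewrite mulr1 IH andbT.
Qed.

Lemma eq_itcoef n e f (p : itp K n) : (forall i, (i < n)%N -> e i = f i) ->
  itcoef e p = itcoef f p.
Proof.
by elim: n p => //= n IH p h; rewrite h // IH // => i ni; apply/h/ltnW.
Qed.

Lemma itcoef_sum_mon (I : finType) n (k : I -> K) (ex : I -> nat -> nat) (x0 : I) :
  (forall x, (forall i, (i < n)%N -> ex x i = ex x0 i) -> x = x0) ->
  itcoef (ex x0) (\sum_x itC K n (k x) * itmon n (ex x)) = k x0.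
Proof.
move=> inj; rewrite (big_morph _ (itcoefD (ex x0)) (itcoef0 n (ex x0))).
rewrite (bigD1 x0) //= itcoefCM itcoef_mon big1 => [|x xn].
  by rewrite (introT allP) ?mulr1 ?addr0.
rewrite itcoefCM itcoef_mon; case: allP => [h|_]; last by rewrite mulr0.
case/eqP: xn; apply: inj => i ni; apply/eqP/h.
by rewrite mem_iota.
Qed.

Lemma itev_mon (S : comNzRingType) (iota : {rmorphism K -> S}) x n e :
  itev iota x n (itmon n e) = \prod_(i < n) x i ^+ e i.
Proof.
elim: n => [|n IH]; first by rewrite big_ord0 /= rmorph1.
rewrite big_ord_recr /= -IH /horner_eval rmorphM /= map_polyC map_polyXn.
by rewrite hornerCM hornerXn.
Qed.

Definition indep (S : comNzRingType) (iota : {rmorphism K -> S}) (n : nat) (x : nat -> S) :=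
  forall p : itp K n, itev iota x n p = 0 -> p = 0.

(** Bounds the degree in the variable of index [s] when [r] variables come after it.
    In a relation between linear forms and equations, the linear forms have the
    indices up to [s] and the equations the following ones, so that this is the
    degree in the last linear form. *)
Fixpoint inner_size_le (r s q : nat) : itp K (r + s.+1) -> Prop :=
  if r is r'.+1 return itp K (r + s.+1) -> Prop
  then fun p : {poly itp K (r' + s.+1)} => forall i, inner_size_le q p`_i
  else fun p : {poly itp K s} => (size p <= q.+1)%N.

Lemma inner_size_le0 r s q : inner_size_le q (0 : itp K (r + s.+1)).
Proof. by elim: r => [|r IH] /=; rewrite ?size_poly0 // => i; rewrite coef0. Qed.

Lemma inner_size_leD r s q (a b : itp K (r + s.+1)) :
  inner_size_le q a -> inner_size_le q b -> inner_size_le q (a + b).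
Proof.
elim: r a b => [|r IH] /= a b ha hb; last by move=> i; rewrite coefD; apply: IH.
by rewrite (leq_trans (size_polyD _ _)) // geq_max ha hb.
Qed.

Lemma inner_size_le_mon r s q c e : (e s <= q)%N ->
  inner_size_le q (itC K (r + s.+1) c * itmon (r + s.+1) e).
Proof.
move=> es; elim: r => [|r IH] /=.
  rewrite mulrA -polyCM; apply: leq_trans (size_polyMleq _ _) _.
  by rewrite size_polyXn size_polyC; case: (_ != _) => /=; lia.
move=> i; rewrite mulrA -polyCM coefCM coefXn.
by case: eqP => _; rewrite ?mulr1 // mulr0; apply: inner_size_le0.
Qed.

End Monomials.

Lemma sum_bump (F : nat -> nat) r s :
  (\sum_(k < r + s.+1) F k = F s + \sum_(i < s + r) F (bump s i))%N.
Proof.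
rewrite -(big_mkord xpredT F) addnS addnC big_mkord.
have hs : (s < (s + r).+1)%N by rewrite ltnS leq_addr.
by rewrite (bigD1_ord (Ordinal hs)).
Qed.

(** Perron's theorem. Consider the products of the [G i] whose exponent at [G s] is
    at most [q] and whose degree, counted without [G s] and with weight [dd i] for the
    equations, is at most [B]. By [count_weighted] they are at least
    $(q+1)\binom{M+B}{M}/q$ in number, where $M$ is the number of variables. They have
    degree at most $B + q$, hence lie in a space of dimension $\binom{M+B+q}{M}$, which
    is smaller for large $B$ by [bin_growth]. *)
Lemma perron (V : choiceType) (K : fieldType) (xs : seq V) (s r : nat)
    (G : nat -> mpol V K) (dd : nat -> nat) :
  uniq xs -> (size xs <= s + r)%N ->
  (forall i, (i < r + s.+1)%N -> vars_in (fun v => v \in xs) (G i)) ->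
  (forall i, (i <= s)%N -> deg_le 1 (G i)) ->
  (forall i, (i < r)%N -> (0 < dd i)%N /\ deg_le (dd i) (G (i + s.+1)%N)) ->
  exists P : itp K (r + s.+1),
    [/\ P != 0, inner_size_le (\prod_(i < r) dd i)%N P &
        itev (malgCr V K) G (r + s.+1) P = 0].
Proof.
move=> uxs sxs vG dg df; set q := (\prod_(i < r) dd i)%N; set M := size xs.
(* The weight of [G k]; [bump s] enumerates all the indices except [s]. *)
pose W k := if (k <= s)%N then 1%N else dd (k - s.+1)%N.
pose w (i : 'I_(s + r)) := W (bump s i).
have w0 i : (0 < w i)%N.
  rewrite /w /W; case: (leqP (bump s i) s) => // lk.
  suff h : (bump s i - s.+1 < r)%N by case: (df _ h).
  by move: lk; rewrite /bump; have := ltn_ord i; case: (leqP s i); lia.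
have qw : (\prod_i w i = q)%N.
  rewrite big_split_ord /= big1 ?mul1n => [|i _]; last first.
    rewrite /w /W /bump /=; have -> : (s <= i)%N = false by rewrite leqNgt ltn_ord.
    by rewrite add0n ltnW.
  apply: eq_bigr => i _; rewrite /w /W /bump /= leq_addr /= add1n.
  by rewrite ltnNge leq_addr /= subSS addKn.
have [B hB] := bin_growth q M.
have cA := count_weighted B w0; rewrite qw in cA.
set A := [set a | _] in cA.
(* [I] indexes the products of the [G i], [J] the monomials of degree at most
   [B + q]. *)
pose I := ({a | a \in A} * 'I_q.+1)%type.
pose T := [set t : M.-tuple 'I_(B + q).+1 | (\sum_(i <- t) i <= B + q)%N].
pose J := {t | t \in T}.
have cJI : (#|{: J}| < #|{: I}|)%N.
  rewrite card_prod !card_sig card_ord card_partial_ord_partitions.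
  have hc : ('C(M + B, M) <= 'C(s + r + B, s + r))%N.
    rewrite -(bin_sub (leq_addr B M)) -(bin_sub (leq_addr B (s + r))) !addKn.
    by rewrite leq_bin2l // leq_add2r.
  have q0 : (0 < q)%N by rewrite -qw prodn_gt0.
  rewrite -(ltn_pmul2l q0); apply: leq_trans hB _.
  rewrite [leqRHS]mulnA [leqRHS]mulnC leq_mul2l [leqRHS]mulnC; apply/orP; right.
  exact: leq_trans hc cA.
pose ex (x : I) (k : nat) : nat :=
  if k == s then nat_of_ord x.2 else
    if insub (unbump s k) is Some i then nat_of_ord (val x.1 i) else 0%N.
have exs x : ex x s = x.2 by rewrite /ex eqxx.
have exb x (i : 'I_(s + r)) : ex x (bump s i) = val x.1 i.
  rewrite /ex eq_sym (negPf (neq_bump _ _)) bumpK insubT // => h.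
  by rewrite (_ : Sub (nat_of_ord i) h = i) //; apply: val_inj.
pose mono (t : J) : {cmonom V} :=
  [cmonom (nth 0%N (map val (val (val t))) (index v xs)) | v in [fset v in xs]]%M.
pose Ge (x : I) := \prod_(k < r + s.+1) G k ^+ ex x k.
have [kp [[x0 kx0] kp0]] := linear_dependency (fun x t => (Ge x)@_(mono t)) cJI.
pose P := \sum_x itC K (r + s.+1) (kp x) * itmon K (r + s.+1) (ex x).
have ltr i : (i < s + r)%N -> (bump s i < r + s.+1)%N by rewrite /bump; lia.
exists P; split.
- apply/eqP => P0; case/eqP: kx0; rewrite -[LHS](@itcoef_sum_mon K _ (r + s.+1) kp ex).
    by rewrite -/P P0 itcoef0.
  move=> x h.
  have hs : ex x s = ex x0 s by apply: h; lia.
  have hb (i : 'I_(s + r)) : ex x (bump s i) = ex x0 (bump s i) by apply/h/ltr.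
  case: x x0 hs hb {h P0} => a j [a0 j0] /=; rewrite /= !exs /= => hs hb.
  congr (_, _); last exact: val_inj.
  by apply/val_inj/ffunP => i; apply: val_inj; have := hb i; rewrite !exb.
- apply: (big_ind (@inner_size_le K r s q)) => [||x _].
  + exact: inner_size_le0.
  + exact: inner_size_leD.
  + by apply: inner_size_le_mon; rewrite exs -ltnS.
- have GeE x : itev (malgCr V K) G (r + s.+1) (itmon K (r + s.+1) (ex x)) = Ge x.
    by rewrite itev_mon.
  have degG x : deg_le (B + q) (Ge x).
    have : deg_le (\sum_(k < r + s.+1) W k * ex x k) (Ge x).
      apply: deg_le_prod => k; apply: deg_le_exp; rewrite /W.
      case: (leqP k s) => [/dg //|sk].
      have [|_] := df (k - s.+1)%N; first by have := ltn_ord k; lia.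
      by rewrite subnK.
    apply: deg_leW; rewrite (sum_bump (fun k => W k * ex x k)%N) exs /W leqnn mul1n addnC.
    apply: leq_add; last by rewrite -ltnS.
    have := valP x.1; rewrite inE; apply: leq_trans.
    by apply: leq_sum => i _; rewrite exb.
  have varG x : vars_in (fun v => v \in xs) (Ge x).
    by apply: vars_in_prod => k; apply: vars_in_exp; apply: vG; apply: ltn_ord.
  apply/malgP => m; rewrite mcoeff0 rmorph_sum /= raddf_sum /=.
  transitivity (\sum_x kp x * (Ge x)@_m).
    by apply: eq_bigr => x _; rewrite rmorphM /= GeE itevC mcoeffCM.
  have [[t ->]|nt] := classic (exists t, m = mono t); first exact: kp0.
  apply: big1 => x _; have [->|Gm] := eqVneq (Ge x)@_m 0; first by rewrite mulr0.
  case: nt; have md := degG x m Gm; have mv := varG x m Gm.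
  pose t := [tuple (inord (m (tnth (in_tuple xs) i)) : 'I_(B + q).+1) | i < M].
  have mi v : (m v < (B + q).+1)%N.
    rewrite ltnS; apply: leq_trans md; rewrite mdegE; case: mdomP => // vm.
    by rewrite (big_fsetD1 v) //= leq_addr.
  have sm : (\sum_(v <- xs) m v = mdeg m)%N.
    have sub : (finsupp m `<=` [fset v in xs])%fset.
      by apply/fsubsetP => v; rewrite -cmE_neq0 !inE => /mv.
    rewrite (mdegEw sub); apply: perm_big; apply: uniq_perm => // v.
    by rewrite !inE.
  have tT : t \in T.
    rewrite inE big_tuple; apply: leq_trans md; rewrite -sm (big_tnth _ _ xs).
    by apply: leq_sum => i _; rewrite tnth_mktuple inordK.
  exists (exist _ t tT); apply/eqP/cmP => v; rewrite cmE fsfun_fun !inE /=.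
  case: ifP => [vxs|/negP nv]; last by apply/eqP/negPn/negP => /mv.
  have iv : (index v xs < M)%N by rewrite index_mem.
  rewrite (nth_map ord0) ?size_tuple ?card_ord //.
  rewrite -[nth _ _ _]/(nth ord0 (val t) (Ordinal iv)) -tnth_nth tnth_mktuple inordK //.
  by rewrite (tnth_nth v) /= nth_index.
Qed.

(** * Specialization along a triangular system *)

Definition free_at (V : choiceType) (S : comNzRingType) (x : V -> S) (v w : V) : {poly S} :=
  if w == v then 'X else (x w)%:P.

Lemma free_at_constant (V : choiceType) (K : fieldType) (S : comNzRingType)
    (iota : {rmorphism K -> S}) (x : V -> S) (v : V) (p : mpol V K) :
  vars_in (fun w => w != v) p ->
  ev (polyC \o iota : {rmorphism K -> {poly S}}) (free_at x v) p = (ev iota x p)%:P.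
Proof.
move=> vp.
rewrite (@rmorph_ev _ _ _ _ _ (@polyC S) (polyC \o iota : {rmorphism K -> {poly S}})) //.
by apply: eq_ev => m pm w mw; rewrite /free_at (negPf (vp m pm w mw)).
Qed.

Definition join_values (S : Type) (s : nat) (g f : nat -> S) (k : nat) : S :=
  if (k <= s)%N then g k else f (k - s.+1)%N.

(** The variables of [P] attached to the equations are set to [0] one after the
    other, starting with the outermost one, that of the last equation. If [P] is
    divisible by that variable, divide by its highest power. This is compatible with
    the relation: where the leading variable of the last equation is given an
    indeterminate value, the equation takes a nonzero value, since it involves none of
    the other [v i], and the ring is a domain. Then specialize the indeterminate to the
    coordinate of [x], where the equation vanishes. For the induction, the relation is
    assumed at all the points that agree with [x] outside of the [v i], with values in
    any domain containing [S]. *)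
Lemma triangular_specialization (V : choiceType) (K : fieldType) (S : idomainType)
    (iota : {rmorphism K -> S}) (x : V -> S) (G f : nat -> mpol V K) (v : nat -> V)
    (s q r : nat) (P : itp K (r + s.+1)) :
  P != 0 -> inner_size_le q P ->
  (forall i j, (i < r)%N -> (j < i)%N -> v i != v j /\ vars_in (fun w => w != v j) (f i)) ->
  (forall i, (i < r)%N -> ev iota x (f i) = 0 /\
     ev (polyC \o iota : {rmorphism K -> {poly S}}) (free_at x (v i)) (f i) != 0) ->
  (forall (S' : idomainType) (j : {rmorphism S -> S'}) (y : V -> S'), injective j ->
     (forall w, (forall i, (i < r)%N -> w != v i) -> y w = j (x w)) ->
     itev (j \o iota : {rmorphism K -> S'})
       (join_values s (fun k => ev (j \o iota : {rmorphism K -> S'}) y (G k))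
                      (fun k => ev (j \o iota : {rmorphism K -> S'}) y (f k)))
       (r + s.+1) P = 0) ->
  exists Q : itp K s.+1,
    [/\ Q != 0, (size (Q : {poly itp K s}) <= q.+1)%N &
        itev iota (fun k => ev iota x (G k)) s.+1 Q = 0].
Proof.
elim: r P => [|r IH] P P0 sP tri fx hP.
  exists P; split=> //.
  have := hP S idfun x (fun _ _ => id) (fun w _ => erefl).
  rewrite -[itev _ _ _ _ = 0]/(itev _ _ s.+1 P = 0) => h.
  rewrite -[RHS]h.
  transitivity (itev (idfun \o iota : {rmorphism K -> S}) (fun k => ev iota x (G k)) s.+1 P).
    exact: (@itev_comp K S S iota idfun (idfun \o iota : {rmorphism K -> S}) _ s.+1 P).
  by apply: eq_itev => i; rewrite /join_values ltnS => ->.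
(* The highest power of the outermost variable that divides [P]. *)
have [a [Pa Pm]] : exists a, (P : {poly itp K (r + s.+1)})`_a != 0 /\
    forall i, (i < a)%N -> (P : {poly itp K (r + s.+1)})`_i = 0.
  have ex : exists a, (P : {poly itp K (r + s.+1)})`_a != 0.
    by exists (size (P : {poly itp K (r + s.+1)})).-1; rewrite -lead_coefE lead_coef_eq0.
  exists (ex_minn ex); case: ex_minnP => a Pa mina; split=> // i ia.
  by apply/eqP/negPn/negP => /mina; rewrite leqNgt ia.
pose P' := drop_poly a (P : {poly itp K (r + s.+1)}).
have eP : (P : {poly itp K (r + s.+1)}) = P' * 'X^a.
  rewrite -[LHS](poly_take_drop a) -[RHS]add0r; congr (_ + _).
  by apply/polyP => i; rewrite coef_take_poly coef0; case: ifP => // /Pm.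
have eP0 : P'`_0 = (P : {poly itp K (r + s.+1)})`_a by rewrite coef_drop_poly add0n.
apply: (IH (P : {poly itp K (r + s.+1)})`_a) => //.
- by move=> i j ir; apply: tri; apply: ltnW.
- by move=> i ir; apply: fx; apply: ltnW.
move=> S' j y ij ey; have [fr0 frX] := fx r (ltnSn r).
(* Free the coordinate [v r] of [y]. *)
pose j2 : {rmorphism S -> {poly S'}} := polyC \o j.
pose y2 w : {poly S'} := if w == v r then 'X else (y w)%:P.
have ij2 : injective j2 by apply: inj_comp ij; apply: polyC_inj.
have ey2 w : (forall i, (i < r.+1)%N -> w != v i) -> y2 w = j2 (x w).
  move=> hw; rewrite /y2 (negPf (hw r _)) // ey // => i ir; exact/hw/ltnW.
have yf w : (forall i, (i < r)%N -> w != v i) -> y w = j (x w) by exact: ey.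
have yvr : y (v r) = j (x (v r)) by apply: ey => i ir; case: (tri r i).
have {hP} := hP _ j2 y2 ij2 ey2.
set io2 : {rmorphism K -> {poly S'}} := (j2 \o iota : {rmorphism K -> {poly S'}}).
set io1 : {rmorphism K -> S'} := (j \o iota : {rmorphism K -> S'}).
rewrite itevS eP rmorphM /= map_polyXn hornerM hornerXn.
set c := join_values _ _ _ _; set val2 := join_values _ _ _.
have hs : (r + s.+1 <= s)%N = false by rewrite addnS ltnNge leq_addl.
have ec : c = ev io2 y2 (f r) by rewrite /c /join_values hs addnK.
have c0 : c != 0.
  have -> : c = map_poly j (ev (polyC \o iota : {rmorphism K -> {poly S}}) (free_at x (v r)) (f r)).
    rewrite ec (@rmorph_ev _ _ _ _ _ (map_poly j) io2) => [|b]; last by rewrite /= map_polyC.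
    apply: eq_ev => m fm w mw; rewrite /= /free_at /y2.
    case: (eqVneq w (v r)) => [_|nw]; first by rewrite map_polyX.
    rewrite map_polyC /= yf // => i ir.
    by have [_ h] := tri r i (ltnSn r) ir; apply: (h m).
  by rewrite map_poly_eq0_id0 ?lead_coef_eq0 // -(rmorph0 j) inj_eq // lead_coef_eq0.
move/eqP; rewrite mulf_eq0 expf_eq0 (negPf c0) andbF orbF => /eqP h.
(* Put back the value of that coordinate. *)
pose e : {rmorphism {poly S'} -> S'} := horner_eval (j (x (v r))).
have ey1 w : e (y2 w) = y w.
  rewrite /e /= /horner_eval /y2; case: eqP => [->|_]; first by rewrite hornerX.
  by rewrite hornerC.
have eev p : e (ev io2 y2 p) = ev io1 y p.
  rewrite (@rmorph_ev _ _ _ _ _ e io1) => [|b]; last by rewrite /e /= /horner_eval hornerC.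
  by apply: eq_ev => m _ w _; rewrite /= ey1.
have ec0 : e c = 0.
  rewrite ec eev -(rmorph0 j) -fr0 (@rmorph_ev _ _ _ _ _ j io1) //.
  apply: eq_ev => m fm w mw; rewrite /= yf // => i ir.
  by have [_ h'] := tri r i (ltnSn r) ir; apply: (h' m).
have := congr1 e h; rewrite rmorph0 -horner_map ec0 horner_coef0 coef_map coef_map /= eP0.
move=> <-; rewrite (@itev_comp _ _ _ io2 e io1) => [|b]; last first.
  by rewrite /e /= /horner_eval hornerC.
rewrite -eP; apply: eq_itev => i _; rewrite /= /val2 /join_values; case: ifP => _; exact/esym/eev.
Qed.

(** * The exchange property of algebraic independence *)

Section Exchange.
Variable K : fieldType.

Fixpoint exponents_le n (L : nat) : itp K n -> Prop :=
  if n is n'.+1 return itp K n -> Prop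
  then fun p : {poly itp K n'} => (size p <= L.+1)%N /\ forall i, exponents_le L p`_i
  else fun=> True.

Lemma exponents_le0 n L : exponents_le L (0 : itp K n).
Proof. by elim: n => //= n IH; rewrite size_poly0; split=> // i; rewrite coef0. Qed.

Lemma exponents_le1 n L : exponents_le L (1 : itp K n).
Proof.
elim: n => //= n IH; rewrite size_poly1; split=> // i; rewrite coef1.
by case: (_ == _) => //; apply: exponents_le0.
Qed.

Lemma exponents_leW n L L' (p : itp K n) : (L <= L')%N -> exponents_le L p -> exponents_le L' p.
Proof.
move=> h; elim: n p => //= n IH p [sp cp]; split; first exact: leq_trans sp _.
by move=> i; apply: IH.
Qed.

Lemma exponents_leD n L (p q : itp K n) :
  exponents_le L p -> exponents_le L q -> exponents_le L (p + q).
Proof.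
elim: n p q => //= n IH p q [sp cp] [sq cq]; split.
  by rewrite (leq_trans (size_polyD _ _)) // geq_max sp sq.
by move=> i; rewrite coefD; apply: IH.
Qed.

Lemma exponents_leN n L (p : itp K n) : exponents_le L p -> exponents_le L (- p).
Proof.
elim: n p => //= n IH p [sp cp]; rewrite size_polyN; split=> // i.
by rewrite coefN; apply: IH.
Qed.

Lemma exponents_leM n L L' (p q : itp K n) :
  exponents_le L p -> exponents_le L' q -> exponents_le (L + L') (p * q).
Proof.
elim: n p q => //= n IH p q [sp cp] [sq cq]; split.
  apply: leq_trans (size_polyMleq _ _) _; rewrite -subn1 leq_subLR.
  by apply: leq_trans (leq_add sp sq) _; rewrite addSn addnS.
move=> i; rewrite coefM; apply: (big_ind (@exponents_le n (L + L'))).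
- exact: exponents_le0.
- exact: exponents_leD.
- by move=> j _; apply: IH.
Qed.

Lemma exponents_le_exp n L (p : itp K n) k :
  exponents_le L p -> exponents_le (L * k) (p ^+ k).
Proof.
move=> h; elim: k => [|k IH]; first by rewrite expr0; apply: exponents_le1.
by rewrite exprS mulnS; apply: exponents_leM.
Qed.

Lemma exponents_le_exists n (p : itp K n) : exists L, exponents_le L p.
Proof.
elim: n p => [|n IH] p; first by exists 0%N.
suff [L hL] : exists L, forall i, (i < size (p : {poly itp K n}))%N ->
    exponents_le L (p : {poly itp K n})`_i.
  exists (maxn L (size (p : {poly itp K n}))); split; first by rewrite leqW // leq_maxr.
  move=> i; have [lt|ge] := ltnP i (size (p : {poly itp K n})).
    by apply: exponents_leW (hL i lt); rewrite leq_maxl.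
  by rewrite nth_default //; apply: exponents_le0.
elim: (size _) => [|m [L hL]]; first by exists 0%N.
have [L' hL'] := IH (p : {poly itp K n})`_m.
exists (maxn L L') => i; rewrite ltnS leq_eqVlt => /orP[/eqP ->|lt].
  by apply: exponents_leW hL'; rewrite leq_maxr.
by apply: exponents_leW (hL i lt); rewrite leq_maxl.
Qed.

Lemma exponents_le_eq0 n L (p : itp K n) : exponents_le L p ->
  (forall e : {ffun 'I_n -> 'I_L.+1},
     itcoef (fun i => if insub i is Some j then nat_of_ord (e j) else 0%N) p = 0) -> p = 0.
Proof.
move=> bp h; have {h} : forall e : nat -> nat, (forall i, (i < n)%N -> (e i <= L)%N) ->
    itcoef e p = 0.
  move=> e eL; rewrite -[RHS](h [ffun i : 'I_n => inord (e i)]); apply: eq_itcoef => i ni.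
  by rewrite insubT /= ffunE inordK // ltnS eL.
elim: n p bp => [|n IH] p bp h; first exact: (h (fun=> 0%N)).
case: bp => sp bp; apply/polyP => j; rewrite coef0.
have [jL|jL] := leqP j L; last by rewrite nth_default // (leq_trans sp).
apply: (IH _ (bp j)) => e eL; have := h (fun k => if k == n then j else e k).
rewrite /= eqxx => h'; rewrite -[RHS]h'; first by apply: eq_itcoef => i /ltn_eqF ->.
by move=> i; case: eqP => [//|/eqP ne]; rewrite ltnS leq_eqVlt (negPf ne); apply: eL.
Qed.

(** Division by [p] without inverting its leading coefficient: the power of that
    coefficient used as denominator can be the same for all [k <= n], and the exponents
    in the remainder grow linearly with [n]. *)
Lemma reduce_power a delta (p : {poly itp K a}) n :
  (1 < size p)%N -> (forall i, exponents_le delta p`_i) ->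
  forall k, (k <= n)%N -> exists R : {poly itp K a},
    [/\ (size R < size p)%N, forall i, exponents_le (n * delta) R`_i &
     forall (S : comNzRingType) (g : {rmorphism itp K a -> S}) z, (map_poly g p).[z] = 0 ->
       (map_poly g R).[z] = g (lead_coef p) ^+ n * z ^+ k].
Proof.
move=> sp bp k kn.
suff [R [sR bR eR]] : exists R : {poly itp K a},
    [/\ (size R < size p)%N, forall i, exponents_le (k * delta) R`_i &
     forall (S : comNzRingType) (g : {rmorphism itp K a -> S}) z, (map_poly g p).[z] = 0 ->
       (map_poly g R).[z] = g (lead_coef p) ^+ k * z ^+ k].
  exists ((lead_coef p ^+ (n - k))%:P * R); split.
  - rewrite mul_polyC; apply: leq_ltn_trans sR; exact: size_scale_leq.
  - move=> i; rewrite coefCM -{1}(subnK kn) mulnDl mulnC.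
    apply: exponents_leM => //; apply: exponents_le_exp; exact: bp.
  - move=> S g z /eR e; rewrite rmorphM /= map_polyC hornerCM e /=.
    have -> : g (lead_coef p ^+ (n - k)) = g (lead_coef p) ^+ (n - k) by apply: rmorphXn.
    by rewrite mulrA -exprD subnK.
elim: k {kn} => [|k [R [sR bR eR]]].
  exists 1; split; first by rewrite size_poly1.
    by move=> i; rewrite coef1; case: (i == _); [apply: exponents_le1|apply: exponents_le0].
  by move=> S g z _; rewrite rmorph1 hornerC !expr0 mulr1.
pose m := (size p).-1; have em : size p = m.+1 by rewrite prednK // ltnW.
pose R' := (lead_coef p)%:P * (R * 'X) - (R`_m.-1)%:P * p.
have m0 : (0 < m)%N by rewrite /m; move: sp; case: (size p) => [|[]].
exists R'; split.
- rewrite em ltnS; apply/leq_sizeP => j jm; rewrite coefB !coefCM coefMX.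
  have j0 : (j == 0%N) = false by apply/eqP => j0; move: jm; rewrite j0 leqNgt m0.
  rewrite j0; move: jm; rewrite leq_eqVlt => /orP[/eqP <-|lt].
    by rewrite /lead_coef -/m mulrC subrr.
  rewrite (nth_default _ (s := R)) ?(nth_default _ (s := p)) ?mulr0 ?subrr ?em //.
  by apply: leq_trans (_ : m <= _)%N; [rewrite -ltnS -em | rewrite -ltnS prednK // (leq_ltn_trans _ lt)].
- move=> i; rewrite coefB !coefCM coefMX mulSn.
  apply: exponents_leD; last apply: exponents_leN.
    apply: exponents_leM; first exact: bp.
    by case: (i == _); [apply: exponents_le0|apply: bR].
  by rewrite addnC; apply: exponents_leM.
- move=> S g z pz; rewrite rmorphB !rmorphM /= !map_polyC map_polyX !hornerE pz mulr0 subr0.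
  by rewrite (eR _ _ _ pz) /= !exprS; ring.
Qed.

(** Otherwise each [Z i] is a root of a polynomial [p i] over the ring generated by
    [X]. Up to a common denominator, the monomials in [Z] with exponents at most
    [n] are then combinations of a number of monomials that does not depend on [n],
    with coefficients of exponents of order [n] in the [a] variables [X]. There are
    more than $n^s$ of the former and a multiple of $n^a$ parameters, so a large [n]
    gives an algebraic relation between the [Z i]. *)
Lemma exchange (S : idomainType) (iota : {rmorphism K -> S}) a s (X Z : nat -> S) :
  indep iota a X -> indep iota s Z -> (a < s)%N ->
  exists2 i, (i < s)%N & indep iota a.+1 (fun k => if k == a then Z i else X k).
Proof.
move=> iX iZ las; apply: NNPP => nex.
have Xa i (c : itp K a) : itev iota (fun k => if k == a then Z i else X k) a c = itev iota X a c.
  by apply: eq_itev => k ka; rewrite ltn_eqF.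
have hp (i : 'I_s) : exists p : {poly itp K a}, p != 0 /\ (map_poly (itev iota X a) p).[Z i] = 0.
  apply: NNPP => np; apply: nex; exists i => // p.
  rewrite itevS eqxx => h; apply/eqP/negPn/negP => p0; apply: np; exists p; split=> //.
  by rewrite -[RHS]h; congr (horner _ _); apply: eq_map_poly => c; rewrite Xa.
pose p i := proj1_sig (constructive_indefinite_description _ (hp i)).
have pP i : p i != 0 /\ (map_poly (itev iota X a) (p i)).[Z i] = 0.
  by rewrite /p; case: constructive_indefinite_description.
have ev0 (c : itp K a) : itev iota X a c = 0 -> c = 0 by apply: iX.
have sp i : (1 < size (p i))%N.
  have [p0 pz] := pP i; rewrite ltnNge; apply/negP => s1.
  move: pz p0; rewrite (size1_polyC s1) map_polyC hornerC => /ev0 ->.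
  by rewrite polyC0 eqxx.
have [delta bp] : exists delta, forall i j, exponents_le delta (p i)`_j.
  have h i : exists L, forall j, exponents_le L (p i)`_j.
    by have [L [_ hL]] := @exponents_le_exists a.+1 (p i); exists L.
  pose L i := proj1_sig (constructive_indefinite_description _ (h i)).
  exists (\max_i L i) => i j; apply: (@exponents_leW _ (L i)); first exact: leq_bigmax.
  by rewrite /L; case: constructive_indefinite_description.
pose e := \max_i size (p i).
(* With this [n], $e^s (L+1)^a < (n+1)^s$. *)
pose n := (e ^ s * (s * delta).+1 ^ a)%N; pose L := (s * (n * delta))%N.
have hR (i : 'I_s) (k : 'I_n.+1) : exists R : {poly itp K a},
    [/\ (size R <= e)%N, forall j, exponents_le (n * delta) R`_j &
     (map_poly (itev iota X a) R).[Z i] =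
        itev iota X a (lead_coef (p i)) ^+ n * Z i ^+ k].
  have [R [sR bR eR]] := reduce_power (sp i) (bp i) (ltn_ord k : (k <= n)%N).
  exists R; split=> //; last by apply: eR; case: (pP i).
  by apply: leq_trans (ltnW sR) _; apply: leq_bigmax.
pose R i k := proj1_sig (constructive_indefinite_description _ (hR i k)).
have RP i k : [/\ (size (R i k) <= e)%N, forall j, exponents_le (n * delta) (R i k)`_j &
     (map_poly (itev iota X a) (R i k)).[Z i] =
        itev iota X a (lead_coef (p i)) ^+ n * Z i ^+ k].
  by rewrite /R; case: constructive_indefinite_description.
pose pk (k : {ffun 'I_s -> 'I_n.+1}) (g : {ffun 'I_s -> 'I_e}) : itp K a :=
  \prod_(i < s) (R i (k i))`_(g i).
have bpk k g : exponents_le L (pk k g).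
  have -> : L = (\sum_(i < s) n * delta)%N by rewrite sum_nat_const card_ord.
  apply: (big_ind2 (fun (c : itp K a) b => exponents_le b c)).
  - exact: exponents_le1.
  - by move=> ? ? ? ?; apply: exponents_leM.
  - by move=> i _; case: (RP i (k i)).
have epk k : \sum_g itev iota X a (pk k g) * \prod_(i < s) Z i ^+ g i =
    (\prod_(i < s) itev iota X a (lead_coef (p i)) ^+ n) * \prod_(i < s) Z i ^+ k i.
  rewrite -big_split /=; transitivity (\prod_(i < s) \sum_(j < e) itev iota X a (R i (k i))`_j * Z i ^+ j).
    rewrite bigA_distr_bigA; apply: eq_bigr => g _.
    by rewrite /pk rmorph_prod -big_split.
  apply: eq_bigr => i _; have [sR _ <-] := RP i (k i).
  rewrite (horner_coef_wide _ (leq_trans (size_poly _ _) sR)).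
  by apply: eq_bigr => j _; rewrite coef_map.
pose ce (b : {ffun 'I_a -> 'I_L.+1}) i := if insub i is Some j then nat_of_ord (b j) else 0%N.
pose ke (k : {ffun 'I_s -> 'I_n.+1}) i := if insub i is Some j then nat_of_ord (k j) else 0%N.
have [|kp [[k0 kpk0] kp0]] := @linear_dependency K {ffun 'I_s -> 'I_n.+1}
   ({ffun 'I_s -> 'I_e} * {ffun 'I_a -> 'I_L.+1})%type
   (fun k gb => itcoef (ce gb.2) (pk k gb.1)).
  rewrite card_prod !card_ffun !card_ord.
  have mono x y k : (x <= y)%N -> (x ^ k <= y ^ k)%N.
    by move=> xy; elim: k => // k IH; rewrite !expnS leq_mul.
  have h1 : (L.+1 ^ a <= (n.+1 * (s * delta).+1) ^ a)%N.
    by apply: mono; rewrite /L; nia.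
  apply: leq_ltn_trans (_ : n * n.+1 ^ a < _)%N.
    by rewrite {1}/n -mulnA -expnMn leq_mul2l (mulnC (_.+1)) h1 orbT.
  apply: leq_trans (_ : n.+1 ^ a.+1 <= _)%N; last by rewrite leq_pexp2l.
  by rewrite expnS ltn_mul2r ltnSn andbT expn_gt0.
pose P := \sum_k itC K s (kp k) * itmon K s (ke k).
have P0 : P = 0.
  apply: iZ; rewrite rmorph_sum /=.
  have C0 : \prod_(i < s) itev iota X a (lead_coef (p i)) ^+ n != 0.
    apply/prodf_neq0 => i _; rewrite expf_eq0 negb_and; apply/orP; right.
    apply/eqP => /ev0 /eqP; rewrite lead_coef_eq0; apply/negP; by case: (pP i).
  apply: (mulfI C0); rewrite mulr0 mulr_sumr.
  transitivity (\sum_k \sum_g itev iota X a (itC K a (kp k) * pk k g) * \prod_(i < s) Z i ^+ g i).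
    apply: eq_bigr => k _; rewrite rmorphM /= itevC itev_mon mulrCA.
    have -> : \prod_(i < s) Z i ^+ ke k i = \prod_(i < s) Z i ^+ k i.
      by apply: eq_bigr => i _; rewrite /ke valK.
    rewrite -epk mulr_sumr; apply: eq_bigr => g _.
    by rewrite rmorphM /= itevC mulrA.
  rewrite exchange_big /=; apply: big1 => g _; rewrite -mulr_suml -rmorph_sum.
  suff -> : \sum_k itC K a (kp k) * pk k g = 0 by rewrite rmorph0 mul0r.
  apply: (@exponents_le_eq0 _ L).
    apply: (big_ind (@exponents_le a L)); first exact: exponents_le0.
      exact: exponents_leD.
    move=> k _; rewrite -[L]add0n; apply: exponents_leM => //.
    by elim: (a) => //= a' IH; rewrite size_polyC; split; [case: (_ != _)|
      move=> i; rewrite coefC; case: ifP => // _; apply: exponents_le0].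
  move=> b; rewrite -/(ce b) (big_morph _ (itcoefD (ce b)) (itcoef0 K a (ce b))).
  rewrite -[RHS](kp0 (g, b)); apply: eq_bigr => k _; exact: itcoefCM.
case/eqP: kpk0; rewrite -[LHS](@itcoef_sum_mon K _ s kp ke).
  by rewrite -/P P0 itcoef0.
move=> k h; apply/ffunP => i; apply: val_inj.
by have := h i (ltn_ord i); rewrite /ke valK.
Qed.

End Exchange.

(** * The derivation of differential polynomials *)

Lemma malg_ind (V : choiceType) (R : comNzRingType) (P : mpol V R -> Prop) :
  (forall c, P c%:MP) -> (forall v, P << ucm v >>) ->
  (forall p q, P p -> P q -> P (p + q)) -> (forall p q, P p -> P q -> P (p * q)) ->
  forall p, P p.
Proof.
move=> hC hX hD hM p; rewrite -[p]ev_id evE.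
have h0 : P 0 by rewrite -malgC0E.
have h1 : P 1 by rewrite -mpolyC1E.
apply: (big_ind P h0 hD) => m _; apply: (hM); first exact: hC.
rewrite /mev; apply: (big_ind P h1 hM) => v _.
move: (m v) => k; elim: k => [|k IH]; first by rewrite expr0.
rewrite exprS; apply: (hM); [exact: hX | exact: IH].
Qed.

Lemma ev_closed (V : choiceType) (R S : comNzRingType) (iota : {rmorphism R -> S})
    (x : V -> S) (P : S -> Prop) (p : mpol V R) :
  P 0 -> P 1 -> (forall a b, P a -> P b -> P (a + b)) ->
  (forall a b, P a -> P b -> P (a * b)) -> (forall c, P (iota c)) ->
  vars_in (fun v => P (x v)) p -> P (ev iota x p).
Proof.
move=> h0 h1 hD hM hC hp; rewrite evE big_seq; apply: (big_ind P h0 hD) => m.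
rewrite -mcoeff_neq0 => pm; apply: (hM); first exact: hC.
rewrite /mev big_seq; apply: (big_ind P h1 hM) => v; rewrite -cmE_neq0 => vm.
have {vm} : P (x v) by apply: (hp m).
move: (m v) => k h; elim: k => [|k IH]; first by rewrite expr0.
rewrite exprS; apply: (hM); [exact: h | exact: IH].
Qed.

Section FieldEvaluation.
Variables (V : choiceType) (K : fieldType) (S : comNzRingType) (iota : {rmorphism K -> S}).
Variable x : V -> S.

Lemma fevC (c : K) : ev iota x (c%:MP : mpol V K) = iota c.
Proof. exact: evC. Qed.

Lemma fevX v : ev iota x (<< ucm v >> : mpol V K) = x v.
Proof. exact: evX. Qed.

Lemma fevD (p q : mpol V K) : ev iota x (p + q) = ev iota x p + ev iota x q.
Proof. exact: rmorphD. Qed.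

Lemma fevM (p q : mpol V K) : ev iota x (p * q) = ev iota x p * ev iota x q.
Proof. exact: rmorphM. Qed.

End FieldEvaluation.

Section CommutingDerivations.
Variables (A S : comNzRingType) (g : {rmorphism A -> S}) (d : A -> A) (D : S -> S).
Hypotheses (hd : derivation d) (hD : derivation D).

Lemma commute_derivationD p q : D (g p) = g (d p) -> D (g q) = g (d q) ->
  D (g (p + q)) = g (d (p + q)).
Proof. by case: hd hD => dA _ [DA _] hp hq; rewrite dA !rmorphD DA hp hq. Qed.

Lemma commute_derivationM p q : D (g p) = g (d p) -> D (g q) = g (d q) ->
  D (g (p * q)) = g (d (p * q)).
Proof. by case: hd hD => _ dM [_ DM] hp hq; rewrite dM rmorphD !rmorphM DM hp hq. Qed.

End CommutingDerivations.

Section Derivation.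
Context {J : choiceType} {F : fieldType} (delta : F -> F).
Hypothesis dd : derivation delta.
Local Notation dP := (mpol (J * nat)%type F).

Lemma dpoly_ind (P : dP -> Prop) :
  (forall c, P (c%:MP : dP)) -> (forall v, P (<< ucm v >> : dP)) ->
  (forall p q : dP, P p -> P q -> P (p + q)) -> (forall p q : dP, P p -> P q -> P (p * q)) ->
  forall p : dP, P p.
Proof. exact: malg_ind. Qed.

Definition dshift (v : J * nat) : J * nat := (v.1, v.2.+1).

Definition dterm (c : F) (m : {cmonom (J * nat)%type}) : dP :=
  << delta c *g m >> +
  \sum_(v <- finsupp m) << c *+ m v *g mmul (divcm m (ucm v)) (ucm (dshift v)) >>.

Lemma dtermD m : {morph dterm^~ m : a b / a + b}.
Proof.
case: dd => hD _ a b; rewrite /dterm hD monalgUD addrACA; congr (_ + _).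
by rewrite -big_split; apply: eq_bigr => v _; rewrite /= mulrnDl monalgUD.
Qed.

Lemma dterm0 m : dterm 0 m = 0.
Proof. by apply: (@addIr _ (dterm 0 m)); rewrite -dtermD !add0r. Qed.

Lemma dderivE p : dderiv delta p = \sum_(m <- msupp p) dterm p@_m m.
Proof. by []. Qed.

Lemma dderivEw (d : {fset {cmonom (J * nat)%type}}) (p : dP) : (msupp p `<=` d)%fset ->
  dderiv delta p = \sum_(m <- d) dterm p@_m m.
Proof.
move=> le; rewrite dderivE [LHS](big_fset_incl _ le) //= => m _ /mcoeff_outdom ->.
exact: dterm0.
Qed.

Lemma dderivD (p q : dP) : dderiv delta (p + q) = dderiv delta p + dderiv delta q.
Proof.
rewrite (dderivEw (msuppD_le p q)) (dderivEw (fsubsetUl (msupp p) (msupp q))).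
rewrite (dderivEw (fsubsetUr (msupp p) (msupp q))) -big_split /=.
by apply: eq_bigr => m _; rewrite mcoeffD dtermD.
Qed.

Lemma dderiv0 : dderiv delta (0 : dP) = 0.
Proof. by apply: (@addIr _ (dderiv delta 0)); rewrite -dderivD !add0r. Qed.

Lemma dderivU c m : dderiv delta (<< c *g m >> : dP) = dterm c m.
Proof.
by rewrite (dderivEw msuppU_le) big_seq_fset1 mcoeffUU.
Qed.

Lemma dderiv_sum (T : Type) (r : seq T) (P : pred T) (f : T -> dP) :
  dderiv delta (\sum_(i <- r | P i) f i) = \sum_(i <- r | P i) dderiv delta (f i).
Proof. exact: (big_morph _ dderivD dderiv0). Qed.

Lemma dterm_sumEw (c : F) (m : {cmonom (J * nat)%type}) (d : {fset J * nat}) : (finsupp m `<=` d)%fset ->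
  \sum_(v <- finsupp m) << c *+ m v *g mmul (divcm m (ucm v)) (ucm (dshift v)) >> =
  \sum_(v <- d) << c *+ m v *g mmul (divcm m (ucm v)) (ucm (dshift v)) >> :> dP.
Proof.
move=> le; rewrite [LHS](big_fset_incl _ le) //= => v _.
by rewrite -cmE_neq0 negbK => /eqP ->; rewrite mulr0n monalgU0.
Qed.

Lemma dtermM c1 c2 m1 m2 :
  dterm (c1 * c2) (mmul m1 m2) = dterm c1 m1 * << c2 *g m2 >> + << c1 *g m1 >> * dterm c2 m2.
Proof.
case: dd => hD hM; rewrite /dterm mdomD.
rewrite (dterm_sumEw _ (fsubsetUl (finsupp m1) (finsupp m2))).
rewrite (dterm_sumEw _ (fsubsetUr (finsupp m1) (finsupp m2))).
have e1 := malgUU (delta c1) c2 m1 m2; have e2 := malgUU c1 (delta c2) m1 m2.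
have e3 : << delta (c1 * c2) *g mmul m1 m2 >> =
    << delta c1 * c2 *g mmul m1 m2 >> + << c1 * delta c2 *g mmul m1 m2 >> :> dP.
  by rewrite hM monalgUD.
have aux (R : nzRingType) (a b c e s1 s2 : R) :
  (a + s1) * c + e * (b + s2) = (a * c + e * b) + (s1 * c + e * s2).
  by rewrite mulrDl mulrDr addrACA.
rewrite aux.
congr (_ + _).
  rewrite e3.
  apply: f_equal2.
    exact: esym e1.
  exact: esym e2.
rewrite [X in _ = X + _]mulr_suml.
rewrite [X in _ = _ + X]mulr_sumr.
rewrite -big_split /=.
apply: eq_bigr => v _.
rewrite cmM mulrnDr monalgUD; congr (_ + _).
  rewrite (malgUU (c1 *+ m1 v) c2 (mmul (divcm m1 (ucm v)) (ucm (dshift v))) m2) mulrnAl.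
  have [->|m0] := posnP (m1 v); first by rewrite !mulr0n !monalgU0.
  have -> : mmul (divcm (mmul m1 m2) (ucm v)) (ucm (dshift v)) =
      mmul (mmul (divcm m1 (ucm v)) (ucm (dshift v))) m2.
    apply/eqP/cmP => w; rewrite !cmM !divcmE !cmM !cmU.
    by case: (eqVneq v w) m0 => [<-|_] m0; lia.
  reflexivity.
rewrite (malgUU c1 (c2 *+ m2 v) m1 (mmul (divcm m2 (ucm v)) (ucm (dshift v)))) mulrnAr.
have [->|m0] := posnP (m2 v); first by rewrite !mulr0n !monalgU0.
have -> : mmul (divcm (mmul m1 m2) (ucm v)) (ucm (dshift v)) =
    mmul m1 (mmul (divcm m2 (ucm v)) (ucm (dshift v))).
  apply/eqP/cmP => w; rewrite !cmM !divcmE !cmM !cmU.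
  by case: (eqVneq v w) m0 => [<-|_] m0; lia.
reflexivity.
Qed.

Lemma dderivM (p q : dP) :
  dderiv delta (p * q) = dderiv delta p * q + p * dderiv delta q.
Proof.
have h1 c m r : dderiv delta (<< c *g m >> * r) = dterm c m * r + << c *g m >> * dderiv delta r.
  rewrite [in LHS](monalgE r) mulr_sumr dderiv_sum.
  transitivity (\sum_(m' <- msupp r) (dterm c m * << r@_m' *g m' >> + << c *g m >> * dterm r@_m' m')).
    by apply: eq_bigr => m' _; rewrite malgUU dderivU dtermM.
  rewrite big_split; apply: f_equal2.
    by rewrite -[LHS]mulr_sumr -monalgE.
  by rewrite -[LHS]mulr_sumr -dderivE.
rewrite [in LHS](monalgE p) mulr_suml dderiv_sum.
transitivity (\sum_(m <- msupp p) (dterm p@_m m * q + << p@_m *g m >> * dderiv delta q)).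
  by apply: eq_bigr => m _; apply: h1.
rewrite big_split; apply: f_equal2.
  by rewrite -[LHS]mulr_suml -dderivE.
by rewrite -[LHS]mulr_suml -monalgE.
Qed.

Lemma dderivC c : dderiv delta (c%:MP : dP) = (delta c)%:MP.
Proof. by rewrite dderivU /dterm mdom1 big_seq_fset0 addr0. Qed.

Lemma derivation1 : delta 1 = 0.
Proof.
case: dd => _ hM; have := hM 1 1; rewrite !mulr1 mul1r => h.
by apply: (@addIr _ (delta 1)); rewrite -h add0r.
Qed.

Lemma dderivX v : dderiv delta (<< ucm v >> : dP) = << ucm (dshift v) >>.
Proof.
rewrite dderivU /dterm derivation1 monalgU0 add0r mdomU big_seq_fset1 cmUU mulr1n.
congr << _ >>; apply/eqP/cmP => w; rewrite cmM divcmE subnn; exact: add0n.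
Qed.

Lemma iter_dderivX v k : iter k (dderiv delta) (<< ucm v >> : dP) = << ucm (v.1, (v.2 + k)%N) >>.
Proof.
elim: k => [|k IH]; first by rewrite addn0; case: v.
rewrite iterS IH dderivX /dshift /= addnS; reflexivity.
Qed.

Lemma derivation_dderiv : derivation (dderiv delta : dP -> dP).
Proof. by split; [apply: dderivD | apply: dderivM]. Qed.

Lemma ev_dderiv (S : comNzRingType) (D : S -> S) (iota : {rmorphism F -> S}) (x : J * nat -> S) p :
  derivation D -> (forall c, D (iota c) = iota (delta c)) -> (forall v, D (x v) = x (dshift v)) ->
  D (ev iota x p) = ev iota x (dderiv delta p).
Proof.
move=> dD DC DX; elim/dpoly_ind: p => [c|v|p q hp hq|p q hp hq].
- by rewrite (fevC iota x c) (dderivC c) (fevC iota x (delta c)); exact: DC.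
- rewrite (fevX iota x v) (dderivX v) (fevX iota x (dshift v)); exact: DX.
- exact: (commute_derivationD (g := ev iota x) derivation_dderiv dD hp hq).
- exact: (commute_derivationM (g := ev iota x) derivation_dderiv dD hp hq).
Qed.

Lemma vars_in_dderiv (P P' : J * nat -> Prop) (p : dP) :
  (forall v, P v -> P' v /\ P' (dshift v)) -> vars_in P p -> vars_in P' (dderiv delta p).
Proof.
move=> h; rewrite dderivE => hp; rewrite big_seq; apply: monomials_in_sum => m.
rewrite -mcoeff_neq0 => pm; have hm := hp m pm; apply: monomials_inD.
  by apply: monomials_inU => v /hm/h[].
rewrite big_seq; apply: monomials_in_sum => v; rewrite -cmE_neq0 => vm.
apply: monomials_inU => w; rewrite cmM divcmE addn_eq0 negb_and => /orP[mw|].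
  by apply: (proj1 (h w _)); apply: hm; apply: contraNneq mw => ->.
rewrite cmU; case: (eqVneq (dshift v) w) => // <- _.
by apply: (proj2 (h v _)); apply: hm.
Qed.

Lemma deg_le_dderiv n (p : dP) : deg_le n p -> deg_le n (dderiv delta p).
Proof.
rewrite dderivE => hp; rewrite big_seq; apply: monomials_in_sum => m.
rewrite -mcoeff_neq0 => pm; have hm := hp m pm; apply: monomials_inD.
  exact: monomials_inU.
rewrite big_seq; apply: monomials_in_sum => v; rewrite -cmE_neq0 => vm.
apply: monomials_inU; rewrite mdegM mdegU.
have e : m = mmul (divcm m (ucm v)) (ucm v).
  by apply/eqP/cmP => w; rewrite cmM divcmE cmU; case: eqP => [<-|]; lia.
by move: hm; rewrite {1}e mdegM mdegU.
Qed.

(** The formal partial derivative with respect to [v]. *)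
Definition dpart (v : J * nat) (p : dP) : dP :=
  \sum_(m <- msupp p) << p@_m *+ m v *g divcm m (ucm v) >>.

(** The derivative of [v] arises from differentiating [v], with the coefficient
    [dpart v p], or was already present in [p]. *)
Lemma dderiv_split (v : J * nat) (p : dP) : exists B : dP,
  dderiv delta p = dpart v p * << ucm (dshift v) >> + B /\
  vars_in (fun w => w \in mvars p \/ exists2 u, u \in mvars p & u != v /\ w = dshift u) B.
Proof.
exists (\sum_(m <- msupp p) (<< delta p@_m *g m >> + \sum_(u <- (finsupp m `\ v)%fset)
   << p@_m *+ m u *g mmul (divcm m (ucm u)) (ucm (dshift u)) >>)); split.
  rewrite dderivE /dpart mulr_suml -big_split; apply: eq_bigr => m _ /=.
  have := malgUU (p@_m *+ m v) 1 (divcm m (ucm v)) (ucm (dshift v)).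
  rewrite mulr1 => ->; rewrite /dterm [RHS]addrCA; apply: (congr1 (+%R _)).
  have [vm|vm] := boolP (v \in finsupp m); first by rewrite (big_fsetD1 v).
  have -> : m v = 0%N by apply/eqP; rewrite cmE_eq0.
  have -> : (finsupp m `\ v)%fset = finsupp m.
    by apply/fsetP => u; rewrite in_fsetD1; case: eqP => // ->; rewrite (negPf vm).
  rewrite mulr0n monalgU0 add0r; reflexivity.
rewrite big_seq; apply: monomials_in_sum => m.
rewrite -mcoeff_neq0 => pm; apply: monomials_inD.
  by apply: monomials_inU => w mw; left; apply/mvarsP; exists m.
rewrite big_seq; apply: monomials_in_sum => u; rewrite in_fsetD1 -cmE_neq0 => /andP[uv um].
apply: monomials_inU => w; rewrite cmM divcmE addn_eq0 negb_and => /orP[mw|].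
  by left; apply/mvarsP; exists m => //; apply: contraNneq mw => ->.
rewrite cmU; case: (eqVneq (dshift u) w) => // <- _; right; exists u => //.
by apply/mvarsP; exists m.
Qed.

Lemma mcoeff_dpart (v : J * nat) (p : dP) (m : {cmonom (J * nat)%type}) : m v != 0%N -> (dpart v p)@_(divcm m (ucm v)) = p@_m *+ m v.
Proof.
move=> mv; rewrite /dpart raddf_sum /=.
have h m' : m' != m -> (<< p@_m' *+ m' v *g divcm m' (ucm v) >> : dP)@_(divcm m (ucm v)) = 0.
  move=> ne; rewrite mcoeffU; have [->|m'v] := eqVneq (m' v) 0%N; first by rewrite mulr0n mul0rn.
  case: eqP => [e|_]; last by rewrite mulr0n.
  case/eqP: ne; apply/eqP/cmP => w; have := congr1 (fun mm : {cmonom (J * nat)%type} => mm w) e.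
  rewrite !divcmE cmU; case: (eqVneq v w) => [<-|_]; lia.
have [pm|pm] := boolP (m \in msupp p).
  rewrite (big_fsetD1 m pm) big1_fset => [|m'].
    exact: etrans (addr0 _) (mcoeffUU _ _).
  by rewrite in_fsetD1 => /andP[ne _] _; apply: h.
rewrite (mcoeff_outdom pm) mul0rn; apply: big1_fset => m' m'p _.
by apply: h; apply: contraNneq pm => <-.
Qed.

(** In characteristic zero the exponent of [v] in a monomial does not vanish in [F],
    and distinct monomials involving [v] have distinct quotients by [v]. *)
Lemma dpart_neq0 v (p : dP) : [pchar F] =i pred0 -> v \in mvars p -> dpart v p != 0.
Proof.
move=> ch /mvarsP [m pm mv]; apply/eqP => h.
have := mcoeff_dpart p mv; rewrite h mcoeff0 => /esym/eqP.
rewrite -mulr_natr mulf_eq0 (negPf pm) /=.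
by move/pcharf0P: ch => ->; rewrite (negPf mv).
Qed.

Lemma dpart_monomial (v : J * nat) (p : dP) (m : {cmonom (J * nat)%type}) : (dpart v p)@_m != 0 ->
  exists m', [/\ p@_m' != 0, m' v != 0%N & m = divcm m' (ucm v)].
Proof.
move=> h; apply: NNPP => H; case/eqP: h; rewrite /dpart raddf_sum /= big_seq.
apply: big1 => m'; rewrite -mcoeff_neq0 => pm'; rewrite mcoeffU.
have [->|m'v] := eqVneq (m' v) 0%N; first by rewrite mulr0n mul0rn.
by case: eqP => [e|_]; rewrite ?mulr0n //; case: H; exists m'.
Qed.

Lemma deriv_ev_free_at (S : comNzRingType) (iota : {rmorphism F -> S}) (x : J * nat -> S) v p :
  (ev (polyC \o iota : {rmorphism F -> {poly S}}) (free_at x v) p)^`() =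
  ev (polyC \o iota : {rmorphism F -> {poly S}}) (free_at x v) (dpart v p).
Proof.
rewrite evE (raddf_sum deriv) /dpart rmorph_sum; apply: eq_bigr => m _.
have mevE (m' : {cmonom (J * nat)%type}) : (forall w, w != v -> m' w = m w) ->
   mev (free_at x v) m' = 'X^(m' v) * (\prod_(w <- (finsupp m `\ v)%fset) x w ^+ m w)%:P.
  move=> e; have sub : (finsupp m' `<=` v |` finsupp m)%fset.
    apply/fsubsetP => w; rewrite !inE -!cmE_neq0; case: (eqVneq w v) => //= wv.
    by rewrite e.
  rewrite (mevEw _ sub) (big_fsetD1 v) ?fset1U1 //= /free_at eqxx; congr (_ * _).
  have -> : ((v |` finsupp m) `\ v)%fset = (finsupp m `\ v)%fset.
    by apply/fsetP => w; rewrite !inE; case: eqP.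
  rewrite rmorph_prod; apply: eq_big_seq => w; rewrite !inE => /andP[wv _] /=.
  by rewrite (negPf wv) e // rmorphXn.
have evU' := evU (polyC \o iota : {rmorphism F -> {poly S}}) (free_at x v).
rewrite [RHS]evU' [in RHS]mevE => [|w wv]; last by rewrite divcmE cmU eq_sym (negPf wv) subn0.
rewrite mevE // divcmE cmU eqxx subn1 /= derivM derivC mul0r add0r derivM derivXn derivC.
by rewrite mulr0 addr0 raddfMn /= mulrnAl raddfMn /= !mulrnAl mulrnAr.
Qed.
End Derivation.

(** * Rankings, characteristic sets and prolongations *)

Section RankingTheory.
Context {J : choiceType} (le : rel (J * nat)).
Hypothesis rk : ranking le.

Definition rlt v w := le v w && (v != w).
Definition dshiftn (k : nat) (v : J * nat) : J * nat := (v.1, v.2 + k)%N.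

Lemma rle_refl v : le v v. Proof. by case: rk => [[h _ _ _] _ _]. Qed.
Lemma rle_anti v w : le v w -> le w v -> v = w.
Proof. by case: rk => [[_ h _ _] _ _] a b; apply: h; rewrite a b. Qed.
Lemma rle_trans u v w : le u v -> le v w -> le u w.
Proof. by case: rk => [[_ _ h _] _ _]; apply: h. Qed.

Lemma rlt_le_trans u v w : rlt u v -> le v w -> rlt u w.
Proof.
move=> /andP[uv ne] vw; rewrite /rlt (rle_trans uv vw) /=.
by apply: contra_neq ne => e; apply: rle_anti => //; rewrite e.
Qed.

Lemma rle_lt_trans u v w : le u v -> rlt v w -> rlt u w.
Proof.
move=> uv /andP[vw ne]; rewrite /rlt (rle_trans uv vw) /=.
by apply: contra_neq ne => e; apply: rle_anti => //; rewrite -e.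
Qed.

Lemma rltW u v : rlt u v -> le u v. Proof. by case/andP. Qed.
Lemma rlt_neq u v : rlt u v -> u != v. Proof. by case/andP. Qed.

Lemma rlt_shift v : rlt v (dshift v).
Proof. by case: v => j k; case: rk => [_ h _]; apply: h. Qed.

Lemma rlt_shift2 v w : rlt v w -> rlt (dshift v) (dshift w).
Proof. by case: v w => [i k] [j l]; case: rk => [_ _ h]; apply: h. Qed.

Lemma rle_shift2 v w : le v w -> le (dshift v) (dshift w).
Proof.
move=> h; have [->|ne] := eqVneq v w; first exact: rle_refl.
by apply/rltW/rlt_shift2; rewrite /rlt h.
Qed.

Lemma dshiftnS k v : dshiftn k.+1 v = dshift (dshiftn k v).
Proof. by rewrite /dshiftn /dshift /= addnS. Qed.

Lemma dshiftn0 v : dshiftn 0 v = v.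
Proof. by rewrite /dshiftn addn0; case: v. Qed.

Lemma rle_shiftn v k : le v (dshiftn k v).
Proof.
elim: k => [|k IH]; first by rewrite dshiftn0 rle_refl.
by rewrite dshiftnS; apply: rle_trans IH _; apply/rltW/rlt_shift.
Qed.

Lemma rlt_order j k l : (k < l)%N -> rlt (j, k) (j, l).
Proof.
move=> kl; have -> : (j, l) = dshift (dshiftn (l - k.+1) (j, k)).
  by rewrite /dshift /dshiftn /=; congr (_, _); lia.
exact: rle_lt_trans (rle_shiftn _ _) (rlt_shift _).
Qed.

End RankingTheory.

Section DegreeIn.
Context {J : choiceType} {F : fieldType}.
Implicit Types (p : mpol (J * nat)%type F).

Lemma ddeg_in_leP v p n : reflect (forall m, p@_m != 0 -> (m v <= n)%N) (ddeg_in v p <= n)%N.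
Proof.
apply: (iffP (bigmax_leqP_seq _ _ _ _)) => h m.
  by rewrite mcoeff_neq0 => mp; apply: h.
by move=> mp _; apply: h; rewrite mcoeff_neq0.
Qed.

Lemma ddeg_leP p n : reflect (deg_le n p) (ddeg p <= n)%N.
Proof.
apply: (iffP (bigmax_leqP_seq _ _ _ _)) => h m.
  by rewrite mcoeff_neq0 => mp; apply: h.
by move=> mp _; apply: h; rewrite mcoeff_neq0.
Qed.

Lemma dord_leP p n : reflect (forall v, v \in mvars p -> (v.2 <= n)%N) (dord p <= n)%N.
Proof.
apply: (iffP (bigmax_leqP_seq _ _ _ _)) => h v; first by move=> vp; apply: h.
by move=> vp _; apply: h.
Qed.

Lemma ddeg_in_gt0 v p : (0 < ddeg_in v p)%N = (v \in mvars p).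
Proof.
apply/idP/mvarsP => [|[m pm mv]].
  rewrite ltnNge => /ddeg_in_leP H; apply: NNPP => nex; apply: H => m pm.
  by rewrite leqn0; apply/negPn/negP => mv; apply: nex; exists m.
rewrite ltnNge; apply/negP => /ddeg_in_leP /(_ m pm).
by rewrite leqn0 (negPf mv).
Qed.

End DegreeIn.

Section CharacteristicSets.
Context {J : choiceType} {F : fieldType} (delta : F -> F).
Hypotheses (dd : derivation delta) (ch0 : [pchar F] =i pred0).
Context (I : mpol (J * nat)%type F -> Prop) (le : rel (J * nat)).
Hypothesis rk : ranking le.
Context (T : finType) (A : T -> mpol (J * nat)%type F) (ld : T -> J * nat).
Hypothesis csA : characteristic_set le I A.
Hypothesis ldP : forall t, is_leader le (A t) (ld t).

Lemma leader_unique (p : mpol (J * nat)%type F) v w : is_leader le p v -> is_leader le p w -> v = w.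
Proof. by move=> [vp hv] [wp hw]; apply: (rle_anti rk); [apply: hw | apply: hv]. Qed.

Lemma leader_in t : ld t \in mvars (A t).
Proof. by case: (ldP t). Qed.

Lemma leader_max t w : w \in mvars (A t) -> le w (ld t).
Proof. by case: (ldP t) => _ h; apply: h. Qed.

(** The polynomial involves neither the leaders nor their derivatives, hence it is
    reduced with respect to [A]. *)
Lemma parametric_eq0 c : I c ->
  vars_in (fun w => forall t, w.1 = (ld t).1 -> (w.2 < (ld t).2)%N) c -> c = 0.
Proof.
case: csA => _ _ h Ic pc; apply: h => // t v /(leader_unique (ldP t)) <-.
have pc' := proj1 (vars_in_subset _ _) pc.
split=> [k vk|].
  by apply/negP => /(pc' (_, k)) /(_ t erefl) /=; lia.
apply: leq_ltn_trans (_ : 0 < _)%N; last by rewrite ddeg_in_gt0 leader_in.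
rewrite leqNgt ddeg_in_gt0; apply/negP => /pc' /(_ t erefl).
by rewrite ltnn.
Qed.

Definition separant t := dpart (ld t) (A t).

Lemma separant_vars t : vars_in (fun w => w \in mvars (A t)) (separant t).
Proof.
move=> m /dpart_monomial [m' [pm' m'v ->]] w; rewrite divcmE => h.
by apply/mvarsP; exists m' => //; apply: contraNneq h => ->.
Qed.

Lemma ddeg_in_separant t w : (ddeg_in w (separant t) <= ddeg_in w (A t))%N.
Proof.
apply/ddeg_in_leP => m /dpart_monomial [m' [pm' m'v ->]]; rewrite divcmE.
apply: leq_trans (leq_subr _ _) _.
by have /ddeg_in_leP := leqnn (ddeg_in w (A t)); apply.
Qed.

(** The separant is nonzero, of smaller degree than [A t] in its leader, and reduced
    with respect to the other elements of [A] as [A t] is: it would contradict the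
    characterization of characteristic sets. *)
Lemma separant_notin t : ~ I (separant t).
Proof.
case: csA => [[_ red] _ h] Is.
have vs := proj1 (vars_in_subset _ _) (@separant_vars t).
have /eqP [] : separant t != 0 by apply: dpart_neq0 => //; apply: leader_in.
apply: h => // s v lv; have [est|nst] := eqVneq s t.
  rewrite est in lv *; rewrite -(leader_unique (ldP t) lv); split=> [k kl|].
    apply/negP => /vs /leader_max h; have := rlt_order rk (ld t).1 kl.
    move/(rlt_le_trans rk)/(_ h); rewrite /rlt; case: (ld t) => a b /=.
    by rewrite eqxx andbF.
  have D0 : (0 < ddeg_in (ld t) (A t))%N by rewrite ddeg_in_gt0 leader_in.
  rewrite -(prednK D0) ltnS; apply/ddeg_in_leP => m /dpart_monomial [m' [pm' m'v ->]].
  rewrite divcmE cmUU -subn1 leq_sub2r //.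
  by have /ddeg_in_leP := leqnn (ddeg_in (ld t) (A t)); apply.
rewrite eq_sym in nst; have [h1 h2] := red t s nst v lv.
split=> [k vk|]; first by apply: contra (h1 k vk) => /vs.
exact: leq_ltn_trans (ddeg_in_separant t v) h2.
Qed.

(** If two leaders were derivatives of the same letter, the element with the leader
    of higher order would not be reduced with respect to the other one. *)
Lemma leader_letters s t : s != t -> (ld s).1 != (ld t).1.
Proof.
case: csA => [[_ red] _ _]; wlog: s t / ((ld s).2 <= (ld t).2)%N => [wl|le2] st.
  have [h|/ltnW h] := leqP (ld s).2 (ld t).2; first exact: wl.
  by rewrite eq_sym; apply: wl; rewrite // eq_sym.
apply/eqP => e; rewrite leq_eqVlt in le2; case/orP: le2 => [/eqP e2|lt2].
  have els : ld s = ld t by move: e e2; case: (ld s) => a b; case: (ld t) => a' b' /= -> ->.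
  have [_ h1] := red s t st _ (ldP t).
  have [_ h2] := red t s (introN eqP (fun x => elimN eqP st (esym x))) _ (ldP s).
  by move: h1; rewrite -els ltnNge (ltnW h2).
have ts : t != s by rewrite eq_sym.
have [h _] := red t s ts _ (ldP s).
have := h _ lt2; rewrite e.
have -> : ((ld t).1, (ld t).2) = ld t by case: (ld t).
by move/negP; apply; apply: leader_in.
Qed.

Lemma dord_leader t : orderly le -> dord (A t) = (ld t).2.
Proof.
move=> ord; apply/eqP; rewrite eqn_leq; apply/andP; split.
  apply/dord_leP => w wA; rewrite leqNgt; apply/negP => lt2.
  have := ord w.1 (ld t).1 _ _ lt2.
  have -> : ((ld t).1, (ld t).2) = ld t by case: (ld t).
  have -> : (w.1, w.2) = w by case: (w).
  by case/andP => h1; rewrite (rle_anti rk h1 (leader_max wA)) eqxx.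
by have /dord_leP := leqnn (dord (A t)); apply; apply: leader_in.
Qed.

(** The proper derivatives of [A t] are linear in their leader, with the separant as
    coefficient. *)
Lemma prolongation t k : exists B,
  iter k.+1 (dderiv delta) (A t) = separant t * << ucm (dshiftn k.+1 (ld t)) >> + B /\
  vars_in (fun w => rlt le w (dshiftn k.+1 (ld t))) B.
Proof.
elim: k => [|k [B [eB vB]]].
  have [B [eB vB]] := dderiv_split delta (ld t) (A t).
  exists B; split; first by rewrite /= eB dshiftnS dshiftn0.
  apply: vars_inW vB => w; rewrite dshiftnS dshiftn0 => -[wA|[u uA [un ->]]].
    exact: (rle_lt_trans rk (leader_max wA) (rlt_shift rk _)).
  by apply: rlt_shift2 => //; rewrite /rlt (leader_max uA).
exists (dderiv delta (separant t) * << ucm (dshiftn k.+1 (ld t)) >> + dderiv delta B); split.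
  rewrite iterS eB (dderivD dd) (dderivM dd) (dderivX dd) -dshiftnS.
  have aux (R : nzRingType) (a b c : R) : a + b + c = b + (a + c) by rewrite [a + b]addrC addrA.
  exact: aux.
have lk : rlt le (dshiftn k.+1 (ld t)) (dshiftn k.+2 (ld t)).
  by rewrite [dshiftn k.+2 _]dshiftnS; apply: rlt_shift.
apply: monomials_inD.
  apply: vars_inM; last exact: vars_inX.
  apply: (vars_in_dderiv _ (@separant_vars t)) => w /leader_max wl.
  have h : le w (dshiftn k.+1 (ld t)) by apply: rle_trans wl (rle_shiftn rk _ _).
  split; first exact: rle_lt_trans h lk.
  apply: (rle_lt_trans rk _ lk); rewrite dshiftnS; apply: rle_shift2 => //.
  exact: rle_trans wl (rle_shiftn rk _ _).
apply: (vars_in_dderiv _ vB) => w wl; split.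
  exact: (rlt_le_trans rk wl (rltW lk)).
by rewrite [dshiftn k.+2 _]dshiftnS; apply: rlt_shift2.
Qed.

Lemma prolongation_vars t k :
  vars_in (fun w => le w (dshiftn k (ld t))) (iter k (dderiv delta) (A t)).
Proof.
elim: k => [|k IH].
  by apply/vars_in_subset => w /leader_max; rewrite dshiftn0.
rewrite iterS; apply: (vars_in_dderiv _ IH) => w wl; rewrite dshiftnS.
split; last exact: rle_shift2.
exact: (rle_trans rk wl (rltW (rlt_shift rk _))).
Qed.

Lemma prolongation_degree t k n : deg_le n (A t) -> deg_le n (iter k (dderiv delta) (A t)).
Proof. by move=> h; elim: k => // k IH; rewrite iterS; apply: deg_le_dderiv. Qed.

Hypothesis idI : prime_differential_ideal (dderiv delta) I.

Lemma prolongation_in t k : I (iter k (dderiv delta) (A t)).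
Proof.
case: csA idI => _ h _ [[_ _ _ hd] _ _].
by elim: k => [|k IH]; [apply: h | rewrite iterS; apply: hd].
Qed.

(** The separant does not vanish at a generic zero. It is the coefficient of the
    leader in a proper derivative of [A t]; for [A t] itself, it is the partial
    derivative with respect to the leader. *)
Lemma prolongation_free (S : idomainType) (iota : {rmorphism F -> S}) (x : J * nat -> S) t k :
  (forall p, ev iota x p = 0 -> I p) ->
  ev (polyC \o iota : {rmorphism F -> {poly S}}) (free_at x (dshiftn k (ld t)))
     (iter k (dderiv delta) (A t)) != 0.
Proof.
move=> gen; have Sx : ev iota x (separant t) != 0.
  by apply/eqP => /gen; apply: separant_notin.
case: k => [|k].
  rewrite dshiftn0 -[iter 0 _ _]/(A t); apply/eqP => h.
  have := deriv_ev_free_at iota x (ld t) (A t); rewrite h deriv0 => /esym h'.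
  have := congr1 (fun q : {poly S} => q.[x (ld t)]) h'; rewrite horner0.
  rewrite -[_.[_]]/(horner_eval _ _) (@rmorph_ev _ _ _ _ _ (horner_eval (x (ld t))) iota).
    move=> h2; case/eqP: Sx; rewrite -[RHS]h2; apply: eq_ev => m _ w _ /=.
    rewrite /horner_eval /free_at; case: eqP => [->|_]; first by rewrite hornerX.
    by rewrite hornerC.
  by move=> c; rewrite /= /horner_eval hornerC.
have [B [-> vB]] := prolongation t k.
set v := dshiftn k.+1 (ld t).
rewrite fevD fevM fevX free_at_constant; last first.
  apply: vars_inW (@separant_vars t) => w /leader_max wl.
  by apply: (rlt_neq (le := le)); apply: (rle_lt_trans rk wl); rewrite /v dshiftnS;
    apply: (rle_lt_trans rk (rle_shiftn rk _ _) (rlt_shift rk _)).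
rewrite free_at_constant; last by apply: vars_inW vB => w /rlt_neq.
rewrite /free_at eqxx.
apply/eqP => /(congr1 (fun q : {poly S} => q`_1)).
rewrite coefD coefCM coefX coefC coef0 /= addr0 mulr1 => h.
by case/eqP: Sx; exact: h.
Qed.

End CharacteristicSets.

(** * A generic zero of the Chow ideal *)

Lemma rmorph_differenceD (R : comNzRingType) (g : {rmorphism R -> R}) (p q : R) :
  (p + q) - g (p + q) = (p - g p) + (q - g q).
Proof. by rewrite rmorphD opprD addrACA. Qed.

(** Shows that the congruence of [p] and [g p] modulo an ideal is stable under
    products. *)
Lemma rmorph_differenceM (R : comNzRingType) (g : {rmorphism R -> R}) (p q : R) :
  p * q - g (p * q) = q * (p - g p) + g p * (q - g q).
Proof. by rewrite rmorphM; ring. Qed.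

Section GenericZero.
Context {F : fieldType} (delta : F -> F) (n d : nat).
Hypothesis dd : derivation delta.
Context (I : mpol ('I_n * nat)%type F -> Prop).
Context (K : fieldType) (iota : {rmorphism F -> K}) (D : K -> K) (eta : 'I_n -> K).
Hypothesis ext : differential_extension delta iota D.
Hypothesis gen : generic_point iota D I eta.

Local Notation C := (chow_index n d).
Local Notation YU := ('I_n + C)%type.
Local Notation B := (mpol ('I_n * nat)%type F).
Local Notation PYU := (mpol (YU * nat)%type F).
Local Notation S := (mpol (C * nat)%type K).

Lemma extension_derivation : derivation D. Proof. by case: ext. Qed.
Lemma extension_constants a : D (iota a) = iota (delta a). Proof. by case: ext. Qed.

Lemma drenameE (J J' : choiceType) (f : J -> J') (p : mpol (J * nat)%type F) :
  drename delta f p = ev (malgCr (J' * nat)%type F) (fun v => << ucm (f v.1, v.2) >>) p.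
Proof.
rewrite -[drename _ _ _]/(ev (malgCr (J' * nat)%type F)
   (fun v => iter v.2 (dderiv delta) (dvar (f v.1) 0)) p).
by apply: eq_ev => m _ v _; rewrite /dvar (iter_dderivX dd) add0n.
Qed.

(** The letters [y] take the values [eta], and each [u_i0] is solved for in
    [P_i = 0]; the other [u_ij] stay indeterminate. *)
Definition chow_zero0 (a : YU) : S :=
  match a with
  | inl j => (eta j)%:MP
  | inr c => if unlift ord0 c.2 is Some j then << ucm (c, 0%N) >>
             else - \sum_(j < n) << ucm ((c.1, lift ord0 j), 0%N) >> * (eta j)%:MP
  end.

Definition chow_zero (v : YU * nat) : S := iter v.2 (dderiv D) (chow_zero0 v.1).

Definition iotaS : {rmorphism F -> S} := malgCr (C * nat)%type K \o iota.

Definition ev_chow : {rmorphism PYU -> S} := ev iotaS chow_zero.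

Lemma chow_zero_shift v : dderiv D (chow_zero v) = chow_zero (dshift v).
Proof. by []. Qed.

Lemma chow_zero_y j k : chow_zero (inl j, k) = (iter k D (eta j))%:MP.
Proof.
rewrite /chow_zero /=; elim: k => [|k IH]; first by [].
rewrite !iterS IH; exact: (dderivC extension_derivation).
Qed.

Lemma chow_zero_u (c : C) k : c.2 != ord0 -> chow_zero (inr c, k) = << ucm (c, k) >>.
Proof.
rewrite eq_sym => c0; rewrite /chow_zero /=; have [j _ ->] := unlift_some c0.
exact: (iter_dderivX extension_derivation).
Qed.

Lemma ev_chow_dderiv p : dderiv D (ev_chow p) = ev_chow (dderiv delta p).
Proof.
apply: (ev_dderiv dd); first exact: (derivation_dderiv extension_derivation).
  by move=> c; rewrite /iotaS /= -extension_constants; exact: (dderivC extension_derivation).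
exact: chow_zero_shift.
Qed.

Lemma ev_chow_iter_dderiv k p : iter k (dderiv D) (ev_chow p) = ev_chow (iter k (dderiv delta) p).
Proof. elim: k => [|k IH]; first reflexivity. rewrite !iterS IH; exact: ev_chow_dderiv. Qed.

Lemma ev_chow_X v : ev_chow << ucm v >> = chow_zero v.
Proof. exact: fevX. Qed.

Lemma generic_vanishes p : I p <-> ev iota (fun v => iter v.2 D (eta v.1)) p = 0.
Proof. exact: gen. Qed.

Lemma ev_chow_inl p : ev_chow (drename delta (@inl 'I_n C) p) =
  (ev iota (fun v => iter v.2 D (eta v.1)) p)%:MP.
Proof.
rewrite drenameE (@rmorph_ev _ _ _ (malgCr _ F) _ ev_chow iotaS) => [|c]; last exact/esym/evC.
have e : malgCr (C * nat)%type K (ev iota (fun v => iter v.2 D (eta v.1)) p) =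
    ev iotaS (malgCr (C * nat)%type K \o (fun v => iter v.2 D (eta v.1))) p.
  exact: rmorph_ev.
apply: etrans (esym e); apply: eq_ev => m _ v _.
rewrite [LHS]ev_chow_X; exact: chow_zero_y.
Qed.

Lemma ev_chow_inr p : ev_chow (drename delta (@inr 'I_n C) p) = ev iotaS (fun v => chow_zero (inr v.1, v.2)) p.
Proof.
rewrite drenameE (@rmorph_ev _ _ _ (malgCr _ F) _ ev_chow iotaS) => [|c]; last exact/esym/evC.
apply: eq_ev => m _ v _; exact: ev_chow_X.
Qed.

Lemma ev_chow_hyperplane i : ev_chow (@generic_hyperplane F n d i) = 0.
Proof.
rewrite /generic_hyperplane rmorphD rmorph_sum /= -/ev_chow.
rewrite [ev_chow (dvar _ _)]ev_chow_X {1}/chow_zero /= unlift_none addrC.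
apply/eqP; rewrite subr_eq0; apply/eqP; apply: eq_bigr => j _.
rewrite [ev_chow _]rmorphM; apply: f_equal2.
  by rewrite [LHS]ev_chow_X chow_zero_u.
by rewrite [LHS]ev_chow_X chow_zero_y.
Qed.

Definition chow_generator (q : PYU) : Prop :=
  (exists2 p, I p & q = drename delta (@inl 'I_n C) p) \/
  (exists i, q = @generic_hyperplane F n d i).

Lemma kernel_ev_chow_ideal : differential_ideal (dderiv delta) (fun q => ev_chow q = 0).
Proof.
split; first exact: rmorph0.
- by move=> a b ha hb; rewrite rmorphD ha hb addr0.
- by move=> a b hb; rewrite rmorphM hb mulr0.
- by move=> a ha; rewrite -ev_chow_dderiv ha; exact: (dderiv0 extension_derivation).
Qed.

Lemma chow_ideal_vanishes f : chow_ideal delta I f ->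
  ev iotaS (fun v => chow_zero (inr v.1, v.2)) f = 0.
Proof.
move=> h; rewrite -ev_chow_inr; apply: (h (fun q => ev_chow q = 0)); first exact: kernel_ev_chow_ideal.
move=> q [[p Ip ->]|[i ->]]; last exact: ev_chow_hyperplane.
by rewrite ev_chow_inl (proj1 (generic_vanishes p) Ip) malgC0E.
Qed.

Definition no_constant_u (v : YU * nat) : Prop :=
  if v.1 is inr c then c.2 != ord0 else True.

(** Polynomials in [y] and [u] as polynomials in [u] with coefficients in the
    polynomials in [y]; used for those without the [u_i0], whose value at the zero is
    then the value of the coefficients ([ev_chow_split]). *)
Definition split_yu : {rmorphism PYU -> mpol (C * nat)%type B} :=
  ev (malgCr (C * nat)%type B \o malgCr ('I_n * nat)%type F : {rmorphism F -> mpol (C * nat)%type B})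
     (fun v => match v.1 with
               | inl j => (<< ucm (j, v.2) >> : B)%:MP
               | inr c => << ucm (c, v.2) >> end).

Definition rename_y : {rmorphism B -> PYU} :=
  ev (malgCr (YU * nat)%type F) (fun v => << ucm (inl v.1, v.2) >>).

Definition merge_yu : {rmorphism mpol (C * nat)%type B -> PYU} :=
  ev rename_y (fun v => << ucm (inr v.1, v.2) >>).

Lemma split_yuK q : merge_yu (split_yu q) = q.
Proof.
rewrite /split_yu (@rmorph_ev _ _ _ _ _ merge_yu (malgCr (YU * nat)%type F)); last first.
  move=> c; rewrite /= [RHS]evC; exact/esym/evC.
rewrite -[RHS]ev_id; apply: eq_ev => m _ [[j|c] k] _ /=.
  rewrite [LHS]evC; exact: evX.
exact: evX.
Qed.

Definition eval_coef : {rmorphism mpol (C * nat)%type B -> S} :=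
  ev (malgCr (C * nat)%type K \o ev iota (fun v => iter v.2 D (eta v.1)) : {rmorphism B -> S})
     (fun v => << ucm v >>).

Lemma ev_chow_split q : vars_in no_constant_u q -> ev_chow q = eval_coef (split_yu q).
Proof.
move=> vq; rewrite /split_yu (@rmorph_ev _ _ _ _ _ eval_coef iotaS); last first.
  move=> c; rewrite [RHS]evC /=; apply: congr1; exact/esym/evC.
apply: eq_ev => m qm [[j|c] k] vm /=.
  rewrite chow_zero_y [RHS]evC /=; apply: congr1; exact/esym/evX.
rewrite chow_zero_u; last exact: (vq m qm _ vm).
exact/esym/evX.
Qed.

(** The [u] are independent over [K], so that each coefficient vanishes at [eta]. *)
Lemma eval_coef_eq0 r : eval_coef r = 0 -> forall m, I r@_m.
Proof.
move=> h m; apply/generic_vanishes; have hm := congr1 (mcoeff m) h.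
rewrite evE raddf_sum mcoeff0 in hm.
have e m' : ((ev iota (fun v => iter v.2 D (eta v.1)) r@_m')%:MP *
     mev (fun v => << ucm v >> : S) m')@_m =
   ev iota (fun v => iter v.2 D (eta v.1)) r@_m' *+ (m' == m).
  rewrite -malg_prodU mcoeffCM mcoeffU1; exact: mulr_natr.
apply: etrans _ hm; apply: etrans (esym (eq_bigr _ (fun m' _ => e m'))).
have [mr|mr] := boolP (m \in msupp r).
  rewrite (big_fsetD1 m mr) eqxx big1_fset => [|m'].
    exact: esym (addr0 _).
  by rewrite in_fsetD1 => /andP[/negPf -> _].
rewrite (mcoeff_outdom mr) rmorph0 big1_fset => // m' m'r _.
by have -> : (m' == m) = false by apply: contraNF mr => /eqP <-.
Qed.

Lemma merge_in_ideal (Jd : PYU -> Prop) r : differential_ideal (dderiv delta) Jd ->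
  (forall q, chow_generator q -> Jd q) -> (forall m, I r@_m) -> Jd (merge_yu r).
Proof.
move=> [j0 jD jM _] jg Ir; rewrite /merge_yu evE; apply: (big_ind Jd) => // m _.
rewrite mulrC; apply: jM; apply: jg; left; exists r@_m; first exact: Ir.
by rewrite drenameE.
Qed.

(** Eliminates the derivatives of [u_i0] by means of those of [P_i]. *)
Definition solve_u (v : YU * nat) : PYU :=
  if v.1 is inr c then
    if unlift ord0 c.2 is Some _ then << ucm v >>
    else iter v.2 (dderiv delta)
      (- \sum_(j < n) dvar (inr (c.1, lift ord0 j) : YU) 0 * dvar (inl j) 0)
  else << ucm v >>.

Definition solve : {rmorphism PYU -> PYU} := ev (malgCr (YU * nat)%type F) solve_u.

Lemma ev_chow_solve q : ev_chow (solve q) = ev_chow q.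
Proof.
rewrite /solve (@rmorph_ev _ _ _ _ _ ev_chow iotaS) => [|c]; last exact/esym/evC.
apply: eq_ev => m _ [[j|[i o]] k] _ /=; first exact: ev_chow_X.
rewrite /solve_u /=; case: unliftP => [j ->|->]; first exact: ev_chow_X.
rewrite -[mmap _ _ _]/(ev_chow _) -ev_chow_iter_dderiv /chow_zero /= unlift_none; congr (iter k _ _).
rewrite rmorphN rmorph_sum /=; congr (- _); apply: eq_bigr => j _.
rewrite -[mmap _ _ _]/(ev_chow _) [ev_chow _]rmorphM; apply: f_equal2.
  by rewrite [LHS]ev_chow_X chow_zero_u.
by rewrite [LHS]ev_chow_X chow_zero_y.
Qed.

Lemma vars_in_iter_dderiv (P : YU * nat -> Prop) k (q : PYU) :
  (forall v, P v -> P (dshift v)) -> vars_in P q -> vars_in P (iter k (dderiv delta) q).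
Proof.
move=> h hq; elim: k => [|k IH]; first exact: hq.
rewrite iterS; apply: (vars_in_dderiv _ IH) => v Pv; split; [exact: Pv | exact: h].
Qed.

Definition linear_part (i : 'I_d.+1) : PYU :=
  \sum_(j < n) dvar (inr (i, lift ord0 j) : YU) 0 * dvar (inl j) 0.

Lemma linear_part_vars (P : YU * nat -> Prop) i :
  (forall j : 'I_n, P (inr (i, lift ord0 j), 0%N)) -> (forall j : 'I_n, P (inl j, 0%N)) ->
  vars_in P (linear_part i).
Proof.
move=> hu hy; apply: monomials_in_sum => j _; apply: vars_inM; exact: vars_inX.
Qed.

Lemma solve_vars q : vars_in no_constant_u (solve q).
Proof.
apply: ev_closed.
- exact: monomials_in0.
- rewrite -mpolyC1E; exact: vars_inC.
- move=> a b; exact: monomials_inD.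
- move=> a b; exact: vars_inM.
- move=> c; exact: vars_inC.
move=> m _ [[j|[i o]] k] _; first exact: vars_inX.
rewrite /solve_u /=; case: unliftP => [j ->|_]; first exact: vars_inX.
apply: vars_in_iter_dderiv => [[[]]//|].
apply: monomials_inN; apply: linear_part_vars => j //.
Qed.

Lemma iter_dderivD k (p q : PYU) :
  iter k (dderiv delta) (p + q) = iter k (dderiv delta) p + iter k (dderiv delta) q.
Proof.
elim: k => [|k IH]; first reflexivity.
rewrite !iterS IH; exact: dderivD.
Qed.

Lemma iter_dderivN k (p : PYU) : iter k (dderiv delta) (- p) = - iter k (dderiv delta) p.
Proof.
apply: (@addIr _ (iter k (dderiv delta) p)); rewrite -iter_dderivD !addNr.
elim: k => [|k IH]; first reflexivity.
rewrite iterS IH; exact: dderiv0.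
Qed.

Lemma hyperplane_split i : @generic_hyperplane F n d i = << ucm (inr (i, ord0), 0%N) >> + linear_part i.
Proof. by []. Qed.

Lemma iter_hyperplane i k : iter k (dderiv delta) (@generic_hyperplane F n d i) =
  << ucm (inr (i, ord0), k) >> + iter k (dderiv delta) (linear_part i).
Proof. by rewrite hyperplane_split iter_dderivD (iter_dderivX dd). Qed.

Section Kernel.
Context (Jd : PYU -> Prop).
Hypotheses (hJ : differential_ideal (dderiv delta) Jd) (hg : forall q, chow_generator q -> Jd q).

Lemma solve_congruent q : Jd (q - solve q).
Proof.
case: (hJ) => j0 jD jM jd.
move: q; apply: dpoly_ind => [c|v|p q hp hq|p q hp hq].
- have -> : solve c%:MP = c%:MP by exact: fevC.
  by rewrite subrr.
- have -> : solve << ucm v >> = solve_u v by exact: fevX.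
  case: v => [[j|[i o]] k]; first by rewrite subrr.
  rewrite /solve_u /=; case: unliftP => [j _|->]; first by rewrite subrr.
  rewrite -/(linear_part i) iter_dderivN opprK -iter_hyperplane.
  elim: k => [|k IH]; last exact: jd.
  by apply: hg; right; exists i.
- exact: (eq_ind_r Jd (jD _ _ hp hq) (rmorph_differenceD solve p q)).
- exact: (eq_ind_r Jd (jD _ _ (jM q _ hp) (jM (solve p) _ hq)) (rmorph_differenceM solve p q)).
Qed.

(** After the elimination of the [u_i0] the coefficients with respect to [u]
    vanish at [eta], hence belong to [I]. *)
Lemma kernel_ev_chow q : ev_chow q = 0 -> Jd q.
Proof.
move=> q0; case: (hJ) => j0 jD jM jd.
rewrite -[q](subrK (solve q)); apply: (jD); first exact: solve_congruent.
rewrite -[solve q]split_yuK; apply: merge_in_ideal => //.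
apply: eval_coef_eq0; rewrite -ev_chow_split; last exact: solve_vars.
by rewrite ev_chow_solve.
Qed.

End Kernel.

Lemma vanishes_chow_ideal f :
  ev iotaS (fun v => chow_zero (inr v.1, v.2)) f = 0 -> chow_ideal delta I f.
Proof. by rewrite -ev_chow_inr => h Jd hJ hg; apply: kernel_ev_chow. Qed.

(** The letters [u] other than the [u_i0] are independent over [K], so that a
    relation has its coefficients in [I]; they only involve derivatives satisfying
    [P], among which [I] contains no relation. *)
Lemma independent_at_chow_zero (P : 'I_n * nat -> Prop) q :
  (forall c, I c -> vars_in P c -> c = 0) ->
  vars_in (fun v => match v.1 with inl j => P (j, v.2) | inr c => c.2 != ord0 end) q ->
  ev_chow q = 0 -> q = 0.
Proof.
move=> hP vq q0; have vq' : vars_in no_constant_u q.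
  by apply: vars_inW vq => -[[j|c] k].
have s0 := q0; rewrite (ev_chow_split vq') in s0.
rewrite -(split_yuK q) (_ : split_yu q = 0) ?rmorph0 //.
apply/malgP => m; rewrite mcoeff0; apply: hP; first exact: (eval_coef_eq0 s0).
move: m; rewrite /split_yu; apply: (@ev_closed _ _ _ _ _
  (fun r : mpol (C * nat)%type B => forall m, vars_in P r@_m)).
- by move=> m; rewrite mcoeff0; exact: monomials_in0.
- move=> m; rewrite mcoeff1 -mpolyC_nat; exact: vars_inC.
- move=> a b ha hb m; rewrite mcoeffD; apply: monomials_inD; [exact: ha | exact: hb].
- move=> a b ha hb m; rewrite mcoeffMl; apply: monomials_in_sum => m1 _.
  apply: monomials_in_sum => m2 _; case: eqP => _; last by rewrite mulr0n; exact: monomials_in0.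
  rewrite mulr1n; apply: vars_inM; [exact: ha | exact: hb].
- move=> c m; rewrite /= mcoeffC; case: eqP => _; last by rewrite mulr0n; exact: monomials_in0.
  by rewrite mulr1n; exact: vars_inC.
- move=> m qm [[j|c] k] vm m' /=; have := vq m qm _ vm.
    rewrite /= mcoeffC => Pj; case: eqP => _; last by rewrite mulr0n; exact: monomials_in0.
    by rewrite mulr1n; exact: vars_inX.
  move=> _; rewrite mcoeffU1 -mpolyC_nat; exact: vars_inC.
Qed.

End GenericZero.

(** * Relations between linear forms at a zero of a triangular system *)

(** The first condition lets the leading variables be eliminated one after the other;
    the last one makes the value of each of them algebraic over the values of the other
    variables. *)
Definition triangular_at (V : choiceType) (K : fieldType) (S : idomainType)
    (iota : {rmorphism K -> S}) (x : V -> S) (fs : seq (V * mpol V K)) : Prop :=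
  (forall a0 i j, (j < i)%N -> (i < size fs)%N -> (nth a0 fs i).1 != (nth a0 fs j).1 /\
     vars_in (fun w => w != (nth a0 fs j).1) (nth a0 fs i).2) /\
  (forall a, a \in fs -> ev iota x a.2 = 0 /\
     ev (polyC \o iota : {rmorphism K -> {poly S}}) (free_at x a.1) a.2 != 0).

(** Bezout's inequality for a point of a variety of dimension at most [s] cut out by
    triangular equations. *)
Lemma bezout_elimination (V : choiceType) (K : fieldType) (S : idomainType)
    (iota : {rmorphism K -> S}) (x : V -> S) (xs : seq V) (G : nat -> mpol V K) (s : nat)
    (fs : seq (V * mpol V K)) (dg : V * mpol V K -> nat) (a0 : V * mpol V K) :
  uniq xs -> (size xs <= s + size fs)%N ->
  (forall i, (i <= s)%N -> vars_in (fun v => v \in xs) (G i) /\ deg_le 1 (G i)) ->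
  (forall a, a \in fs -> [/\ vars_in (fun v => v \in xs) a.2, (0 < dg a)%N & deg_le (dg a) a.2]) ->
  triangular_at iota x fs ->
  exists Q : itp K s.+1,
    [/\ Q != 0, (size (Q : {poly itp K s}) <= (\prod_(a <- fs) dg a).+1)%N &
        itev iota (fun k => ev iota x (G k)) s.+1 Q = 0].
Proof.
move=> uxs sxs hG hf [tri fx].
pose Gf := join_values s G (fun k => (nth a0 fs k).2).
have inG i : (i < size fs + s.+1)%N -> (i <= s)%N \/
    exists2 k, i = (k + s.+1)%N & (k < size fs)%N.
  move=> h; have [le|lt] := leqP i s; [by left|right].
  by exists (i - s.+1)%N; [rewrite subnK | lia].
have Gs i : (i <= s)%N -> Gf i = G i by rewrite /Gf /join_values => ->.
have Gk k : Gf (k + s.+1)%N = (nth a0 fs k).2.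
  by rewrite /Gf /join_values addnS ltnNge leq_addl /= -addnS addnK.
have hd : (\prod_(i < size fs) dg (nth a0 fs i) = \prod_(a <- fs) dg a)%N.
  by rewrite (big_nth a0) big_mkord.
have [|i le|k lk|P [P0 sP eP]] := @perron V K xs s (size fs) Gf (fun k => dg (nth a0 fs k)) uxs sxs.
- move=> i /inG [le|[k -> lk]]; first by rewrite Gs //; case: (hG i le).
  by rewrite Gk; case: (hf _ (mem_nth a0 lk)).
- by rewrite Gs //; case: (hG i le).
- by rewrite Gk; case: (hf _ (mem_nth a0 lk)).
rewrite hd in sP.
apply: (triangular_specialization (f := fun k => (nth a0 fs k).2) (v := fun k => (nth a0 fs k).1) P0 sP).
- by move=> i j li ji; apply: tri.
- by move=> i li; apply: fx; apply: mem_nth.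
move=> S' j y _ _; have := congr1 (ev (j \o iota : {rmorphism K -> S'}) y) eP.
rewrite rmorph0 => h; rewrite -[RHS]h.
rewrite (itev_comp (iota' := (j \o iota : {rmorphism K -> S'}))) => [|c]; last exact/esym/evC.
apply: eq_itev => i _; rewrite /= /Gf /join_values; case: ifP => _; reflexivity.
Qed.

(** If they were coprime, a Bezout relation would give a nonzero polynomial in the
    first [m] variables that vanishes at [x]. *)
Lemma common_zero_divides (K : fieldType) (S : idomainType) (iota : {rmorphism K -> S}) m
    (x : nat -> S) (p q : {poly itp K m}) :
  indep iota m x -> irreducible p ->
  itev iota x m.+1 p = 0 -> itev iota x m.+1 q = 0 -> divides p q.
Proof.
move=> ix irp px qx; have p0 : p != 0 by case: irp => /eqP.
have sp : (1 < size p)%N.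
  rewrite ltnNge; apply/negP => s1; move: px p0; rewrite (size1_polyC s1) itevS.
  by rewrite map_polyC hornerC => /ix ->; rewrite polyC0 eqxx.
apply: (irreducible_divides_noncoprime (itp_factorial K m) irp sp).
apply/negP => /Bezout_coprimepP [[u v] /=].
rewrite -size_poly_eq1 => /size_poly1P [c c0 e].
have := congr1 (fun r => itev iota x m.+1 r) e.
rewrite [in RHS]itevS map_polyC hornerC rmorphD !rmorphM px qx !mulr0 addr0.
by move/esym/ix => c0'; rewrite c0' eqxx in c0.
Qed.

Definition indep_seq (K : fieldType) (S : comNzRingType) (iota : {rmorphism K -> S}) (s : seq S) :=
  indep iota (size s) (nth 0 s).

(** Steinitz's lemma: elements of [Z] are added as long as [exchange] allows. *)
Lemma extend_independent (V : choiceType) (K : fieldType) (S : idomainType)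
    (iota : {rmorphism K -> S}) (x : V -> S) (X : seq S) (Z : seq V) :
  indep_seq iota X -> indep_seq iota [seq x z | z <- Z] ->
  exists zs : seq V, [/\ {subset zs <= Z}, indep_seq iota (X ++ [seq x z | z <- zs]) &
    (size Z <= size X + size zs)%N].
Proof.
move=> iX iZ; suff gen k : exists zs : seq V, [/\ {subset zs <= Z},
    indep_seq iota (X ++ [seq x z | z <- zs]) & (minn k (size Z) <= size X + size zs)%N].
  by have [zs [h1 h2]] := gen (size Z); rewrite minnn => h3; exists zs.
elim: k => [|k [zs [sub ind sz]]]; first by exists [::]; rewrite cats0 min0n.
have [le|lt] := leqP (minn k.+1 (size Z)) (size X + size zs); first by exists zs.
have lz : (size (X ++ [seq x z | z <- zs]) < size [seq x z | z <- Z])%N.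
  by rewrite size_cat !size_map; apply: leq_trans lt _; rewrite geq_minr.
have [i iZ' ind'] := exchange ind iZ lz; rewrite size_map in iZ'.
have [z0 zZ ez] : exists2 z0, z0 \in Z & nth 0 [seq x z | z <- Z] i = x z0.
  case: Z {sub iZ sz lt lz ind'} iZ' => // z1 Z' h; exists (nth z1 (z1 :: Z') i).
    exact: mem_nth.
  by rewrite (nth_map z1).
exists (rcons zs z0); split.
- by move=> z; rewrite mem_rcons inE => /orP[/eqP ->|/sub].
- rewrite map_rcons -rcons_cat /indep_seq size_rcons => p h.
  by apply: ind'; rewrite -[RHS]h; apply: eq_itev => k' lk; rewrite nth_rcons ez;
    move: lk; rewrite ltnS; case: ltngtP.
- rewrite size_rcons; move: sz lt; lia.
Qed.

Lemma indep_polyX (K : fieldType) (S : idomainType) (iota : {rmorphism K -> S}) (X : seq S) :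
  indep_seq iota X ->
  indep_seq (polyC \o iota : {rmorphism K -> {poly S}}) (rcons [seq s%:P | s <- X] 'X).
Proof.
move=> iX; rewrite /indep_seq size_rcons size_map => p.
rewrite itevS nth_rcons size_map ltnn eqxx => h.
have e : map_poly (itev iota (nth 0 X) (size X)) p = 0.
  rewrite -[RHS]h -[LHS]comp_polyXr /comp_poly -map_poly_comp; congr (horner _ _).
  apply: eq_map_poly => c /=.
  rewrite (@itev_comp _ _ _ iota (@polyC S) (polyC \o iota : {rmorphism K -> {poly S}})) //.
  apply: eq_itev => i li; rewrite nth_rcons size_map li (nth_map 0) //.
apply/polyP => i; rewrite coef0; apply: iX.
by rewrite -coef_map e coef0.
Qed.

Lemma itp_nonvanishing (K : fieldType) n (p : itp K n) : [pchar K] =i pred0 -> p != 0 ->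
  exists l : nat -> K, itev idfun l n p != 0.
Proof.
move=> ch; elim: n p => [|n IH] p p0; first by exists (fun=> 0).
have [l hl] := IH (lead_coef (p : {poly itp K n})) (etrans (congr1 negb (lead_coef_eq0 _)) p0).
pose q := map_poly (itev idfun l n) (p : {poly itp K n}).
have q0 : q != 0.
  apply/eqP => h; have := congr1 (fun r : {poly K} => r`_(size (p : {poly itp K n})).-1) h.
  by rewrite coef0 coef_map => /eqP; rewrite -lead_coefE (negPf hl).
have [t qt] : exists t, ~~ root q t.
  apply: NNPP => nt; pose rs := [seq i%:R : K | i <- iota 0 (size q)].
  have : (size rs < size q)%N.
    apply: max_poly_roots => //.
      by apply/allP => t _; apply/negPn/negP => h; apply: nt; exists t.
    rewrite map_inj_uniq ?iota_uniq // => i j.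
    wlog le : i j / (i <= j)%N => [wl|].
      by move=> e; case/orP: (leq_total i j) => le; [apply: wl | apply/esym/wl].
    move/eqP; rewrite eq_sym -subr_eq0 -natrB // => /eqP e; apply/eqP; rewrite eqn_leq le /=.
    by rewrite -subn_eq0; move/pcharf0P: ch => <-; apply/eqP.
  by rewrite size_map size_iota ltnn.
exists (fun i => if i == n then t else l i); rewrite itevS eqxx.
rewrite (_ : map_poly _ _ = q) //; apply: eq_map_poly => c.
by apply: eq_itev => i /ltn_eqF ->.
Qed.

Lemma malg_nonvanishing (V : choiceType) (K : fieldType) (p : mpol V K) :
  [pchar K] =i pred0 -> p != 0 -> exists l : V -> K, ev idfun l p != 0.
Proof.
move=> ch p0; pose xs : seq V := enum_fset (mvars p).
have ux : uniq xs by apply: fset_uniq.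
have ep := malg_itK (n := size xs) erefl (@vars_in_mvars _ _ p : vars_in (fun v => v \in xs) p).
have [|l hl] := itp_nonvanishing (p := malg_it K xs (size xs) p) ch.
  by apply: contraNneq p0 => h; rewrite -ep h rmorph0.
exists (fun v => l (index v xs)); apply: contraNneq hl => h; apply/eqP.
rewrite -[RHS]h -[in RHS]ep.
rewrite (ev_it_malg (n := size xs) erefl); apply: eq_itev => i li.
have v0 : V by case: (xs) li => [//|v ? _]; exact: v.
by rewrite (nth_map v0) // index_uniq.
Qed.

Definition tdeg (V : choiceType) (R : nzRingType) (p : mpol V R) := (\max_(m <- msupp p) mdeg m)%N.

Definition top_part (V : choiceType) (K : fieldType) (D : nat) (p : mpol V K) : mpol V K :=
  [malg m in msupp p => if mdeg m == D then p@_m else 0].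

Lemma deg_le_tdeg (V : choiceType) (R : comNzRingType) (p : mpol V R) : deg_le (tdeg p) p.
Proof. by move=> m; rewrite mcoeff_neq0 => mp; apply: (leq_bigmax_seq _ mp). Qed.

Lemma top_part_neq0 (V : choiceType) (K : fieldType) (p : mpol V K) :
  p != 0 -> top_part (tdeg p) p != 0.
Proof.
move=> p0; have [m mp em] : exists2 m, m \in msupp p & tdeg p = mdeg m.
  have ne : msupp p != fset0 by rewrite msupp_eq0.
  have [m0 m0p] := fset0Pn _ ne.
  apply: NNPP => nex.
  have : (tdeg p <= (tdeg p).-1)%N.
    apply/bigmax_leqP_seq => m mp _.
    have le : (mdeg m <= tdeg p)%N by apply: (leq_bigmax_seq _ mp).
    have ne' : mdeg m != tdeg p by apply/eqP => e; apply: nex; exists m.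
    by lia.
  have t0 : (0 < tdeg p)%N.
    rewrite lt0n; apply/eqP => t0; apply: nex; exists m0 => //; rewrite t0.
    by apply/esym/eqP; rewrite -leqn0 -[X in (_ <= X)%N]t0; apply: (leq_bigmax_seq _ m0p).
  by lia.
apply/eqP => /(congr1 (mcoeff m)); rewrite mcoeff0 mcoeffE mp em eqxx.
by move: mp; rewrite -mcoeff_neq0 => /eqP.
Qed.

Lemma coef_size_mul (R : comNzRingType) (p q : {poly R}) k l :
  (size p <= k.+1)%N -> (size q <= l.+1)%N ->
  (size (p * q)%R <= (k + l).+1)%N /\ (p * q)`_(k + l) = p`_k * q`_l.
Proof.
move=> sp sq; split.
  apply: leq_trans (size_polyMleq _ _) _; rewrite -subn1 leq_subLR.
  by apply: leq_trans (leq_add sp sq) _; rewrite addSn addnS.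
have hk : (k < (k + l).+1)%N by rewrite ltnS leq_addr.
rewrite coefM (bigD1 (Ordinal hk)) //= addKn big1 ?addr0 // => j jk.
have {}jk : (j : nat) != k by apply: contra_neq jk => e; apply: val_inj.
have [lt|ge] := ltnP j k; last first.
  by rewrite nth_default ?mul0r // (leq_trans sp) // ltn_neqAle eq_sym jk.
by rewrite [q`_ _]nth_default ?mulr0 // (leq_trans sq) //; have := ltn_ord j; lia.
Qed.

(** On the line through [t] with direction [l], the highest coefficient of a polynomial
    of degree at most [D] is the value at [l] of its form of degree [D]. *)
Lemma coef_top_part (V : choiceType) (K : fieldType) (S : comNzRingType)
    (iota : {rmorphism K -> S}) (t l : V -> S) (p : mpol V K) D : deg_le D p ->
  (ev (polyC \o iota : {rmorphism K -> {poly S}}) (fun v => (t v)%:P + (l v)%:P * 'X) p)`_D =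
  ev iota l (top_part D p).
Proof.
move=> hp; set y := fun v => _.
have hm (m : {cmonom V}) : (size (mev y m) <= (mdeg m).+1)%N /\ (mev y m)`_(mdeg m) = mev l m.
  rewrite /mev mdegE; elim: (enum_fset (finsupp m)) => [|v r [s1 c1]].
    by rewrite !big_nil size_poly1 coef1 eqxx.
  have [s2 c2] : (size (y v ^+ m v) <= (m v).+1)%N /\ (y v ^+ m v)`_(m v) = l v ^+ m v.
    elim: (m v) => [|k [s2 c2]]; first by rewrite !expr0 size_poly1 coef1 eqxx.
    have sy : (size (y v) <= 2)%N.
      rewrite /y addrC (leq_trans (size_polyD _ _)) // geq_max.
      rewrite (leq_trans (size_polyC_leq1 _)) // andbT.
      rewrite mul_polyC (leq_trans (size_scale_leq _ _)) // size_polyX //.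
    have cy : (y v)`_1 = l v by rewrite /y coefD coefC /= add0r coefCM coefX eqxx mulr1.
    have [s3 c3] := coef_size_mul sy s2; rewrite add1n in s3 c3.
    by rewrite !exprS; split=> //; rewrite c3 cy c2.
  rewrite !big_cons; have [s3 c3] := coef_size_mul s2 s1.
  by split=> //; rewrite c3 c2 c1.
have sub : (msupp (top_part D p) `<=` msupp p)%fset.
  by apply/fsubsetP => m; rewrite -mcoeff_neq0 mcoeffE; case: ifP; rewrite ?eqxx.
rewrite evE coef_sum [RHS](mmapEw sub) big_seq [RHS]big_seq.
apply: eq_bigr => m mp; rewrite coefCM; have [s1 c1] := hm m.
rewrite mcoeffE mp; case: eqP => [e|ne]; first by rewrite -e c1.
have i0 : iota 0 = 0 by exact: rmorph0.
rewrite [X in _ = X * _]i0 mul0r.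
rewrite nth_default ?mulr0 //; apply: leq_trans s1 _.
have : (mdeg m <= D)%N by apply: hp; rewrite mcoeff_neq0.
by rewrite leq_eqVlt => /orP[/eqP|].
Qed.

(** * The degree of a projection *)

Lemma irreducible_transport (R A : idomainType) (phi : {rmorphism R -> A}) (psi : {rmorphism A -> R})
   (p : R) : cancel phi psi -> irreducible (phi p) -> irreducible p.
Proof.
move=> K [p0 ni ir]; split.
- by move=> e; apply: p0; rewrite e rmorph0.
- by case=> b pb; apply: ni; exists (phi b); rewrite -rmorphM pb rmorph1.
have inv b : invertible (phi b) -> invertible b.
  by case=> c e; exists (psi c); rewrite -(K b) -rmorphM e rmorph1.
by move=> b c e; case: (ir (phi b) (phi c)); [rewrite e rmorphM | left; apply: inv | right; apply: inv].
Qed.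

Lemma itev_closed (K : fieldType) (S : comNzRingType) (iota : {rmorphism K -> S})
    (P : S -> Prop) (x : nat -> S) n (p : itp K n) :
  P 0 -> (forall a b, P a -> P b -> P (a + b)) -> (forall a b, P a -> P b -> P (a * b)) ->
  (forall c, P (iota c)) -> (forall i, (i < n)%N -> P (x i)) -> P (itev iota x n p).
Proof.
move=> h0 hD hM hC; elim: n p => [|n IH] p hx; first exact: hC.
have {}IH c : P (itev iota x n c) by apply: IH => i li; apply/hx/ltnW.
rewrite itevS; elim/poly_ind: (p : {poly itp K n}) => [|q c hq]; first by rewrite rmorph0 horner0.
rewrite rmorphD rmorphM /= map_polyX map_polyC hornerD hornerMX hornerC.
exact: (hD _ _ (hM _ _ hq (hx n (ltnSn n))) (IH c)).
Qed.

Lemma size_factor (R : idomainType) (a b c : {poly R}) : c = a * b -> c != 0 ->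
  a != 0 /\ (size a <= size c)%N.
Proof.
move=> -> ; rewrite mulf_eq0 negb_or => /andP[a0 b0]; split=> //.
by rewrite size_mul //; move: b0; rewrite -size_poly_gt0; case: (size b) => // k _; rewrite addnS leq_addr.
Qed.

Lemma rmorph_line (A S : comNzRingType) (g : {rmorphism A -> S}) (a c t : A) :
  g (a - c * t) = g a - g c * g t.
Proof. by rewrite rmorphB rmorphM. Qed.

Lemma ev_line (V : choiceType) (K : fieldType) (S : comNzRingType) (iota : {rmorphism K -> S})
    (y : V -> S) (a b : V) (c : K) :
  ev iota y (<< ucm a >> - c%:MP * << ucm b >>) = y a - iota c * y b.
Proof.
have -> : y a = ev iota y << ucm a >> by exact/esym/fevX.
have -> : y b = ev iota y << ucm b >> by exact/esym/fevX.
have -> : iota c = ev iota y c%:MP by exact/esym/fevC.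
exact: (rmorph_line (ev iota y)).
Qed.

Lemma ev_line_add (V : choiceType) (K : fieldType) (S : comNzRingType) (iota : {rmorphism K -> S})
    (y : V -> S) (a b : V) (c : K) :
  ev iota y (<< ucm a >> + c%:MP * << ucm b >>) = y a + iota c * y b.
Proof.
have -> : y a = ev iota y << ucm a >> by exact/esym/fevX.
have -> : y b = ev iota y << ucm b >> by exact/esym/fevX.
have -> : iota c = ev iota y c%:MP by exact/esym/fevC.
apply: etrans (rmorphD (ev iota y) _ _) _; congr (_ + _); exact: rmorphM.
Qed.

Section ProjectionDegree.
Variables (V U : choiceType) (F : fieldType) (S : idomainType) (iota : {rmorphism F -> S}).
Variables (x : V -> S) (emb : U -> V) (xs : seq V) (tau : V) (fs : seq (V * mpol V F)).
Variables (dg : V * mpol V F -> nat) (f : mpol U F) (fresh : nat -> U) (u0 : U) (Z : seq V).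
Hypotheses (ch0 : [pchar F] =i pred0) (uxs : uniq xs) (tauP : tau \notin xs).
Hypothesis fsP : forall a, a \in fs ->
  [/\ vars_in (fun v => v \in xs) a.2, (0 < dg a)%N & deg_le (dg a) a.2].
Hypothesis tri : triangular_at iota x fs.
Hypotheses (sZ : {subset Z <= xs}) (cZ : (size xs <= size Z + size fs)%N)
  (iZ : indep_seq iota [seq x z | z <- Z]).
Hypotheses (irf : irreducible f) (embP : forall u, u \in mvars f -> emb u \in xs)
  (fx : ev iota (x \o emb) f = 0).
Let ws : seq U := enum_fset (mvars f `\ u0)%fset.
Hypotheses (u0f : u0 \in mvars f) (iws : indep_seq iota [seq x (emb u) | u <- ws]).
Hypotheses (freshI : injective fresh) (freshP : forall k, fresh k \notin mvars f).

Let iotaX : {rmorphism F -> {poly S}} := polyC \o iota.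
Let xX (v : V) : {poly S} := if v == tau then 'X else (x v)%:P.

Lemma ev_xX p : vars_in (fun v => v \in xs) p -> ev iotaX xX p = (ev iota x p)%:P.
Proof.
move=> vp; rewrite (@rmorph_ev _ _ _ iota _ (@polyC S) iotaX) //.
apply: eq_ev => m pm v mv; rewrite /xX; case: eqP => // e.
by move: (vp m pm v mv); rewrite e (negPf tauP).
Qed.

Lemma triangular_xX : triangular_at iotaX xX fs.
Proof.
case: tri => t1 t2; split=> // a afs; have [vs _ _] := fsP afs; have [h1 h2] := t2 a afs.
split; first by rewrite ev_xX // h1 polyC0.
pose j : {rmorphism {poly S} -> {poly {poly S}}} := map_poly (@polyC S).
have e : ev (polyC \o iotaX : {rmorphism F -> {poly {poly S}}}) (free_at xX a.1) a.2 =
    j (ev (polyC \o iota : {rmorphism F -> {poly S}}) (free_at x a.1) a.2).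
  rewrite (@rmorph_ev _ _ _ _ _ j (polyC \o iotaX : {rmorphism F -> {poly {poly S}}})).
    apply: eq_ev => m pm v mv; rewrite /= /free_at /j /=; case: eqP => [_|_].
      by rewrite map_polyX.
    rewrite map_polyC /= /xX; case: eqP => // e.
    by move: (vs m pm v mv); rewrite e (negPf tauP).
  by move=> c; rewrite /= /j map_polyC.
by rewrite e /j /= map_polyC_eq0.
Qed.

(** The equations [fs] have a generic zero [x] with the independent variables [Z],
    and [f] is the irreducible relation between the coordinates [emb u]; the bound
    is that of the degree of the projection. The variable [tau] is new, and takes an
    indeterminate value in [xX]. The letters [fresh k] are used to write the relation
    obtained from [bezout_elimination] as a polynomial in the same variables as [f],
    to which it is then compared. *)
Theorem projection_degree : (tdeg f <= \prod_(a <- fs) dg a)%N.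
Proof.
have f0 : f != 0 by case: irf => /eqP.
have [zs [szs izs csz]] := extend_independent iws iZ; rewrite size_map in csz.
(* A direction in which no degree is lost. *)
have [l hl] := malg_nonvanishing ch0 (top_part_neq0 f0).
pose wv := u0 :: ws.
have u0ws : u0 \notin ws by rewrite in_fsetD1 eqxx.
have uwv : uniq wv by rewrite /= u0ws fset_uniq.
have wvf u : (u \in wv) = (u \in mvars f).
  by rewrite inE in_fsetD1; case: eqP => [->|] //=; rewrite u0f.
(* The linear forms of the relation; the last one is [tau]. *)
pose gl := [seq << ucm (emb w) >> - (l w)%:MP * << ucm tau >> | w <- wv] ++
           [seq << ucm z >> | z <- zs] ++ [:: << ucm tau >>] : seq (mpol V F).
pose s := (size wv + size zs)%N.
have sgl : size gl = s.+1 by rewrite /gl !size_cat !size_map /= addn1 addnS.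
have glP g : g \in gl -> vars_in (fun v => v \in tau :: xs) g /\ deg_le 1 g.
  rewrite !mem_cat => /or3P[/mapP [w ww ->]|/mapP [z zz ->]|].
  - split; apply: monomials_inD.
    + by apply: vars_inX; rewrite inE embP ?orbT // -wvf.
    + apply: monomials_inN; apply: vars_inM; first exact: vars_inC.
      by apply: vars_inX; rewrite mem_head.
    + exact: deg_leX.
    + apply: monomials_inN; rewrite -[1%N]add0n; apply: deg_leM; [exact: deg_leC | exact: deg_leX].
  - by split; [apply: vars_inX; rewrite inE sZ ?orbT // szs | exact: deg_leX].
  - by rewrite inE => /eqP ->; split; [apply: vars_inX; rewrite mem_head | exact: deg_leX].
have [||i le|a afs|Q [Q0 sQ eQ]] := @bezout_elimination V F _ iotaX xX (tau :: xs) (nth 0 gl) s fs dg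
    (tau, 0) _ _ _ _ triangular_xX.
- by rewrite /= tauP.
- rewrite /s /=; move: cZ csz; lia.
- by apply: glP; rewrite mem_nth // sgl ltnS.
- have [h1 h2 h3] := fsP afs; split=> //.
  by apply: vars_inW h1 => v vx; rewrite inE vx orbT.
pose tn := fresh 0.
have [zn [szn uzn tnzn znf]] : exists zn : seq U, [/\ size zn = size zs, uniq zn, tn \notin zn &
    forall u, u \in mvars f -> u \notin zn].
  exists [seq fresh k.+1 | k <- seq.iota 0 (size zs)]; split.
  - by rewrite size_map size_iota.
  - by rewrite map_inj_uniq ?iota_uniq // => i j /freshI [].
  - by apply/negP => /mapP [k _ /freshI].
  - by move=> u uf; apply/negP => /mapP [k _ e]; move: (freshP k.+1); rewrite -e uf.
have fw u : u \in mvars f -> u != tn /\ u \notin zn.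
  by move=> uf; split; [apply: contraTneq uf => ->; apply: freshP | apply: znf].
have wsf u : u \in ws -> u \in mvars f by rewrite in_fsetD1 => /andP[].
(* Two orders of the same variables: [u0] is outermost in the first one, where
   divisibility is proved, and [tn] in the second one, where degrees are compared. *)
pose Lb := ws ++ zn ++ [:: tn]; pose L1 := rcons Lb u0; pose L2 := wv ++ zn ++ [:: tn].
have uzt : uniq (zn ++ [:: tn]) by rewrite cats1 rcons_uniq tnzn.
have dis u : u \in mvars f -> u \notin zn ++ [:: tn].
  by move=> /fw [h1 h2]; rewrite mem_cat inE negb_or h1 h2.
have uL2 : uniq L2.
  rewrite cat_uniq uwv uzt andbT /=; apply/hasPn => u uz; apply/negP; rewrite wvf => /dis.
  by rewrite uz.
have pL : perm_eq L1 L2 by rewrite perm_rcons.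
have uL1 : uniq L1 by rewrite (perm_uniq pL).
have mL : L1 =i L2 := perm_mem pL.
have sL2 : size L2 = s.+1 by rewrite /L2 !size_cat szn /= addn1 addnS.
pose m := size Lb; have sL1 : size L1 = m.+1 by rewrite size_rcons.
(* The point corresponding to [xX]. *)
pose rho u : {poly S} := if u == tn then 'X else
  if u \in zn then (x (nth tau zs (index u zn)))%:P else (x (emb u))%:P.
have rhof u : u \in mvars f -> rho u = (x (emb u))%:P.
  by case/fw => h1 h2; rewrite /rho (negPf h1) (negPf h2).
have rhoz : [seq rho u | u <- zn] = [seq (x z)%:P | z <- zs].
  apply: (@eq_from_nth _ 0); rewrite !size_map // szn => i li.
  rewrite (nth_map tn) ?szn // (nth_map tau) // /rho index_uniq ?szn // mem_nth ?szn //.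
  by case: eqP => // e; move: tnzn; rewrite -e mem_nth ?szn.
have rhot : rho tn = 'X by rewrite /rho eqxx.
have rhoLb : [seq rho u | u <- Lb] = rcons [seq s%:P | s <- [seq x (emb u) | u <- ws] ++
    [seq x z | z <- zs]] 'X.
  rewrite /Lb !map_cat rhoz /= rhot -cats1 -!map_comp -catA; congr (_ ++ _).
  by apply/eq_in_map => u /wsf/rhof.
have irho : indep iotaX m (nth 0 [seq rho u | u <- L1]).
  have := indep_polyX izs; rewrite -rhoLb /indep_seq size_map -/m => h p hp; apply: h.
  by rewrite -[RHS]hp; apply: eq_itev => i li; rewrite map_rcons nth_rcons size_map li.
pose gU := [seq << ucm w >> - (l w)%:MP * << ucm tn >> | w <- wv] ++
           [seq << ucm z >> | z <- zn] ++ [:: << ucm tn >>] : seq (mpol U F).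
have sgU : size gU = s.+1 by rewrite /gU !size_cat !size_map szn /= addn1 addnS.
(* The relation as a polynomial in the variables of [f], [zn] and [tn]. *)
pose Qt := itev (malgCr U F) (nth 0 gU) s.+1 Q.
have gUP g : g \in gU -> vars_in (fun u => u \in L1) g.
  have L1X u : u \in L2 -> vars_in (fun u => u \in L1) (<< ucm u >> : mpol U F).
    by move=> uL; apply: vars_inX; rewrite mL.
  have L1t : vars_in (fun u => u \in L1) (<< ucm tn >> : mpol U F).
    by apply: L1X; rewrite !mem_cat mem_head !orbT.
  rewrite !mem_cat => /or3P[/mapP [w ww ->]|/mapP [z zz ->]|].
  - apply: monomials_inD; first by apply: L1X; rewrite mem_cat ww.
    apply: monomials_inN; apply: vars_inM L1t; exact: vars_inC.
  - by apply: L1X; rewrite !mem_cat zz orbT.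
  - by rewrite inE => /eqP ->.
have vQt : vars_in (fun u => u \in L1) Qt.
  apply: itev_closed.
  - exact: monomials_in0.
  - move=> a b; exact: monomials_inD.
  - move=> a b; exact: vars_inM.
  - move=> c; exact: vars_inC.
  - by move=> i li; apply: gUP; rewrite mem_nth // sgU.
have vf : vars_in (fun u => u \in L1) f.
  by apply/vars_in_subset => u uf; rewrite mL mem_cat wvf uf.
have rhoQt : ev iotaX rho Qt = 0.
  rewrite /Qt (itev_comp (iota' := iotaX)) => [|c]; last exact/esym/evC.
  rewrite -[RHS]eQ; apply: eq_itev => i li.
  rewrite -[LHS]/(ev iotaX rho (nth 0 gU i)).
  have e : [seq ev iotaX rho g | g <- gU] = [seq ev iotaX xX g | g <- gl].
    have xt : xX tau = 'X by rewrite /xX eqxx.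
    have et : ev iotaX rho << ucm tn >> = ev iotaX xX << ucm tau >>.
      by rewrite !fevX rhot xt.
    rewrite /gU /gl !map_cat -!map_comp; congr (_ ++ (_ ++ _)).
    + apply/eq_in_map => w ww /=; rewrite wvf in ww.
      rewrite ev_line [RHS]ev_line rhot xt rhof // /xX.
      by case: eqP => // e; move: (embP ww); rewrite e (negPf tauP).
    + transitivity [seq rho u | u <- zn]; first by apply: eq_map => u; apply: fevX.
      rewrite rhoz; apply/eq_in_map => z zz /=; rewrite [RHS]fevX /xX.
      by case: eqP => // e; move: (sZ (szs z zz)); rewrite e (negPf tauP).
    + by apply: (congr1 (cons^~ [::])); exact: et.
  have : nth 0 [seq ev iotaX rho g | g <- gU] i = nth 0 [seq ev iotaX xX g | g <- gl] i.
    by rewrite e.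
  by rewrite (nth_map 0) ?sgU // (nth_map 0) ?sgl.
pose phi := it_malg F L1 m.+1; pose psi := malg_it F L1 m.+1.
have efT : phi (psi f) = f by exact: (malg_itK sL1 vf).
have eQT : phi (psi Qt) = Qt by exact: (malg_itK sL1 vQt).
have irfT : irreducible (psi f : {poly itp F m}).
  apply: (@irreducible_transport _ _ phi psi); first exact: (it_malgK uL1 sL1).
  by rewrite efT.
have [h eh] : divides (psi f : {poly itp F m}) (psi Qt : {poly itp F m}).
  apply: (common_zero_divides irho irfT).
  - rewrite -(ev_it_malg sL1 iotaX rho) -/phi efT -[RHS](polyC0 S) -fx.
    rewrite (@rmorph_ev _ _ _ iota _ (@polyC S) iotaX) //.
    by apply: eq_ev => k fk u ku; rewrite /= rhof //; apply/mvarsP; exists k.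
  - by rewrite -(ev_it_malg sL1 iotaX rho) -/phi eQT.
(* Undoes the substitution [w - l w * tn] of the linear forms. *)
pose shift : {rmorphism mpol U F -> mpol U F} :=
  ev (malgCr U F) (fun u => if u \in wv then << ucm u >> + (l u)%:MP * << ucm tn >> else << ucm u >>).
have eshift : shift Qt = it_malg F L2 s.+1 Q.
  rewrite /Qt /it_malg (itev_comp (iota' := malgCr U F)) => [|c]; last exact/esym/evC.
  apply: eq_itev => i li; rewrite -[LHS]/(shift (nth 0 gU i)).
  have e : [seq shift g | g <- gU] = [seq << ucm u >> | u <- L2].
    have zt u : u \in zn ++ [:: tn] -> shift << ucm u >> = << ucm u >>.
      move=> uz; rewrite /shift [LHS]fevX; case: ifP => //; rewrite wvf => /dis.
      by rewrite uz.
    have tt : tn \in zn ++ [:: tn] by rewrite mem_cat mem_head orbT.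
    rewrite /gU /L2 !map_cat -!map_comp; congr (_ ++ (_ ++ _)).
    + apply/eq_in_map => w ww.
      rewrite -[LHS]/(shift (_ - _)) /shift ev_line -/shift ww.
      have -> : (if tn \in wv then << ucm tn >> + (l tn)%:MP * << ucm tn >> else << ucm tn >>) =
          << ucm tn >> :> mpol U F.
        by case: ifP => //; rewrite wvf => /dis; rewrite tt.
      exact: addrK.
    + by apply/eq_in_map => u uz; apply: zt; rewrite mem_cat uz.
    + by apply: (congr1 (cons^~ [::])); apply: zt.
  by rewrite -e (nth_map 0) // sgU.
pose psi2 := malg_it F L2 s.+1.
have ePsi : Q = psi2 (shift f) * psi2 (shift (phi h)).
  rewrite -[LHS](it_malgK (K := F) uL2 sL2) -eshift -[in LHS]eQT eh.
  have e1 : phi (psi f * h) = phi (psi f) * phi h by exact: rmorphM.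
  have e2 : shift (phi (psi f) * phi h) = shift (phi (psi f)) * shift (phi h) by exact: rmorphM.
  rewrite [phi _]e1 e2 efT; exact: rmorphM.
have [g1 g2] := @size_factor (itp F s) _ _ _ ePsi Q0.
apply: leq_trans (_ : (size (psi2 (shift f) : {poly itp F s})).-1 <= _)%N; last first.
  by rewrite -ltnS prednK ?size_poly_gt0 //; apply: leq_trans g2 sQ.
have top : (psi2 (shift f) : {poly itp F s})`_(tdeg f) != 0.
  have -> : psi2 (shift f) = ev (polyC \o itC F s : {rmorphism F -> {poly itp F s}})
      (fun u => (itX F s (index u L2))%:P + (itC F s (l u))%:P * 'X) f.
    rewrite /shift (@rmorph_ev _ _ _ _ _ psi2 (itC F s.+1)) => [|c]; last exact/esym/evC.
    apply: eq_ev => k fk u ku; have uf : u \in mvars f by apply/mvarsP; exists k.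
    have uw : u \in wv by rewrite wvf.
    have iu : index u L2 = index u wv by rewrite /L2 index_cat uw.
    have it : index tn L2 = s.
      rewrite /L2 catA index_cat.
      have -> : tn \in wv ++ zn = false.
        by rewrite mem_cat (negPf tnzn) wvf orbF; apply/negbTE/freshP.
      by rewrite /= eqxx addn0 size_cat szn.
    have lu : (index u wv == s) = false.
      by apply: ltn_eqF; apply: leq_trans (_ : size wv <= s)%N; rewrite ?index_mem // leq_addr.
    rewrite -[LHS]/(psi2 (if u \in wv then _ else _)) uw /psi2 /malg_it ev_line_add.
    by rewrite it iu /= lu eqxx.
  rewrite coef_top_part; last exact: deg_le_tdeg.
  have -> : ev (itC F s) (fun v => itC F s (l v)) (top_part (tdeg f) f) =
      itC F s (ev idfun l (top_part (tdeg f) f)).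
    by rewrite (@rmorph_ev _ _ _ idfun _ (itC F s) (itC F s)).
  by rewrite fmorph_eq0.
rewrite -ltnS prednK; last by rewrite size_poly_gt0.
by rewrite ltnNge; apply: contra top => le; rewrite nth_default.
Qed.
End ProjectionDegree.

(** * The degree of the Chow form *)

Lemma pairwise_impl (T : eqType) (r1 r2 R : rel T) (s : seq T) :
  pairwise r1 s -> pairwise r2 s ->
  {in s &, forall a b, r1 a b -> r2 a b -> R a b} -> pairwise R s.
Proof.
elim: s => // a s IH /= /andP[a1 p1] /andP[a2 p2] h; apply/andP; split.
  by apply/allP => b bs; apply: h; rewrite ?mem_head ?inE ?bs ?orbT //; [apply: (allP a1) | apply: (allP a2)].
by apply: IH => // b c bs cs; apply: h; rewrite inE ?bs ?cs orbT.
Qed.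

(** Translates independence from iterated polynomials to monoid algebras. *)
Lemma indep_of_malg (V : choiceType) (F : fieldType) (S : comNzRingType) (iota : {rmorphism F -> S})
    (x : V -> S) (Z : seq V) : uniq Z ->
  (forall q : mpol V F, vars_in (fun v => v \in Z) q -> ev iota x q = 0 -> q = 0) ->
  indep_seq iota [seq x z | z <- Z].
Proof.
move=> uZ h; rewrite /indep_seq size_map => p hp.
rewrite -(it_malgK (K := F) uZ (erefl (size Z)) p) (h (it_malg F Z (size Z) p)) ?rmorph0 //.
  apply: itev_closed.
  - exact: monomials_in0.
  - move=> a b; exact: monomials_inD.
  - move=> a b; exact: vars_inM.
  - move=> c; exact: vars_inC.
  - move=> i li; have v0 : V by case: (Z) li => [//|v ? _]; exact: v.
    rewrite (nth_map v0) //; apply: vars_inX; exact: mem_nth.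
by rewrite (ev_it_malg (n := size Z) erefl).
Qed.

Section GradedRanking.
Variable J : countType.

(** For an orderly ranking the leader of the Chow form has the order of the form. *)
Definition graded_le (v w : J * nat) : bool :=
  (v.2 < w.2)%N || (v.2 == w.2) && (choice.pickle v.1 <= choice.pickle w.1)%N.

Lemma graded_ranking : ranking graded_le.
Proof.
rewrite /graded_le; split; last 2 first.
- by move=> j k /=; rewrite ltnSn xpair_eqE eqxx andTb neq_ltn ltnSn.
- by move=> i j k l /=; rewrite ltnS eqSS !xpair_eqE eqSS.
split.
- by move=> v; rewrite eqxx leqnn orbT.
- move=> [i k] [j l] /= /andP[/orP[h1|/andP[/eqP -> h1]] /orP[h2|/andP[/eqP e h2]]]; try lia.
  congr (_, _); apply: (pcan_inj (@choice.pickleK J)); apply/eqP; rewrite eqn_leq h1 h2 //.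
- move=> [j l] [i k] [a b] /= /orP[h1|/andP[/eqP e1 h1]] /orP[h2|/andP[/eqP e2 h2]].
  + by rewrite (ltn_trans h1 h2).
  + by rewrite -e2 h1.
  + by rewrite e1 h2.
  + by rewrite e1 e2 eqxx (leq_trans h1 h2) orbT.
- move=> [i k] [j l] /=; case: ltngtP => //= _.
  exact: leq_total.
Qed.

Lemma graded_order (v w : J * nat) : graded_le v w -> (v.2 <= w.2)%N.
Proof. by case/orP => [/ltnW|/andP[/eqP -> _]]. Qed.

End GradedRanking.

(** With [e t] the order of [A t] and [h] their sum, counts the equations
    [A_t^(k)] of order at most [h]. *)
Lemma sum_complements (N : nat) (e : 'I_N -> nat) : let h := (\sum_(t < N) e t)%N in
  (\sum_(t < N) (h - e t).+1 + h = N * h.+1)%N.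
Proof.
move=> h; rewrite {2}/h -big_split /= (eq_bigr (fun=> h.+1)); last first.
  by move=> t _; rewrite addSn subnK // /h (bigD1 t) //= leq_addr.
by rewrite sum_nat_const card_ord.
Qed.

Section ChowDegree.
Variables (F : fieldType) (delta : F -> F) (n d : nat).
Variables (I : mpol ('I_n * nat)%type F -> Prop) (le : rel ('I_n * nat)).
Variables (A : 'I_(n - d) -> mpol ('I_n * nat)%type F).
Hypotheses (ch0 : [pchar F] =i pred0) (dd : derivation delta).
Hypothesis prI : prime_differential_ideal (dderiv delta) I.
Hypotheses (rk : ranking le) (ordl : orderly le) (csA : characteristic_set le I A).
Variables (K : fieldType) (io : {rmorphism F -> K}) (D : K -> K) (eta : 'I_n -> K).
Hypotheses (ext : differential_extension delta io D) (gen : generic_point io D I eta).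
Variable ld : 'I_(n - d) -> 'I_n * nat.
Hypothesis ldP : forall t, is_leader le (A t) (ld t).

Local Notation C := (chow_index n d).
Local Notation YU := ('I_n + C)%type.
Local Notation V := ((YU * nat)%type : choiceType).
Local Notation U := ((C * nat)%type : choiceType).
Local Notation S := (mpol U K).

Let e t := (ld t).2.
Let h := (\sum_(t < n - d) e t)%N.
Let x : V -> S := chow_zero D eta.
Let iS : {rmorphism F -> S} := iotaS n d io.

Let allC : seq C := [seq (i, o) | i <- enum 'I_d.+1, o <- enum 'I_n.+1].
Let allYU : seq YU := [seq inl j | j <- enum 'I_n] ++ [seq inr c | c <- allC].
Let xs : seq V := [seq (a, k) | a <- allYU, k <- iota 0 h.+1].

Lemma mem_xs v : (v \in xs) = (v.2 <= h)%N.
Proof.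
apply/allpairsP/idP => [[[a k] [_ ki ->]]|vh].
  by move: ki; rewrite mem_iota.
exists (v.1, v.2); split; last by case: v vh.
  case: v vh => [[j|[i o]] k] _ /=; rewrite mem_cat; apply/orP; [left|right].
    by apply/mapP; exists j; rewrite // mem_enum.
  apply/mapP; exists (i, o) => //; apply/allpairsP; exists (i, o).
  by rewrite !mem_enum.
by rewrite mem_iota.
Qed.

Lemma size_allC : size allC = (d.+1 * n.+1)%N.
Proof. by rewrite size_allpairs !size_enum_ord. Qed.

Lemma size_xs : size xs = ((n + d.+1 * n.+1) * h.+1)%N.
Proof.
rewrite size_allpairs size_iota size_cat; congr ((_ + _) * _)%N.
  by rewrite size_map size_enum_ord.
by rewrite size_map size_allC.
Qed.

Lemma uniq_allC : uniq allC.
Proof. by apply: allpairs_uniq; rewrite ?enum_uniq // => -[a b] [a' b'] _ _ /= [-> ->]. Qed.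

Lemma uniq_xs : uniq xs.
Proof.
apply: allpairs_uniq; rewrite ?iota_uniq //; last by move=> -[a b] [a' b'] _ _ /= [-> ->].
rewrite cat_uniq; apply/and3P; split.
- by rewrite map_inj_uniq ?enum_uniq // => a b [].
- by apply/hasP => -[a /mapP [c _ ->]] /mapP [].
- by rewrite map_inj_uniq ?uniq_allC // => a b [].
Qed.

Definition lead (tk : 'I_(n - d) * nat) := dshiftn tk.2 (ld tk.1).

Let char_idx : seq ('I_(n - d) * nat) :=
  sort (fun a b => le (lead b) (lead a))
    [seq (t, k) | t <- enum 'I_(n - d), k <- seq.iota 0 (h - e t).+1].
Let hyper_idx : seq ('I_d.+1 * nat) := [seq (i, k) | i <- enum 'I_d.+1, k <- seq.iota 0 h.+1].

Let hyper_eq (ik : 'I_d.+1 * nat) : V * mpol V F :=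
  ((inr (ik.1, ord0) : YU, ik.2), iter ik.2 (dderiv delta) (@generic_hyperplane F n d ik.1)).
Let char_eq (tk : 'I_(n - d) * nat) : V * mpol V F :=
  ((inl (lead tk).1 : YU, (lead tk).2),
   drename delta (@inl 'I_n C) (iter tk.2 (dderiv delta) (A tk.1))).

Let fs := map hyper_eq hyper_idx ++ map char_eq char_idx.

Lemma e_le t : (e t <= h)%N.
Proof. by rewrite /h (bigD1 t) //= leq_addr. Qed.

Lemma mem_char_idx t k : ((t, k) \in char_idx) = (e t + k <= h)%N.
Proof.
rewrite mem_sort; apply/allpairsPdep/idP => [[t' [k' [_ hk [-> ->]]]]|hk].
  by move: hk; rewrite mem_iota; have := e_le t'; lia.
by exists t, k; rewrite mem_enum mem_iota; split=> //; lia.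
Qed.

Lemma mem_hyper_idx i k : ((i, k) \in hyper_idx) = (k <= h)%N.
Proof.
apply/allpairsP/idP => [[[i' k'] [_ hk [_ ->]]]|hk].
  by move: hk; rewrite mem_iota.
by exists (i, k); rewrite mem_enum mem_iota.
Qed.

Lemma uniq_hyper_idx : uniq hyper_idx.
Proof.
apply: allpairs_uniq; rewrite ?enum_uniq ?iota_uniq //.
by move=> -[a b] [a' b'] _ _ /= [-> ->].
Qed.

Lemma uniq_char_idx : uniq char_idx.
Proof.
rewrite sort_uniq; apply: allpairs_uniq_dep; rewrite ?enum_uniq //.
  by move=> t _; apply: iota_uniq.
by move=> -[a b] [a' b'] _ _ /= [-> ->].
Qed.

Lemma lead_inj : injective lead.
Proof.
move=> [t k] [t' k'] /= el; have et : t = t'.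
  apply/eqP/negPn/negP => /(leader_letters csA ldP); rewrite -[(ld t).1]/((lead (t, k)).1) el.
  by rewrite eqxx.
by rewrite -et in el *; case: el => /addnI ->.
Qed.

Lemma pair_ext (X Y : Type) (a b : X * Y) : a.1 = b.1 -> a.2 = b.2 -> a = b.
Proof. by case: a b => [? ?] [? ?] /= -> ->. Qed.

Lemma size_hyper_idx : size hyper_idx = (d.+1 * h.+1)%N.
Proof. by rewrite size_allpairs size_iota size_enum_ord. Qed.

Lemma size_char_idx : size char_idx = (\sum_(t < n - d) (h - e t).+1)%N.
Proof.
rewrite size_sort size_allpairs_dep sumnE big_map big_enum /=.
by apply: eq_bigr => t _; rewrite size_iota.
Qed.

Lemma sum_orders : (\sum_(t < n - d) (h - e t).+1 + h = (n - d) * h.+1)%N.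
Proof. exact: sum_complements. Qed.

Lemma size_fs : size fs = (d.+1 * h.+1 + \sum_(t < n - d) (h - e t).+1)%N.
Proof. by rewrite /fs size_cat (size_map hyper_eq) (size_map char_eq) size_hyper_idx size_char_idx. Qed.

(** The derivatives of [P_i] involve no [u_i'0] other than their leading variable. *)
Lemma linear_part_iter_vars i k :
  vars_in (fun v => no_constant_u v /\ (v.2 <= k)%N) (iter k (dderiv delta) (@linear_part F n d i)).
Proof.
elim: k => [|k IH]; first by apply: linear_part_vars.
rewrite iterS; apply: (vars_in_dderiv _ IH) => v [c lk].
by split; split=> //; apply: leqW.
Qed.

Lemma hyper_eq_vars ik : vars_in (fun v => v = (hyper_eq ik).1 \/ no_constant_u v /\ (v.2 <= ik.2)%N)
  (hyper_eq ik).2.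
Proof.
rewrite [(hyper_eq ik).2](iter_hyperplane n dd).
apply: monomials_inD; first by apply: vars_inX; left.
by apply: vars_inW (@linear_part_iter_vars ik.1 ik.2) => v; right.
Qed.

Lemma char_eq_vars tk : vars_in (fun v => exists2 w, v = (inl w.1, w.2) & le w (lead tk)) (char_eq tk).2.
Proof.
rewrite [(char_eq tk).2](drenameE dd); apply: ev_closed.
- exact: monomials_in0.
- rewrite -mpolyC1E; exact: vars_inC.
- move=> a b; exact: monomials_inD.
- move=> a b; exact: vars_inM.
- move=> c; exact: vars_inC.
apply: vars_inW (prolongation_vars (delta := delta) rk ldP (t := tk.1) (k := tk.2)) => w lw.
by apply: vars_inX; exists w.
Qed.

Let before (a b : V * mpol V F) := (b.1 != a.1) && (a.1 \notin mvars b.2).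

Lemma notin_mvars (P : V -> Prop) (p : mpol V F) v : vars_in P p -> ~ P v -> v \notin mvars p.
Proof. by move=> /vars_in_subset sub nP; apply/negP => /sub. Qed.

(** The equations [P_i^(k)] come first: their leading variables are the [u_i0], which
    do not occur elsewhere. The prolongations of [A] follow by decreasing leader, as
    each of them involves only derivatives up to its own leader. *)
Lemma pairwise_fs : pairwise before fs.
Proof.
rewrite /fs pairwise_cat; apply/and3P; split.
- apply/allrelP => _ _ /mapP [ik _ ->] /mapP [tk _ ->]; rewrite /before; apply/andP; split=> //.
  by apply: (notin_mvars (@char_eq_vars tk)) => -[w].
- rewrite pairwise_map.
  have une := uniq_hyper_idx; rewrite uniq_pairwise in une.
  apply: (pairwise_impl une une) => -[i k] [i' k'] _ _ /= ne _; rewrite /before /=; apply/andP; split.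
    by apply: contra_neq ne => -[-> ->].
  apply: (notin_mvars (@hyper_eq_vars (i', k'))) => -[[ei ek]|[]] //.
  by move: ne; rewrite ei ek eqxx.
- rewrite pairwise_map.
  have une := uniq_char_idx; rewrite uniq_pairwise in une.
  have srt : pairwise (fun a b => le (lead b) (lead a)) char_idx.
    rewrite -sorted_pairwise; last by move=> a b c h1 h2; apply: rle_trans h2 h1.
    by apply: sort_sorted => a b; case: rk => [[_ _ _ tot] _ _]; apply: tot.
  apply: (pairwise_impl une srt) => a b _ _ /= ne lba; rewrite /before; apply/andP; split.
    by apply: contra_neq ne => -[h1 h2]; apply/lead_inj/esym/pair_ext.
  apply: (notin_mvars (@char_eq_vars b)) => -[w [e1 e2]].
  have -> : w = lead a by apply/esym/pair_ext.
  by move=> lab; move/negP: ne; apply; apply/eqP/lead_inj/(rle_anti rk).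
Qed.


Lemma polyX_addC_neq0 (R : nzRingType) (c : R) : 'X + c%:P != 0 :> {poly R}.
Proof.
apply/eqP => /(congr1 (fun q : {poly R} => q`_1)); rewrite coefD coefX coefC coef0 addr0.
exact/eqP/oner_neq0.
Qed.

Lemma malgC_injective (V' : choiceType) (R : comNzRingType) : injective (malgCr V' R).
Proof.
have coefE c : mcoeff mone (malgCr V' R c) = c by rewrite mcoeffC eqxx; exact: mulr1n.
move=> a b eab; rewrite -[a]coefE eab; exact: coefE.
Qed.

Lemma hyper_eq_value ik : ev iS x (hyper_eq ik).2 = 0.
Proof.
rewrite -[LHS]/(ev_chow d io D eta (iter ik.2 (dderiv delta) (@generic_hyperplane F n d ik.1))).
rewrite -(ev_chow_iter_dderiv dd eta ext) (ev_chow_hyperplane eta ext).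
elim: ik.2 => [|k IH]; first reflexivity.
rewrite iterS IH; exact: (dderiv0 (proj1 ext)).
Qed.

Lemma char_eq_value tk : ev iS x (char_eq tk).2 = 0.
Proof.
rewrite -[LHS]/(ev_chow d io D eta (drename delta (@inl 'I_n C) (iter tk.2 (dderiv delta) (A tk.1)))).
rewrite (ev_chow_inl d dd eta ext) (proj1 (generic_vanishes gen _)) ?malgC0E //.
exact: (prolongation_in csA prI).
Qed.

Lemma hyper_eq_free ik :
  ev (polyC \o iS : {rmorphism F -> {poly S}}) (free_at x (hyper_eq ik).1) (hyper_eq ik).2 != 0.
Proof.
rewrite [(hyper_eq ik).2](iter_hyperplane n dd) fevD fevX {1}/free_at eqxx free_at_constant; last first.
  apply: vars_inW (@linear_part_iter_vars ik.1 ik.2) => w [nc _]; apply: contraTneq isT => ew.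
  by rewrite ew in nc.
exact: polyX_addC_neq0.
Qed.

(** The value over [S] comes from the value over [K] given by [prolongation_free]. *)
Lemma char_eq_free tk :
  ev (polyC \o iS : {rmorphism F -> {poly S}}) (free_at x (char_eq tk).1) (char_eq tk).2 != 0.
Proof.
pose y (w : 'I_n * nat) := iter w.2 D (eta w.1).
have := prolongation_free dd ch0 rk csA ldP (iota := io) (x := y) tk.1 tk.2 (fun p => proj2 (generic_vanishes gen p)).
apply: contra_neq => e0.
pose j : {rmorphism {poly K} -> {poly S}} := map_poly (malgCr U K).
have j0 : j (ev (polyC \o io : {rmorphism F -> {poly K}}) (free_at y (lead tk))
    (iter tk.2 (dderiv delta) (A tk.1))) = 0.
  rewrite -[RHS]e0 [(char_eq tk).2](drenameE dd).
  rewrite (@rmorph_ev _ _ _ _ _ j (polyC \o iS : {rmorphism F -> {poly S}})); last first.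
    by move=> c; rewrite /= /j /= map_polyC.
  rewrite [RHS](@rmorph_ev _ _ _ (malgCr V F) _ (ev (polyC \o iS : {rmorphism F -> {poly S}})
    (free_at x (char_eq tk).1)) (polyC \o iS : {rmorphism F -> {poly S}})); last first.
    move=> c; exact/esym/fevC.
  apply: eq_ev => m _ w _; rewrite [RHS]fevX /= /free_at /j.
  have -> : ((inl w.1 : YU, w.2) == (char_eq tk).1) = (w == lead tk).
    apply/eqP/eqP => [[e1 e2]|->//]; exact: pair_ext.
  case: eqP => _; first by rewrite /= map_polyX.
  by rewrite /= map_polyC /= /x (chow_zero_y d eta ext).
apply: (map_inj_poly (@malgC_injective U K) (rmorph0 (malgCr U K))).
exact: etrans j0 (esym (rmorph0 j)).
Qed.

Lemma triangular_fs : triangular_at iS x fs.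
Proof.
split=> [a0 i j ji isz|a].
  have /(pairwiseP a0) := pairwise_fs; move/(_ j i (ltn_trans ji isz) isz ji) => /andP[h1 h2].
  split=> //; apply/vars_in_subset => v vi; apply: contraNneq h2 => <- //.
rewrite mem_cat => /orP[] /mapP [ik _ ->].
  by split; [apply: hyper_eq_value | apply: hyper_eq_free].
by split; [apply: char_eq_value | apply: char_eq_free].
Qed.

(** A constant that vanishes at the point is [0], which [triangular_fs] excludes. *)
Lemma eqs_degree_gt0 a : a \in fs -> (0 < tdeg a.2)%N.
Proof.
case: triangular_fs => _ tri /tri [e1 e2]; rewrite lt0n; apply: contra_neq e2 => t0.
have nv : a.1 \notin mvars a.2.
  apply/negP => /mvarsP [m pm mv]; have := deg_le_tdeg (p := a.2) pm; rewrite t0 leqn0 mdeg_eq0.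
  by move/eqP=> m1; move: mv; rewrite m1 cm1.
rewrite free_at_constant ?e1 //; apply/vars_in_subset => w wp.
by apply: contraNneq nv => <-.
Qed.

(** The ranking is orderly, so that a prolongation has the order of its leader. *)
Lemma eqs_vars a : a \in fs -> vars_in (fun v => v \in xs) a.2.
Proof.
rewrite mem_cat => /orP[] /mapP [[t k] tk ->].
  rewrite mem_hyper_idx in tk; apply: vars_inW (@hyper_eq_vars (t, k)) => v; rewrite mem_xs.
  by case=> [->|[_]] //= h1; apply: leq_trans tk.
rewrite mem_char_idx in tk; apply: vars_inW (@char_eq_vars (t, k)) => v; rewrite mem_xs => -[w -> lw] /=.
apply: leq_trans tk; rewrite leqNgt; apply/negP => lt2.
have := ordl w.1 (lead (t, k)).1 lt2; rewrite -!surjective_pairing => /andP[lw' ne].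
by move: ne; rewrite (rle_anti rk lw' lw) eqxx.
Qed.

Lemma leads_in a : a \in fs -> a.1 \in xs.
Proof.
rewrite mem_cat => /orP[] /mapP [[t k] tk ->]; rewrite mem_xs /=.
  by rewrite mem_hyper_idx in tk.
by rewrite mem_char_idx in tk.
Qed.

Lemma uniq_leads : uniq (map fst fs).
Proof.
rewrite uniq_pairwise pairwise_map; apply: sub_pairwise pairwise_fs => a b /andP[ne _] /=.
by rewrite eq_sym.
Qed.

Let Z : seq V := [seq v <- xs | v \notin map fst fs].

Lemma size_Z : (size Z + size fs = size xs)%N.
Proof.
rewrite -(size_map fst fs) -[RHS](count_predC (mem (map fst fs))) addnC size_filter; congr (_ + _)%N.
rewrite -size_filter; apply/perm_size/uniq_perm; rewrite ?filter_uniq ?uniq_leads ?uniq_xs //.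
move=> v; rewrite mem_filter; apply/idP/andP => [vl|[]//]; split=> //.
by case/mapP: vl => a afs ->; apply: leads_in.
Qed.

(** The variables of [Z] are the [u_ij] with [j > 0] and the parametric derivatives of
    the [y_j]. *)
Lemma independent_Z : indep_seq iS [seq x z | z <- Z].
Proof.
apply: indep_of_malg; first by rewrite filter_uniq ?uniq_xs.
move=> q vq q0; apply: (independent_at_chow_zero (D := D) (eta := eta) (I := I)
   (P := fun w => forall t, w.1 = (ld t).1 -> (w.2 < (ld t).2)%N) ext gen _ _ q0).
  by move=> c Ic; apply: (parametric_eq0 rk csA ldP Ic).
apply: vars_inW vq => -[[j|[i o]] k]; rewrite mem_filter mem_xs => /andP[nl /= kh].
  move=> t et; rewrite ltnNge; apply: contra nl => le2.
  rewrite /fs map_cat mem_cat; apply/orP; right; rewrite -map_comp; apply/mapP.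
  exists (t, k - (ld t).2)%N; first by rewrite mem_char_idx /e subnKC.
  by apply: pair_ext; rewrite /= ?subnKC // -et.
apply: contra nl => /eqP ->; rewrite /fs map_cat mem_cat; apply/orP; left.
rewrite -map_comp; apply/mapP; exists (i, k) => //; by rewrite mem_hyper_idx.
Qed.

Lemma size_Z_value : (size Z + d.+1 * h.+1 + (n - d) * h.+1 = (n + d.+1 * n.+1) * h.+1 + h)%N.
Proof. by rewrite -sum_orders addnA; congr (_ + _)%N; rewrite -size_xs -size_Z size_fs addnA. Qed.

Section ChowForm.
Variable f : mpol U F.
Hypothesis irf : irreducible f.
Hypothesis csf : forall chow_le : rel (C * nat), ranking chow_le ->
  characteristic_set chow_le (chow_ideal delta I) (fun _ : 'I_1 => f).

Let chow_le : rel (C * nat) := @graded_le ('I_d.+1 * 'I_n.+1)%type.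
Let emb (u : U) : V := (inr u.1, u.2).

Lemma chow_le_ranking : ranking chow_le.
Proof. exact: graded_ranking. Qed.

Lemma chow_leader : exists u0, is_leader chow_le f u0.
Proof. by case: (csf chow_le_ranking) => [[h' _] _ _]; apply: (h' ord0). Qed.

Lemma chow_value : ev iS (x \o emb) f = 0.
Proof.
case: (csf chow_le_ranking) => _ fI _; have := chow_ideal_vanishes dd ext gen (fI ord0).
by apply: etrans.
Qed.

Variable u0 : U.
Hypothesis u0P : is_leader chow_le f u0.

(** A relation would be an element of the Chow ideal reduced with respect to [f]. *)
Lemma independent_u us : uniq us ->
  (forall u, u \in us -> u.1 = u0.1 -> (u.2 < u0.2)%N) ->
  indep_seq iS [seq x (emb u) | u <- us].
Proof.
move=> uu us0; apply: (indep_of_malg (x := x \o emb) uu) => q vq q0.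
have cq := vanishes_chow_ideal dd ext gen q0.
apply: (parametric_eq0 chow_le_ranking (csf chow_le_ranking) (ld := fun=> u0) (fun=> u0P) cq).
by apply: vars_inW vq => u uus _; apply: us0.
Qed.

Let allU : seq U := [seq (c, k) | c <- allC, k <- seq.iota 0 h.+1].

Lemma mem_allU u : (u \in allU) = (u.2 <= h)%N.
Proof.
apply/allpairsP/idP => [[[c k] [_ ki ->]]|uh]; first by move: ki; rewrite mem_iota.
exists (u.1, u.2); rewrite mem_iota; split=> //; last by case: (u).
by case: (u.1) => i o; apply/allpairsP; exists (i, o); rewrite !mem_enum.
Qed.

Lemma size_allU : size allU = (d.+1 * n.+1 * h.+1)%N.
Proof. by rewrite size_allpairs size_iota size_allC. Qed.

Lemma uniq_allU : uniq allU.
Proof.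
apply: allpairs_uniq; rewrite ?iota_uniq ?uniq_allC //.
by move=> -[a b] [a' b'] _ _ /= [-> ->].
Qed.

(** Otherwise all the derivatives of order at most [h] of the [u_ij] are independent;
    with [d <= n] they are just one more than the dimension [size xs - size fs]. *)
Lemma leader_order : (u0.2 <= h)%N.
Proof.
rewrite leqNgt; apply/negP => lt0.
have ind : indep_seq iS [seq x (emb u) | u <- allU].
  apply: independent_u uniq_allU _ => u; rewrite mem_allU => uh _.
  exact: leq_ltn_trans uh lt0.
have sU : (size allU).-1.+1 = size allU by rewrite prednK // size_allU.
pose G := nth 0 [seq << ucm (emb u) >> : mpol V F | u <- allU].
have v0 : U by exact: u0.
have hG i : (i <= (size allU).-1)%N ->
    vars_in (fun v => v \in xs) (G i) /\ deg_le 1 (G i).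
  rewrite -ltnS sU => li; rewrite /G (nth_map v0) //; split; last exact: deg_leX.
  by apply: vars_inX; rewrite mem_xs -mem_allU mem_nth.
have hsz : (size xs <= (size allU).-1 + size fs)%N.
  rewrite -ltnS -addSn sU size_xs size_fs size_allU.
  have := sum_orders; move: (\sum_(t < _) _)%N => s.
  have [dn|nd] := leqP d n; last first.
    have -> : (n - d = 0)%N by apply/eqP; rewrite subn_eq0 ltnW.
    by nia.
  by nia.
have [Q [Q0 _ eQ]] := bezout_elimination (dg := fun a => tdeg a.2) (emb u0, 0) uniq_xs hsz hG
  (fun a afs => And3 (eqs_vars afs) (eqs_degree_gt0 afs) (@deg_le_tdeg _ _ a.2)) triangular_fs.
case/eqP: Q0; move: ind; rewrite /indep_seq size_map; move: eQ; move: Q; rewrite sU => Q eQ; apply.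
rewrite -[RHS]eQ; apply: eq_itev => i li.
rewrite /G !(nth_map v0) //; exact/esym/fevX.
Qed.

Lemma chow_vars u : u \in mvars f -> (u.2 <= h)%N.
Proof. by case: u0P => _ mx /mx /graded_order le2; apply: leq_trans le2 leader_order. Qed.

(** For [n < d] the characteristic set is empty and [h = 0]. The [u_ij] other than the
    leader of [f] are independent and more numerous than [Z], so that one of them is
    independent of [Z]; yet all of them are polynomials in [Z], the [u_i0] by [P_i]. *)
Lemma dimension_le : (d <= n)%N.
Proof.
rewrite leqNgt; apply/negP => nd.
have nd0 : (n - d = 0)%N by apply/eqP; rewrite subn_eq0 ltnW.
have h0 : h = 0%N by apply: big1 => -[t ht]; exfalso; move: ht; rewrite nd0.
have u00 : u0.2 = 0%N by apply/eqP; rewrite -leqn0 -{1}h0 leader_order.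
pose us := rem u0 allU.
have ind : indep_seq iS [seq x (emb u) | u <- us].
  apply: independent_u => [|u]; first by rewrite rem_uniq ?uniq_allU.
  rewrite mem_rem_uniq ?uniq_allU // inE mem_allU h0 leqn0 => /andP[ne /eqP e2] e1.
  by case/eqP: ne; apply: pair_ext; rewrite ?e2.
have su : size us = (size allU).-1 by rewrite size_rem // mem_allU leader_order.
have lt : (size Z < size us)%N.
  rewrite su size_allU; have := size_Z_value; rewrite h0 nd0.
  by nia.
have iZ := independent_Z; rewrite /indep_seq size_map in iZ; rewrite /indep_seq size_map in ind.
have [i li iE] := exchange iZ ind lt.
pose u := nth u0 us i; pose w := @solve_u F delta n d (emb u).
have ui : u.2 = 0%N.
  by have := mem_rem (mem_nth u0 li); rewrite -/u mem_allU h0 leqn0 => /eqP.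
have vw : vars_in (fun v => v \in Z) w.
  have inZ v : no_constant_u v -> (v.2 <= 0)%N -> v \in Z.
    move=> nc v2; rewrite mem_filter mem_xs h0 v2 andbT /fs map_cat mem_cat negb_or.
    apply/andP; split; apply/negP => /mapP [a /mapP [[t k] _ ->] ev]; first by rewrite ev in nc.
    by case: (t) => j; rewrite nd0.
  rewrite /w /solve_u /=; case: unliftP => [j uj|_].
    apply: vars_inX; apply: inZ; last by rewrite [(emb u).2]ui.
    by rewrite /no_constant_u /= uj.
  rewrite ui; apply: monomials_inN; apply: linear_part_vars => j; exact: inZ.
have xw : ev iS x w = x (emb u).
  have <- : @solve F delta n d << ucm (emb u) >> = w by exact: fevX.
  apply: etrans (ev_chow_solve dd eta ext _) _; exact: ev_chow_X.
pose c := malg_it F Z (size Z) w.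
pose p : {poly itp F (size Z)} := 'X - c%:P.
have p0 : p != 0 by apply: monic_neq0; exact: monicXsubC.
case/eqP: p0; apply: iE.
rewrite itevS eqxx; set g := itev _ _ _.
have gc : g c = x (emb u).
  rewrite -xw -(malg_itK (n := size Z) erefl vw) (ev_it_malg (n := size Z) erefl).
  by apply: eq_itev => k kZ; rewrite ltn_eqF.
rewrite /p rmorphB /= map_polyX map_polyC hornerXsubC /= gc (nth_map u0) //.
exact: subrr.
Qed.

Lemma chow_degree_eqs : (tdeg f <= \prod_(a <- fs) tdeg a.2)%N.
Proof.
have iws : indep_seq iS [seq x (emb u) | u <- enum_fset (mvars f `\ u0)%fset].
  apply: independent_u (fset_uniq _) _ => u; rewrite in_fsetD1 => /andP[ne uf] e1.
  case: u0P => _ mx; have := mx u uf; rewrite /chow_le /graded_le e1 leqnn andbT.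
  case/orP => // /eqP e2; by case/eqP: ne; apply: pair_ext.
pose c0 : C := (ord0, ord0).
apply: (projection_degree (iota := iS) (x := x) (emb := emb) (tau := (inr c0, h.+1)) (Z := Z) (u0 := u0)
   (fresh := fun k => (c0, (h.+1 + k)%N)) ch0 uniq_xs).
- by rewrite mem_xs ltnn.
- by move=> a afs; split; [apply: eqs_vars | apply: eqs_degree_gt0 | apply: deg_le_tdeg].
- exact: triangular_fs.
- by move=> v; rewrite mem_filter => /andP[].
- by rewrite size_Z.
- exact: independent_Z.
- exact: irf.
- by move=> u uf; rewrite mem_xs; apply: chow_vars.
- exact: chow_value.
- by case: u0P.
- exact: iws.
- by move=> i j [] /addnI.
- by move=> k; apply/negP => /chow_vars /=; rewrite addSn ltnNge leq_addr.
Qed.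
End ChowForm.

Lemma tdeg_le (V' : choiceType) (p : mpol V' F) k : deg_le k p -> (tdeg p <= k)%N.
Proof. by move=> hp; apply/bigmax_leqP_seq => m mp _; apply: hp; rewrite mcoeff_neq0. Qed.

Lemma hyper_eq_degree ik : (tdeg (hyper_eq ik).2 <= 2)%N.
Proof.
apply: tdeg_le; rewrite /hyper_eq /=; elim: ik.2 => [|k IH]; last first.
  by rewrite iterS; apply: deg_le_dderiv.
apply: monomials_inD; first exact: deg_leX.
apply: monomials_in_sum => j _; apply: (@deg_leM _ _ 1 1); exact: deg_leX.
Qed.

Lemma drename_degree (J J' : choiceType) (g : J -> J') (p : mpol (J * nat)%type F) k :
  deg_le k p -> deg_le k (drename delta g p).
Proof.
move=> hp; rewrite (drenameE dd) evE big_seq; apply: monomials_in_sum => m mp.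
rewrite -[k]add0n; apply: deg_leM; first exact: deg_leC.
apply: deg_leW (hp m _) _; first by rewrite mcoeff_neq0.
rewrite mdegE; apply: deg_le_prod => v; rewrite -{1}[m v]mul1n.
apply: deg_le_exp; exact: deg_leX.
Qed.

Lemma char_eq_degree tk : (tdeg (char_eq tk).2 <= ddeg (A tk.1))%N.
Proof.
apply/tdeg_le/drename_degree/prolongation_degree; exact/ddeg_leP.
Qed.

(** Bezout's inequality for the projection to the [u]-space. *)
Theorem chow_degree (f : mpol U F) : is_differential_chow_form delta I f ->
  (d <= n)%N /\
  (ddeg f <= 2 ^ (h.+1 * d.+1) * \prod_(t < n - d) ddeg (A t) ^ (h - e t).+1)%N.
Proof.
case=> irf csf; have [u0 u0P] := chow_leader csf; split; first exact: (dimension_le csf u0P).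
apply: leq_trans (chow_degree_eqs irf csf u0P) _.
rewrite /fs big_cat /= !big_map; apply: leq_mul.
  apply: leq_trans (_ : \prod_(ik <- hyper_idx) 2 <= _)%N.
    by apply: leq_prod => ik _; apply: hyper_eq_degree.
  by rewrite big_const_seq count_predT iter_muln_1 size_hyper_idx mulnC.
apply: leq_trans (_ : \prod_(tk <- char_idx) ddeg (A tk.1) <= _)%N.
  by apply: leq_prod => tk _; apply: char_eq_degree.
rewrite (perm_big _ (permEl (perm_sort _ _))) big_allpairs_dep big_enum /=.
apply: eq_leq; apply: eq_bigr => t _.
by rewrite big_const_seq count_predT iter_muln_1 /= size_iota.
Qed.
End ChowDegree.

Theorem theorem13 (F : fieldType) (delta : F -> F) (n d : nat)
    (I : dpoly 'I_n F -> Prop) (le : rel ('I_n * nat))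
    (A : 'I_(n - d) -> dpoly 'I_n F) (f : dpoly (chow_index n d) F) :
  [pchar F] =i pred0 ->
  derivation delta ->
  prime_differential_ideal (dderiv delta) I ->
  differential_dimension delta I d ->
  ranking le -> orderly le ->
  characteristic_set le I A ->
  is_differential_chow_form delta I f ->
  let e i := dord (A i) in
  let m i := ddeg (A i) in
  let h := (\sum_(i < n - d) e i)%N in
  let D := maxn 2 (\max_(i < n - d) m i) in
  (ddeg f <= 2 ^ (h.+1 * d.+1) * (\prod_(i < n - d) m i ^ (h - e i + 1))
             * (2 * (\sum_(i < n - d) (m i - 1)) + 1))%N /\
  (ddeg f < (n - d + 1) * D ^ (n * h + n + 3))%N.
Proof.
move=> ch0 dd prI [K [io [D [eta [ext gen _]]]]] rk ordl csA cf e m h Dm.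
have exld t : {v | is_leader le (A t) v}.
  by apply: constructive_indefinite_description; case: csA => [[ex _] _ _]; apply: ex.
pose ld t := sval (exld t); have ldP t : is_leader le (A t) (ld t) := svalP (exld t).
have ee t : (ld t).2 = e t by rewrite /e (dord_leader rk ldP t ordl).
have [dn] := chow_degree ch0 dd prI rk ordl csA ext gen ldP cf.
have -> : (\sum_(t < n - d) (ld t).2 = h)%N by apply: eq_bigr => t _; apply: ee.
move=> bf; have eP : (\prod_(t < n - d) ddeg (A t) ^ (h - (ld t).2).+1 =
    \prod_(t < n - d) m t ^ (h - e t + 1))%N by apply: eq_bigr => t _; rewrite addn1 ee.
rewrite {}eP in bf; split.
  (* The last factor is at least $1$. *)
  by apply: leq_trans bf _; rewrite -[X in (X <= _)%N]muln1 leq_mul2l addn1 orbT.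
have D2 : (2 <= Dm)%N by rewrite leq_maxl.
have mD t : (m t <= Dm)%N by rewrite leq_max (leq_bigmax t) orbT.
have D0 : (0 < Dm)%N by apply: leq_trans D2.
have bD : (ddeg f <= Dm ^ (n * h + n + 1))%N.
  apply: leq_trans bf _.
  (* This count of the equations uses $d \leq n$. *)
  have -> : (n * h + n + 1 = h.+1 * d.+1 + \sum_(t < n - d) (h - e t + 1))%N.
    rewrite (eq_bigr (fun t => (h - e t).+1)) => [|t _]; last by rewrite addn1.
    have := sum_complements e; rewrite /= -/h; move: (\sum_(t < _) _)%N => s; move: dn; nia.
  rewrite expnD expn_sum; apply: leq_mul; first by rewrite leq_exp2r.
  by apply: leq_prod => t _; rewrite leq_exp2r // addn1.
apply: leq_ltn_trans bD _; apply: leq_trans (_ : Dm ^ (n * h + n + 3) <= _)%N.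
  by rewrite ltn_exp2l // ltn_add2l.
by rewrite leq_pmull // addn1.
Qed.
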